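(* Let $\rho\in(0,1)$ and let $T_n=(\gamma(i-j))_{i,j=1}^n$, $n\ge1$, be positive semi-definite Toeplitz matrices with $\gamma(h)=\dfrac{L_1(|h|)}{(1+|h|)^{\rho}}$ for $h\in\mathbb Z$, where $L_1$ is a positive, locally bounded function on $[0,\infty)$ which is slowly varying at $\infty$. For any $j\ge 1$, let $f_j$ be the normalized eigenfunction of $\mathcal K^{(\rho)}$ associated with $\lambda_j(\mathcal K^{(\rho)})$, and let $u_j=(u_{j,1},\dots,u_{j,n})^\top$ be a normalized eigenvector of $T_n$ associated with $\lambda_j(T_n)$. Then, up to a change of sign (of $u_j$, for each $n$), $$\lim_{n\to\infty}\ \sup_{1\le k\le n}\left|\sqrt n\,u_{j,k}-f_j\!\left(\frac kn\right)\right|=0 .$$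
   Context: $\mathcal K^{(\rho)}$ is the operator on $L^2(0,1)$ given by $(\mathcal K^{(\rho)}f)(x)=\int_0^1|x-y|^{-\rho}f(y)\,\mathrm dy$. It is compact, self-adjoint and positive semi-definite, with infinitely many positive eigenvalues. For a Hermitian matrix or operator $A$, $\lambda_1(A)\ge\lambda_2(A)\ge\cdots$ are its eigenvalues in decreasing order. ''Normalized'' means of $L^2$ (resp. $\ell^2$) norm one; $f_j$ and $u_j$ are taken real-valued, and $f_j$ denotes the representative continuous on $[0,1]$. A positive function $L$ is slowly varying at $\infty$ if $L(ax)/L(x)\to1$ as $x\to\infty$ for every $a>0$.
   Formalization: The slowly varying function L_1 is additionally assumed Lebesgue measurable on [0,∞), as in Karamata's standard definition; without measurability the statement fails for pathological L_1 built from a Hamel basis. *)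

(* Defs.v *)
From HB Require Import structures.
From mathcomp Require Import all_boot all_order all_algebra.
From mathcomp Require Import all_classical all_reals all_analysis measurable_realfun.

Set Implicit Arguments.
Unset Strict Implicit.
Unset Printing Implicit Defensive.

Import Order.TTheory GRing.Theory Num.Theory.
Import numFieldNormedType.Exports.

Local Open Scope classical_set_scope.
Local Open Scope ring_scope.

(* Measurability for the completed Lebesgue sigma-algebra; it is implied by
   [measurable_fun D f], which refers to Borel sets only. *)
Definition lebesgue_measurable_fun {R : realType} (D : set R) (f : R -> R) :=
  forall B : set R, measurable B ->
    completed_algebra_gen (@lebesgue_measure R) (D `&` f @^-1` B).

(* No measurability here: it is a separate hypothesis of the theorem. *)
Definition slowly_varying {R : realType} (L : R -> R) :=
  (forall x, 0 <= x -> 0 < L x) /\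
  (forall a, 0 < a -> L (a * x) / L x @[x --> +oo] --> (1 : R)).

Definition autocov {R : realType} (rho : R) (L : R -> R) (h : int) : R :=
  L `|h|%N%:R / (1 + `|h|%N%:R) `^ rho.

Definition toeplitz {R : realType} (gamma : int -> R) (n : nat) : 'M[R]_n :=
  \matrix_(i < n, j < n) gamma (i%:Z - j%:Z).

Definition positive_semidefinite {R : realType} (n : nat) (A : 'M[R]_n) :=
  A^T = A /\ forall v : 'cV[R]_n, 0 <= (v^T *m A *m v) 0 0.

(* [mu] is lambda_j(A), for 1 <= j <= n: the eigenvalues are the roots of the
   characteristic polynomial, listed with multiplicity in decreasing order. *)
Definition mx_lambda {R : realType} (n : nat) (A : 'M[R]_n) (j : nat)
    (mu : R) :=
  exists s : seq R,
    [/\ sorted >=%R s, char_poly A = \prod_(x <- s) ('X - x%:P),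
        (0 < j <= size s)%N & mu = s`_j.-1].

Definition mx_normalized_eigenvector {R : realType} (n : nat) (A : 'M[R]_n)
    (mu : R) (u : 'cV[R]_n) :=
  A *m u = mu *: u /\ \sum_(k < n) u k 0 ^+ 2 = 1.

(* Elements of L^2(0,1) are represented by real functions on the line, whose
   values outside ]0, 1[ are irrelevant. *)
Definition L2 {R : realType} (f : R -> R) : Prop :=
  f \_ `]0, 1[ \in Lfun (@lebesgue_measure R) 2%:E.

Definition L2_inner {R : realType} (f g : R -> R) : R :=
  \int[@lebesgue_measure R]_(x in `]0, 1[) (f x * g x).

Definition L2_eq {R : realType} (f g : R -> R) :=
  {ae @lebesgue_measure R, forall x, x \in `]0, 1[ -> f x = g x}.

(* For [f] in L^2(0,1) the integral converges for almost every [x] only; the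
   junk value of the total integral elsewhere is invisible to [L2_eq]. *)
Definition riesz_op {R : realType} (rho : R) (f : R -> R) (x : R) : R :=
  \int[@lebesgue_measure R]_(y in `]0, 1[) (`|x - y| `^ (- rho) * f y).

Definition riesz_eigen {R : realType} (rho mu : R) (f : R -> R) :=
  L2 f /\ L2_eq (riesz_op rho f) (fun x => mu * f x).

(* [lam i] is lambda_(i+1) of [riesz_op rho]: a decreasing enumeration of the
   positive eigenvalues, each repeated according to its multiplicity.  There are
   infinitely many of them, so none is missed by an enumeration along [nat]. *)
Definition riesz_spectrum {R : realType} (rho : R) (lam : nat -> R) :=
  (forall i, 0 < lam i.+1 <= lam i) /\
  exists phi : nat -> R -> R,
    [/\ forall i, riesz_eigen rho (lam i) (phi i),
        forall i k, L2_inner (phi i) (phi k) = (i == k)%:R &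
        forall mu g, 0 < mu -> riesz_eigen rho mu g ->
          (forall i, L2_inner g (phi i) = 0) -> L2_eq g (fun=> 0)].

(* [mu] is lambda_j of [riesz_op rho], for j >= 1. *)
Definition riesz_lambda {R : realType} (rho : R) (j : nat) (mu : R) :=
  (0 < j)%N /\ exists2 lam, riesz_spectrum rho lam & mu = lam j.-1.

(* The representative of an eigenfunction that is continuous on [0, 1]. *)
Definition riesz_normalized_eigenfunction {R : realType} (rho mu : R)
    (f : R -> R) :=
  [/\ {within `[0, 1], continuous f}, riesz_eigen rho mu f &
      L2_inner f f = 1].

(* Main.v *)
Require Import Defs.
From HB Require Import structures.
From mathcomp Require Import all_boot all_order all_algebra.
From mathcomp Require Import all_classical all_reals all_analysis measurable_realfun.
From mathcomp Require Import ring lra zify.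

Set Implicit Arguments.
Unset Strict Implicit.
Unset Printing Implicit Defensive.

Import Order.TTheory GRing.Theory Num.Theory.
Import numFieldNormedType.Exports.

Local Open Scope classical_set_scope.
Local Open Scope ring_scope.

(** Put c_n = n^(1 - rho) L1(n).  On samples v_l of a function at the points
    (l+1)/n, the matrix T_n / c_n acts as the quadrature rule

      (1/n) sum_l w_n(|k - l|) v_l,
      w_n(h) = (n^rho / L1(n)) (L1(h) / (1 + h)^rho),

    and w_n(h) is close to |h/n|^(-rho).  Away from the diagonal this is the
    uniform convergence theorem for slowly varying functions
    ([slowly_varying_uniform]); near the diagonal Potter's bound
    ([potter_bound]) shows that the weights carry little mass.  Together they say
    that, uniformly on bounded vectors, T_n / c_n is as close as desired to the
    quadrature rule of a kernel truncated at a fixed height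
    ([scaled_toeplitz_trunc]).  Two consequences follow.  T_n / c_n is consistent
    with the integral operator K on continuous functions
    ([scaled_toeplitz_consistent]).  Eigenvectors of T_n / c_n whose eigenvalues
    stay away from 0, normalized so that their mean square is 1, are uniformly
    bounded and equicontinuous ([eigvec_bounded], [eigvec_equicontinuous]).

    By a discrete version of the theorem of Ascoli ([ultra_ascoli]) these
    eigenvectors have uniform limits, along any ultrafilter on the indices n; the
    limits g_1, g_2, ... are continuous orthonormal eigenfunctions of K, and the
    eigenvalue nu_i of g_i is the limit of lambda_i(T_n) / c_n.  The
    Courant-Fischer principle with sampled eigenfunctions of K as test vectors
    gives nu_i >= lambda_i(K) ([eigenvalue_liminf]).

    It remains to see that nu_i = lambda_i(K) and that the limit is determined up
    to sign.  Both rest on the simplicity of the positive eigenvalues of K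
    ([riesz_eigenfunction_sign]).  If nu_1, ..., nu_(i-1) are already known to
    be lambda_1, ..., lambda_(i-1), then nu_i is none of them, since g_i would
    be a multiple of an earlier g_k; being an eigenvalue of K and at least
    lambda_i, it is lambda_i.  Hence g_j is f_j or - f_j, and since this holds
    along every ultrafilter the convergence is genuine ([ultra_eventually]).

    Simplicity is proved by a dilation argument: an eigenfunction that vanishes
    at the endpoint 1 is zero ([riesz_eigenfunction_endpoint]), and two
    eigenfunctions for one eigenvalue have a nontrivial combination that vanishes
    at 1. *)

(** * Powers and the truncated kernel *)
Section powers.
Context {R : realType}.
Implicit Types a p s t e rho : R.

(** The factor 1/2 pays for replacing exp (- d) by 1 / (1 + d), which avoids any
    derivative. *)
Lemma one_sub_powR_ge a p : 0 < a <= 1 -> 0 < p <= 1 ->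
  p / 2 * (1 - a) <= 1 - a `^ p.
Proof.
move=> /andP[a0 a1] /andP[p0 p1].
have lnle : ln a <= a - 1 by rewrite -[X in ln X](subrK 1 a) addrC; apply: le_ln1Dx; lra.
rewrite /powR gt_eqF//.
set d := p * (1 - a).
have d0 : 0 <= d by rewrite mulr_ge0//; lra.
have d1 : d <= 1 by rewrite mulr_ile1//; lra.
have h1 : expR (p * ln a) <= expR (- d).
  by rewrite ler_expR /d -mulrN ler_pM2l//; lra.
have h2 : expR (- d) <= (1 + d)^-1.
  rewrite expRN lef_pV2 ?posrE ?expR_gt0//; [exact: expR_ge1Dx|lra].
suff : d / 2 <= 1 - (1 + d)^-1 by rewrite /d; lra.
have -> : 1 - (1 + d)^-1 = d / (1 + d) by field; lra.
by rewrite ler_wpM2l// lef_pV2 ?posrE; lra.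
Qed.

Lemma powRN_lipschitz rho e s t : 0 < rho <= 1 -> 0 < e -> e <= s -> e <= t ->
  `|s `^ (- rho) - t `^ (- rho)| <= e `^ (- rho) / e * `|s - t|.
Proof.
move=> /andP[r0 r1] e0; wlog st : s t / s <= t.
  move=> H es et; have [|/ltW] := leP s t; first by move=> ?; exact: H.
  by move=> ts; rewrite distrC (distrC s); exact: H.
move=> es et.
have s0 : 0 < s by lra.
have t0 : 0 < t by lra.
have mono x y : 0 < x -> x <= y -> y `^ (- rho) <= x `^ (- rho).
  move=> x0 xy; rewrite !powRN lef_pV2 ?posrE ?powR_gt0//; last by lra.
  by rewrite ge0_ler_powR ?nnegrE; lra.
have := mono s t s0 st => tsr.
rewrite ger0_norm ?subr_ge0// ler0_norm; last by lra.
have -> : t `^ (- rho) = s `^ (- rho) * (s / t) `^ rho.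
  rewrite powRM ?invr_ge0; [|lra|lra].
  rewrite -powR_inv1; last by lra.
  rewrite -powRrM mulN1r mulrA -powRD; last by rewrite (gt_eqF s0) implybT.
  by rewrite addNr powRr0 mul1r.
have q1 : s / t <= 1 by rewrite ler_pdivrMr// mul1r.
have q0 : 0 < s / t by rewrite divr_gt0.
have qr : s / t <= (s / t) `^ rho by apply: ger1_powR; rewrite ?q0.
apply: (@le_trans _ _ (s `^ (- rho) * (1 - s / t))).
  by have := powR_ge0 s (- rho); nra.
have -> : 1 - s / t = (t - s) / t by field; lra.
rewrite opprB -mulrA [e^-1 * _]mulrC; apply: ler_pM; rewrite ?powR_ge0 ?mono//.
  by rewrite divr_ge0; lra.
by rewrite ler_wpM2l ?subr_ge0// lef_pV2 ?posrE.
Qed.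

Lemma sum_powRN_le p (m : nat) : 0 < p <= 1 ->
  \sum_(h < m) (h.+1%:R : R) `^ (p - 1) <= 2 / p * m%:R `^ p.
Proof.
move=> /andP[p0 p1]; elim: m => [|m IH]; first by rewrite big_ord0 mulr_ge0 ?powR_ge0//; rewrite divr_ge0; lra.
rewrite big_ord_recr/=; apply: (le_trans (lerD IH (lexx _))).
have [->|m0] := eqVneq m 0%N.
  rewrite powR1 powR0 ?gt_eqF// mulr0 add0r.
  by rewrite mulr1 ler_pdivlMr ?mul1r; lra.
have mS0 : 0 < (m.+1%:R : R) by [].
have m0' : 0 < (m%:R : R) by rewrite ltr0n lt0n.
have := @one_sub_powR_ge (m%:R / m.+1%:R) p.
rewrite divr_gt0//= ler_pdivrMr// mul1r ler_nat leqnSn p0 => /(_ isT p1).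
rewrite powRM ?invr_ge0; [|lra|lra].
have -> : (m.+1%:R : R) `^ (p - 1) = m.+1%:R `^ p / m.+1%:R.
  by rewrite powRD ?(gt_eqF mS0) ?implybT// powR_inv1//.
have -> : ((m.+1%:R : R) ^-1) `^ p = (m.+1%:R `^ p)^-1.
  by rewrite -powR_inv1// -powRrM mulN1r powRN.
have P0 : 0 < (m.+1%:R : R) `^ p by rewrite powR_gt0.
have -> : 1 - m%:R / m.+1%:R = (m.+1%:R)^-1 :> R by rewrite -natr1; field; rewrite natr1 gt_eqF.
set A := m%:R `^ p; set B := m.+1%:R `^ p in P0 *; set C := m.+1%:R^-1 => H.
have H1 : p / 2 * C * B <= B - A.
  by have := ler_wpM2r (ltW P0) H; rewrite mulrBl mul1r divfK ?gt_eqF.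
have : 2 / p * (p / 2 * C * B) <= 2 / p * (B - A).
  by rewrite ler_wpM2l// divr_ge0; lra.
have -> : 2 / p * (p / 2 * C * B) = B * C by field; rewrite gt_eqF.
lra.
Qed.

Lemma powR_small s (eta : R) : 0 < s -> 0 < eta ->
  exists2 e0 : R, 0 < e0 & forall e, 0 <= e <= e0 -> e `^ s <= eta.
Proof.
move=> s0 eta0; exists (eta `^ s^-1); first by rewrite powR_gt0.
move=> e /andP[e0 ee].
have := @ge0_ler_powR R s (ltW s0) _ _ _ _ ee.
rewrite -powRrM mulVf ?gt_eqF// powRr1 ?(ltW eta0)// => H; apply: H; rewrite nnegrE//.
exact: powR_ge0.
Qed.

(** Two quantities [a] and [c] are compared through their approximations [b]
    and [d]. *)
Lemma ler_dist_chain (a b c d p q r : R) :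
  `|a - b| <= p -> `|c - d| <= q -> `|b - d| <= r -> `|a - c| <= p + q + r.
Proof. by rewrite !ler_norml => /andP[? ?] /andP[? ?] /andP[? ?]; lra. Qed.

(** Truncating the distance, rather than the value, makes the truncated kernel
    Lipschitz and leaves it unchanged outside a ball around the singularity. *)
Definition trunc_ker rho e t : R := Num.max `|t| e `^ (- rho).

Lemma trunc_ker_ge0 rho e t : 0 <= trunc_ker rho e t.
Proof. exact: powR_ge0. Qed.

Lemma trunc_ker_lipschitz rho e s t : 0 < rho <= 1 -> 0 < e ->
  `|trunc_ker rho e s - trunc_ker rho e t| <= e `^ (- rho) / e * `|s - t|.
Proof.
move=> hr e0; apply: (le_trans (powRN_lipschitz hr e0 _ _)); rewrite ?le_max ?lexx ?orbT//.
apply: ler_wpM2l; first by rewrite divr_ge0 ?powR_ge0 ?ltW.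
have := ler_dist_dist s t.
have nn : 0 <= `|s - t| by [].
case: (ltP `|s| e) => ?; case: (ltP `|t| e) => ?; rewrite ?subrr ?normr0//;
  rewrite !ler_norml => /andP[? ?]; lra.
Qed.

Lemma trunc_ker_le rho e t : 0 < rho <= 1 -> 0 < e -> trunc_ker rho e t <= e `^ (- rho).
Proof.
move=> hr e0; rewrite /trunc_ker !powRN lef_pV2 ?posrE ?powR_gt0//; last by rewrite lt_max e0 orbT.
by rewrite ge0_ler_powR ?nnegrE ?le_max ?lexx ?orbT//; lra.
Qed.

Lemma trunc_ker_far rho e t : e <= `|t| -> trunc_ker rho e t = `|t| `^ (- rho).
Proof. by move=> h; rewrite /trunc_ker max_l. Qed.

End powers.

(** * Mass of the kernel near its singularity *)
Section affine.
Context {R : realType}.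
Notation mu := (@lebesgue_measure R).
Variables (c d : R).
Hypothesis c0 : c != 0.

Let phi : R -> measurableTypeR R := fun t => c * t + d.

Let mphi : measurable_fun [set: R] phi.
Proof. by apply: measurable_funD => //; exact: mulrl_measurable. Qed.

Let image_mu := measure_function_pushforward__canonical__measure_function_Measure
  (@lebesgue_measure R) mphi.

Let nu := mscale (NngNum (normr_ge0 c)) image_mu.

(** The left side is a measure that gives half-open intervals their length, and
    such a measure is unique. *)
Lemma lebesgue_measure_affine (A : set R) : measurable A ->
  (`|c|%:E * mu (phi @^-1` A) = mu A)%E.
Proof.
move=> mA; suff : mu A = nu A by move=> ->.
apply: lebesgue_measure_unique => // _ [[a b] /= ab <-].
rewrite /nu /mscale/= /pushforward.
case: (ltgtP c 0) c0 => // c0' _.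
- have -> : phi @^-1` `]a, b] = `[(b - d) / c, (a - d) / c[%classic.
    apply/seteqP; split => t /=; rewrite !in_itv/= /phi => /andP[h1 h2].
      by rewrite ler_ndivrMr// ltr_ndivlMr//; apply/andP; split; lra.
    move: h1 h2; rewrite ler_ndivrMr// ltr_ndivlMr// => h1 h2.
    by apply/andP; split; lra.
  rewrite [LHS]lebesgue_measure_itv [in RHS]lebesgue_measure_itv/= !lte_fin.
  rewrite ltr_ndivrMr// divfK ?lt_eqF// ltrD2r.
  case: ltP => _; rewrite ?mule0// -!EFinD -EFinM; congr EFin.
  by rewrite ltr0_norm//; field; rewrite lt_eqF.
- have -> : phi @^-1` `]a, b] = `](a - d) / c, (b - d) / c]%classic.
    apply/seteqP; split => t /=; rewrite !in_itv/= /phi => /andP[h1 h2].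
      by rewrite ltr_pdivrMr// ler_pdivlMr//; apply/andP; split; lra.
    move: h1 h2; rewrite ltr_pdivrMr// ler_pdivlMr// => h1 h2.
    by apply/andP; split; lra.
  rewrite [LHS]lebesgue_measure_itv [in RHS]lebesgue_measure_itv/= !lte_fin.
  rewrite ltr_pdivrMr// divfK ?gt_eqF// ltrD2r.
  case: ltP => _; rewrite ?mule0// -!EFinD -EFinM; congr EFin.
  by rewrite gtr0_norm//; field; rewrite gt_eqF.
Qed.

Lemma ge0_integral_affine (f : R -> \bar R) : measurable_fun [set: R] f ->
  (forall t, (0 <= f t)%E) ->
  (\int[mu]_t f t = `|c|%:E * \int[mu]_t f (c * t + d)%R)%E.
Proof.
move=> mf f0.
have -> : (\int[mu]_t f t = \int[nu]_t f t)%E.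
  apply: eq_measure_integral => A mA _.
  exact: (esym (lebesgue_measure_affine mA)).
rewrite ge0_integral_mscale//; congr (_ * _)%E.
by rewrite ge0_integral_pushforward//= preimage_setT.
Qed.

End affine.

Section kernel_integral.
Context {R : realType}.
Notation mu := (@lebesgue_measure R).
Variable rho : R.
Hypothesis hrho : 0 < rho < 1.

Let rho0 : 0 < rho. Proof. by case/andP: hrho. Qed.
Let rho1 : rho < 1. Proof. by case/andP: hrho. Qed.

Lemma measurable_ker x : measurable_fun [set: R] (fun y : R => `|x - y| `^ (- rho)).
Proof.
apply: (@measurableT_comp _ _ _ _ _ _ (@powR R ^~ (- rho))) => //.
apply: measurableT_comp => //.
exact: measurable_funB.
Qed.

Lemma integral_powRN_segment (d e : R) : 0 < d -> d < e ->
  (\int[mu]_(t in `[d, e]) (t `^ (- rho))%:E <= (e `^ (1 - rho) / (1 - rho))%:E)%E.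
Proof.
move=> d0 de.
have r1 : 1 - rho != 0 by rewrite gt_eqF// subr_gt0.
have der (x : R) : 0 < x -> is_derive x 1 (fun t => (1 - rho)^-1 * t `^ (1 - rho)) (x `^ (- rho)).
  move=> x0; have := @is_derive1_powR R (1 - rho) x x0 => D.
  apply: is_derive_eq.
  rewrite (_ : 1 - rho - 1 = - rho); last by lra.
  by rewrite /GRing.scale/= mulrA mulVf// mul1r.
have cont (x : R) : 0 < x -> {for x, continuous (fun t => (1 - rho)^-1 * t `^ (1 - rho))}.
  move=> x0; apply/differentiable_continuous/derivable1_diffP.
  by have [] := der x x0.
rewrite (@continuous_FTC2 _ _ (fun t => (1 - rho)^-1 * t `^ (1 - rho)))//.
- rewrite -EFinB lee_fin mulrC lerBlDr lerDl mulr_ge0 ?powR_ge0// invr_ge0.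
  by rewrite subr_ge0 ltW.
- apply: continuous_in_subspaceT => x; rewrite inE/= in_itv/= => /andP[dx _].
  apply/differentiable_continuous/derivable1_diffP/derivable_powR.
  by rewrite in_itv/= andbT; lra.
- split.
  + move=> x; rewrite in_itv/= => /andP[dx _].
    by have [] := der x (lt_trans d0 dx).
  + exact/cvg_at_right_filter/cont.
  + exact/cvg_at_left_filter/cont/(lt_trans d0).
- move=> x; rewrite in_itv/= => /andP[dx _].
  by rewrite derive1E; have [] := der x (lt_trans d0 dx).
Qed.

(** The integrand is unbounded at 0, so the fundamental theorem of calculus is
    applied on segments that exhaust the half-open interval. *)
Lemma integral_powRN_ball0 (e : R) : 0 < e ->
  (\int[mu]_(t in `]0%R, e]) (t `^ (- rho))%:E <= (e `^ (1 - rho) / (1 - rho))%:E)%E.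
Proof.
move=> e0; pose F (i : nat) := `[e / i.+2%:R, e]%classic.
have FE : `]0, e]%classic = \bigcup_i F i.
  apply/seteqP; split => [t|t [i _]]; rewrite /= ?/F/= !in_itv/=.
    move=> /andP[t0 te]; exists (Num.truncn (e / t)) => //=; rewrite in_itv/= te andbT.
    rewrite ler_pdivrMr// mulrC -ler_pdivrMr//.
    apply: ltW; apply: lt_le_trans (truncnS_gt _) _.
    by rewrite ler_nat.
  by move=> /andP[t0 ->]; rewrite andbT; apply: lt_le_trans t0; rewrite divr_gt0.
rewrite FE.
apply: (cvge_le _ (ge0_nondecreasing_set_cvg_integral _ _ _ _)).
- apply: nearW => i; apply: integral_powRN_segment; first by rewrite divr_gt0.
  by rewrite ltr_pdivrMr// ltr_pMr// ltr1n.
- move=> i j ij; apply/subsetPset => t; rewrite /F/= !in_itv/= => /andP[h ->].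
  rewrite andbT; apply: le_trans h; rewrite ler_wpM2l ?(ltW e0)//.
  by rewrite lef_pV2 ?posrE// ler_nat.
- by move=> i; exact: measurable_itv.
- by move=> i; apply/measurable_EFinP; apply: measurable_funTS; exact: measurable_powR.
- by move=> i x _; rewrite lee_fin powR_ge0.
Qed.

Lemma measurable_trunc_ker (e : R) : measurable_fun [set: R] (trunc_ker rho e).
Proof.
apply: (@measurableT_comp _ _ _ _ _ _ (@powR R ^~ (- rho))) => //.
by apply: measurable_maxr => //; exact: normr_measurable.
Qed.

Definition trunc_error (e t : R) : R := `| `|t| `^ (- rho) - trunc_ker rho e t|.

Lemma measurable_trunc_error e : measurable_fun [set: R] (trunc_error e).
Proof.
apply: measurableT_comp => //; apply: measurable_funB; last exact: measurable_trunc_ker.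
apply: (@measurableT_comp _ _ _ _ _ _ (@powR R ^~ (- rho))) => //.
Qed.

Let trunc_error_le e t : 0 < e -> 0 < t -> trunc_error e t <= t `^ (- rho).
Proof.
move=> e0 t0; rewrite /trunc_error /trunc_ker (gtr0_norm t0).
case: (ltP t e) => te; last by rewrite subrr normr0 powR_ge0.
rewrite ger0_norm ?lerBlDr ?lerDl ?powR_ge0// subr_ge0.
rewrite !powRN lef_pV2 ?posrE ?powR_gt0//.
by rewrite ge0_ler_powR ?nnegrE// ltW.
Qed.

(** The integral of |t|^(-rho) over the ball of radius [e] around 0. *)
Definition near_mass (e : R) : R := 2 * (e `^ (1 - rho) / (1 - rho)).

Let g1 (e t : R) : \bar R := (((trunc_error e) \_ `[0, e]) t)%:E.

Let mg1 e : measurable_fun [set: R] (g1 e).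
Proof.
apply/measurable_EFinP/(measurable_restrictT _ _).1 => //.
exact: measurable_funTS (measurable_trunc_error e).
Qed.

Let g1_ge0 e t : (0 <= g1 e t)%E.
Proof. by rewrite lee_fin /patch; case: ifP => // _; rewrite normr_ge0. Qed.

Let integral_g1 e : 0 < e ->
  (\int[mu]_t g1 e t <= (e `^ (1 - rho) / (1 - rho))%:E)%E.
Proof.
move=> e0; apply: le_trans (integral_powRN_ball0 e0).
have -> : (\int[mu]_t g1 e t = \int[mu]_(t in `[0%R, e]) (trunc_error e t)%:E)%E.
  by rewrite [RHS]integral_mkcond; apply: eq_integral => t _; rewrite restrict_EFin.
rewrite -integral_itv_obnd_cbnd; last first.
  by apply/measurable_EFinP; exact: measurable_funTS (measurable_trunc_error e).
apply: ge0_le_integral => //.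
- by move=> t _; rewrite lee_fin /trunc_error normr_ge0.
- by apply/measurable_EFinP; apply: measurable_funTS; exact: measurable_trunc_error.
- by apply/measurable_EFinP; apply: measurable_funTS; exact: measurable_powR.
- by move=> t /=; rewrite in_itv/= => /andP[t0 _]; rewrite lee_fin trunc_error_le.
Qed.

Let msubl (x : R) : measurable_fun [set: R] (fun y : R => x - y).
Proof. exact: measurable_funB. Qed.

Let msubr (x : R) : measurable_fun [set: R] (fun y : R => y - x).
Proof. exact: measurable_funB. Qed.

(** The error lives on |x - y| <= e; each half of this interval is moved to [0, e]
    by a reflection or a translation, where the error is at most t^(-rho). *)
Lemma integral_trunc_error (x e : R) : 0 < e ->
  (\int[mu]_y (trunc_error e (x - y))%:E <= (near_mass e)%:E)%E.
Proof.
move=> e0; apply: (@le_trans _ _ (\int[mu]_y (g1 e (x - y) + g1 e (y - x)))%E).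
  apply: ge0_le_integral => //.
  - by move=> t _; rewrite lee_fin /trunc_error normr_ge0.
  - apply/measurable_EFinP; apply: (measurableT_comp (measurable_trunc_error e)).
    exact: msubl.
  - apply: emeasurable_funD; first exact: (measurableT_comp (mg1 e) (msubl x)).
    exact: (measurableT_comp (mg1 e) (msubr x)).
  - move=> y _; rewrite -EFinD lee_fin /patch.
    rewrite (_ : trunc_error e (y - x) = trunc_error e (x - y)); last by rewrite /trunc_error /trunc_ker (distrC y x).
    rewrite !mem_setE !in_itv/=.
    case: (leP `|x - y| e); last first.
      move=> xe; have -> : trunc_error e (x - y) = 0.
        by rewrite /trunc_error (trunc_ker_far _ (ltW xe)) subrr normr0.
      by rewrite !if_same addr0.
    rewrite ler_norml => /andP[? ?].
    have [xy|xy] := leP 0 (x - y).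
      by rewrite ifT ?xy// lerDl; case: ifP; rewrite // normr_ge0.
    rewrite /=.
    have -> : (0 <= y - x <= e) by apply/andP; split; lra.
    by rewrite (_ : point = 0 :> R)// add0r.
rewrite ge0_integralD//; last 2 first.
- exact: (measurableT_comp (mg1 e) (msubl x)).
- exact: (measurableT_comp (mg1 e) (msubr x)).
have E1 : (\int[mu]_y g1 e (x - y) = \int[mu]_y g1 e y)%E.
  have N1 : (-1 : R) != 0 by rewrite oppr_eq0 oner_neq0.
  apply/esym/(etrans (ge0_integral_affine x N1 (mg1 e) (g1_ge0 e))).
  by rewrite normrN normr1 mul1e; under eq_integral do rewrite mulN1r addrC.
have E2 : (\int[mu]_y g1 e (y - x) = \int[mu]_y g1 e y)%E.
  apply/esym/(etrans (ge0_integral_affine (- x) (oner_neq0 R) (mg1 e) (g1_ge0 e))).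
  by rewrite normr1 mul1e; apply: eq_integral => y _; rewrite (mul1r y).
rewrite E1 E2 /near_mass mulr_natl mulr2n EFinD.
by apply: leeD; exact: integral_g1.
Qed.

Lemma near_mass_ge0 e : 0 <= near_mass e.
Proof. by rewrite mulr_ge0// divr_ge0 ?powR_ge0// subr_ge0 ltW. Qed.

Lemma near_mass_small (eta : R) : 0 < eta ->
  exists2 e0 : R, 0 < e0 <= 1 & forall e, 0 < e <= e0 -> near_mass e <= eta.
Proof.
move=> eta0.
have r1 : 0 < 1 - rho by rewrite subr_gt0.
have q0 : 0 < eta * (1 - rho) / 2 by rewrite !mulr_gt0// invr_gt0.
have [e1 e10 H] := powR_small r1 q0.
exists (Num.min 1 e1); first by rewrite lt_min ltr01 e10 ge_min lexx.
move=> e /andP[e0]; rewrite le_min => /andP[_ ee1].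
rewrite /near_mass mulrA ler_pdivrMr// mulrC -ler_pdivlMr//.
by apply: H; rewrite ltW.
Qed.

End kernel_integral.

(** * The Riesz operator on bounded functions *)
Section unit_interval.
Context {R : realType}.
Notation mu := (@lebesgue_measure R).
Notation I := (`]0 : R, 1 : R[%classic).

Lemma lebesgue_unit : mu I = 1%E.
Proof. by rewrite lebesgue_measure_itv/= lte_fin ltr01 sube0. Qed.

Lemma bounded_integrable (D : set R) (w : R) (g : R -> R) (M : R) :
  measurable D -> mu D = w%:E -> measurable_fun D g ->
  (forall y, D y -> `|g y| <= M) -> mu.-integrable D (EFin \o g).
Proof.
move=> mD Dw mg gM; apply: measurable_bounded_integrable => //.
  by rewrite [X in (X < _)%E]Dw ltry.
exists M; split; rewrite ?num_real// => B MB y Dy /=.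
exact: le_trans (gM _ Dy) (ltW MB).
Qed.

Lemma le_norm_Rintegral (D : set R) (w : R) (g : R -> R) (M : R) :
  measurable D -> mu D = w%:E -> measurable_fun D g ->
  (forall y, D y -> `|g y| <= M) -> `|\int[mu]_(y in D) g y| <= M * w.
Proof.
move=> mD Dw mg gM; have ig := bounded_integrable mD Dw mg gM.
apply: (le_trans (le_normr_Rintegral _ ig)) => //.
have -> : M * w = \int[mu]_(y in D) M by rewrite Rintegral_cst// [X in fine X]Dw.
apply: le_Rintegral => //; first exact: (integrable_norm ig).
exact: (@bounded_integrable _ _ _ `|M| mD Dw).
Qed.

Lemma bounded_integrable_unit (g : R -> R) (M : R) : measurable_fun I g ->
  (forall y, I y -> `|g y| <= M) -> mu.-integrable I (EFin \o g).
Proof. exact: bounded_integrable lebesgue_unit. Qed.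

Lemma le_norm_Rintegral_unit (g : R -> R) (M : R) : measurable_fun I g ->
  (forall y, I y -> `|g y| <= M) -> `|\int[mu]_(y in I) g y| <= M.
Proof. move=> mg gM; rewrite -[leRHS]mulr1; exact: le_norm_Rintegral lebesgue_unit mg gM. Qed.

Lemma le_Rintegral_mul (k g : R -> R) (M : R) :
  mu.-integrable I (EFin \o k) -> measurable_fun I g ->
  (forall y, I y -> `|g y| <= M) -> mu.-integrable I (EFin \o (fun y => k y * g y)) /\
  `|\int[mu]_(y in I) (k y * g y)| <= M * \int[mu]_(y in I) `|k y|.
Proof.
move=> ik mg gM.
have mk : measurable_fun I k by apply/measurable_EFinP; exact: (measurable_int mu).
have ink := integrable_norm ik.
have iMk : mu.-integrable I (EFin \o (fun y => M * `|k y|)).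
  exact: (@integrableZl _ _ _ mu I (measurable_itv _) M _ ink).
have mkg : measurable_fun I (fun y => k y * g y) by exact: measurable_funM.
have kgM y : I y -> `|k y * g y| <= M * `|k y|.
  by move=> Iy; rewrite normrM mulrC ler_wpM2r// gM.
have ikg : mu.-integrable I (EFin \o (fun y => k y * g y)).
  apply: (le_integrable _ _ _ iMk) => //; first exact/measurable_EFinP.
  move=> y Iy; rewrite lee_fin; apply: le_trans (kgM y Iy) _; exact: ler_norm.
split=> //.
apply: (le_trans (le_normr_Rintegral _ ikg)) => //.
rewrite -RintegralZl//; apply: le_Rintegral => //.
exact: (integrable_norm ikg).
Qed.

End unit_interval.

Section riesz_operator.
Context {R : realType}.
Notation mu := (@lebesgue_measure R).
Notation I := (`]0 : R, 1 : R[%classic).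
Variable rho : R.
Hypothesis hrho : 0 < rho < 1.
Notation ker := (fun t : R => `|t| `^ (- rho)).

Let rho01 : 0 < rho <= 1. Proof. by case/andP: hrho => -> /ltW ->. Qed.

Let msub (x : R) : measurable_fun [set: R] (fun y : R => x - y).
Proof. exact: measurable_funB. Qed.

Lemma measurable_trunc_ker_sub (e x : R) : measurable_fun I (fun y => trunc_ker rho e (x - y)).
Proof. apply: measurable_funTS; exact: (measurableT_comp (measurable_trunc_ker rho e) (msub x)). Qed.

Lemma trunc_ker_sub_integrable (e x : R) : 0 < e ->
  mu.-integrable I (EFin \o (fun y => trunc_ker rho e (x - y))).
Proof.
move=> e0; apply: (@bounded_integrable_unit _ _ (e `^ (- rho))).
  exact: measurable_trunc_ker_sub.
by move=> y _; rewrite ger0_norm ?trunc_ker_ge0// trunc_ker_le.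
Qed.

Lemma trunc_error_integrable (e x : R) : 0 < e ->
  mu.-integrable I (EFin \o (fun y => `|x - y| `^ (- rho) - trunc_ker rho e (x - y))) /\
  \int[mu]_(y in I) `| `|x - y| `^ (- rho) - trunc_ker rho e (x - y)| <= near_mass rho e.
Proof.
move=> e0.
have md : measurable_fun [set: R] (fun y => `|x - y| `^ (- rho) - trunc_ker rho e (x - y)).
  apply: measurable_funB; first exact: measurable_ker.
  exact: (measurableT_comp (measurable_trunc_ker rho e) (msub x)).
have b : (\int[mu]_(y in I) `|(`|x - y| `^ (- rho) - trunc_ker rho e (x - y))%:E| <=
     (near_mass rho e)%:E)%E.
  apply: le_trans (integral_trunc_error hrho x e0).
  rewrite [leRHS](_ : _ = \int[mu]_y `|(`|x - y| `^ (- rho) - trunc_ker rho e (x - y))%:E|)%E//.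
  apply: ge0_subset_integral => //.
  by apply: measurableT_comp => //; exact/measurable_EFinP.
have id : mu.-integrable I (EFin \o (fun y => `|x - y| `^ (- rho) - trunc_ker rho e (x - y))).
  apply/integrableP; split; first by apply/measurable_EFinP; exact: measurable_funTS.
  exact: le_lt_trans b (ltry _).
split=> //; rewrite -lee_fin /Rintegral fineK; first exact: b.
exact/integrable_fin_num/(integrable_norm id).
Qed.

Lemma ker_integrable (x : R) :
  mu.-integrable I (EFin \o (fun y => `|x - y| `^ (- rho))).
Proof.
have [i _] := trunc_error_integrable x (ltr01 : 0 < 1 :> R).
have := @integrableD _ _ _ mu I (measurable_itv _) _ _ i (trunc_ker_sub_integrable x (ltr01 : 0 < 1 :> R)).
apply: eq_integrable => // y _ /=.
by rewrite -EFinD subrK.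
Qed.

Section bounded_function.
Variables (g : R -> R) (M : R).
Hypothesis mg : measurable_fun I g.
Hypothesis gM : forall y, I y -> `|g y| <= M.

Let M0 : 0 <= M.
Proof. by apply: (le_trans (normr_ge0 (g 2^-1))); apply: gM; rewrite /= in_itv/=; lra. Qed.

Lemma ker_mul_integrable (x : R) :
  mu.-integrable I (EFin \o (fun y => `|x - y| `^ (- rho) * g y)).
Proof. by have [] := le_Rintegral_mul (ker_integrable x) mg gM. Qed.

Lemma trunc_ker_mul_integrable (e x : R) : 0 < e ->
  mu.-integrable I (EFin \o (fun y => trunc_ker rho e (x - y) * g y)).
Proof. by move=> e0; have [] := le_Rintegral_mul (trunc_ker_sub_integrable x e0) mg gM. Qed.

Lemma riesz_truncation (e x : R) : 0 < e ->
  `|riesz_op rho g x - \int[mu]_(y in I) (trunc_ker rho e (x - y) * g y)| <= M * near_mass rho e.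
Proof.
move=> e0; have [i b] := trunc_error_integrable x e0.
have [_] := le_Rintegral_mul i mg gM.
under eq_Rintegral do rewrite mulrBl.
rewrite RintegralB//; [|exact: ker_mul_integrable|exact: trunc_ker_mul_integrable].
by move=> /le_trans; apply; rewrite ler_wpM2l.
Qed.

Lemma riesz_bounded (x : R) : `|riesz_op rho g x| <= M * (near_mass rho 1 + 1).
Proof.
have := riesz_truncation x (ltr01 : 0 < 1 :> R).
set J := \int[mu]_(y in I) _.
have : `|J| <= M.
  apply: le_norm_Rintegral_unit.
    by apply: measurable_funM => //; exact: measurable_trunc_ker_sub.
  move=> y Iy; rewrite normrM -[leRHS]mul1r ler_pM ?gM//.
  rewrite ger0_norm ?trunc_ker_ge0//; apply: le_trans (trunc_ker_le _ rho01 ltr01) _.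
  by rewrite powR1.
move=> J1 H; have := ler_normD (riesz_op rho g x - J) J.
rewrite subrK => /le_trans; apply; rewrite mulrDr mulr1; exact: lerD.
Qed.

(** Truncation costs [near_mass] at each of the two points, and the truncated kernel
    is Lipschitz. *)
Lemma riesz_modulus (e x x' : R) : 0 < e ->
  `|riesz_op rho g x - riesz_op rho g x'| <=
    M * (2 * near_mass rho e + e `^ (- rho) / e * `|x - x'|).
Proof.
move=> e0; have H := riesz_truncation x e0; have H' := riesz_truncation x' e0.
rewrite mulrDr [2 * _]mulr_natl mulr2n mulrDr; apply: (ler_dist_chain H H').
rewrite -RintegralB//; [|exact: trunc_ker_mul_integrable|exact: trunc_ker_mul_integrable].
apply: le_norm_Rintegral_unit.
  by apply: measurable_funB; apply: measurable_funM => //; exact: measurable_trunc_ker_sub.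
move=> y Iy; rewrite -mulrBl normrM mulrC ler_pM ?gM//.
by apply: le_trans (trunc_ker_lipschitz _ _ rho01 e0) _; rewrite opprB addrA subrK.
Qed.

End bounded_function.

(** The modulus depends on the bound of [g] only: this is the source of the
    continuity of eigenfunctions. *)
Lemma riesz_equicontinuous (eta : R) : 0 < eta -> exists2 d : R, 0 < d &
  forall (g : R -> R) (M : R), measurable_fun I g -> (forall y, I y -> `|g y| <= M) ->
  forall x x', `|x - x'| <= d -> `|riesz_op rho g x - riesz_op rho g x'| <= M * eta.
Proof.
move=> eta0; have e4 : 0 < eta / 4 by rewrite divr_gt0.
have [e /andP[e0 _] /(_ e)] := near_mass_small hrho e4.
rewrite e0 lexx => /(_ isT) he.
have q0 : 0 < e `^ (- rho) / e by rewrite divr_gt0// powR_gt0.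
exists (eta / 2 / (e `^ (- rho) / e)); first by rewrite !divr_gt0// powR_gt0.
move=> g M mg gM x x' xx'.
have M0 : 0 <= M.
  by apply: (le_trans (normr_ge0 (g 2^-1))); apply: gM; rewrite /= in_itv/=; lra.
apply: (le_trans (riesz_modulus mg gM x x' e0)); apply: ler_wpM2l => //.
move: xx'; rewrite ler_pdivlMr// mulrC; lra.
Qed.

Lemma riesz_continuous (g : R -> R) (M : R) : measurable_fun I g ->
  (forall y, I y -> `|g y| <= M) -> continuous (riesz_op rho g).
Proof.
move=> mg gM x.
have M0 : 0 <= M.
  by apply: (le_trans (normr_ge0 (g 2^-1))); apply: gM; rewrite /= in_itv/=; lra.
apply/cvgrPdist_le => eta eta0.
have M1 : 0 < M + 1 by lra.
have [|d d0 H] := @riesz_equicontinuous (eta / (M + 1)); first by rewrite divr_gt0.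
near=> z; apply: (le_trans (H _ _ mg gM x z _)).
  by rewrite distrC; near: z; apply: (@cvgr_distC_le R R^o).
by rewrite mulrCA ler_piMr ?(ltW eta0)// ler_pdivrMr// mul1r; lra.
Unshelve. all: by end_near. Qed.

End riesz_operator.

(** * Symmetry of the Riesz operator under dilations *)
Section riesz_symmetry.
Context {R : realType}.
Notation mu := (@lebesgue_measure R).
Notation I := (`]0 : R, 1 : R[%classic).
Variable rho : R.
Hypothesis hrho : 0 < rho < 1.

Let mI : measurable I. Proof. exact: measurable_itv. Qed.

Lemma ker_dilation (a s y : R) : 0 < a ->
  `|a * s - y| `^ (- rho) = a `^ (- rho) * `|y / a - s| `^ (- rho).
Proof.
move=> a0; rewrite -powRM ?normr_ge0 ?ltW//; congr (_ `^ _).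
have -> : a * s - y = - (a * (y / a - s)) by field; rewrite gt_eqF.
by rewrite normrN normrM (gtr0_norm a0).
Qed.

(** Exchanging the integrals of g(s) |a s - y|^(-rho) h(y) and using that the kernel
    is homogeneous.  The case a = 1 is the symmetry of the operator, and letting a
    vary is what gives the behaviour of eigenfunctions at the endpoint. *)
Lemma riesz_fubini (a : R) (g h : R -> R) (M N : R) : 0 < a ->
  measurable_fun I g -> (forall y, I y -> `|g y| <= M) ->
  measurable_fun I h -> (forall y, I y -> `|h y| <= N) ->
  \int[mu]_(s in I) (g s * riesz_op rho h (a * s)) =
  \int[mu]_(y in I) (h y * (a `^ (- rho) * riesz_op rho g (y / a))).
Proof.
move=> a0 mg gM mh hN.
pose F (z : R * R) : \bar R :=
  ((`|a * z.1 - z.2| `^ (- rho) * (g \_ I) z.1) * (h \_ I) z.2)%:E.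
have mg' : measurable_fun [set: R] (g \_ I) by apply/(measurable_restrictT _ _).1.
have mh' : measurable_fun [set: R] (h \_ I) by apply/(measurable_restrictT _ _).1.
have mF : measurable_fun [set: R * R] F.
  apply/measurable_EFinP; apply: measurable_funM; first apply: measurable_funM.
  - apply: (@measurableT_comp _ _ _ _ _ _ (@powR R ^~ (- rho))) => //.
    apply: measurableT_comp => //; apply: measurable_funB; last exact: measurable_snd.
    by apply: measurable_funM => //; exact: measurable_fst.
  - exact: (measurableT_comp mg' measurable_fst).
  - exact: (measurableT_comp mh' measurable_snd).
have in1 s : (\int[mu]_y F (s, y) = ((g \_ I) s * riesz_op rho h (a * s))%:E)%E.
  rewrite EFinM /riesz_op /Rintegral fineK; last first.
    exact/integrable_fin_num/(ker_mul_integrable hrho mh hN).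
  rewrite -integralZl//; last exact: (ker_mul_integrable hrho mh hN).
  rewrite [RHS]integral_mkcond; apply: eq_integral => y _.
  rewrite /F/= !patchE; case: (y \in _); last by rewrite mulr0.
  rewrite -EFinM.
  by congr EFin; ring.
have iF : (mu \x mu)%E.-integrable [set: R * R] F.
  apply/(integrable12ltyP mu mu mF).
  have N0 : 0 <= N.
    by apply: (le_trans (normr_ge0 (h 2^-1))); apply: hN; rewrite /= in_itv/=; lra.
  set C := near_mass rho 1 + 1.
  apply: (@le_lt_trans _ _ (\int[mu]_x (((cst (M * (N * C))) \_ I) x)%:E)%E).
    apply: ge0_le_integral => //.
    - by move=> x _; exact: integral_ge0.
    - apply: (@measurable_fun_fubini_tonelli_F _ _ _ _ _ mu (abse \o F)) => //=.
      exact: measurableT_comp.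
    - by apply/measurable_EFinP; apply/(measurable_restrictT _ _).1.
    - move=> s _.
      have mN : measurable_fun I (fun y => `|h y|) by exact: measurableT_comp.
      have hN' y : I y -> `| `|h y| | <= N by move=> ?; rewrite normr_id hN.
      rewrite (_ : (\int[mu]_y `|F (s, y)| = `|(g \_ I) s|%:E * (riesz_op rho (fun y => `|h y|) (a * s))%:E)%E).
        rewrite -EFinM lee_fin !patchE; case: ifP => [/set_mem Is|_]; last first.
          by rewrite normr0 mul0r.
        apply: ler_pM => //; last 2 first.
        - exact: gM.
        - exact: le_trans (ler_norm _) (riesz_bounded hrho mN hN' _).
        by apply: Rintegral_ge0 => y _; rewrite mulr_ge0 ?powR_ge0.
      rewrite /riesz_op /Rintegral fineK; last first.
        exact/integrable_fin_num/(ker_mul_integrable hrho mN hN').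
      rewrite -integralZl//; last exact: (ker_mul_integrable hrho mN hN').
      rewrite [RHS]integral_mkcond; apply: eq_integral => y _.
      rewrite /F/= !patchE; case: (y \in _); last by rewrite mulr0 normr0.
      by rewrite -EFinM !normrM (ger0_norm (powR_ge0 _ _)); congr EFin; ring.
  rewrite (_ : \int[mu]_x _ = \int[mu]_(x in I) (M * (N * C))%:E)%E; last first.
    by rewrite [RHS]integral_mkcond; apply: eq_integral => x _; rewrite !patchE; case: ifP.
  by rewrite integral_cst// [X in (_ * X < _)%E]lebesgue_unit mule1 ltry.
have in2 y : (\int[mu]_s F (s, y) =
    ((h \_ I) y * (a `^ (- rho) * riesz_op rho g (y / a)))%:E)%E.
  have ik := ker_mul_integrable hrho mg gM (y / a).
  rewrite !EFinM /riesz_op /Rintegral fineK; last exact: integrable_fin_num.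
  rewrite muleA -EFinM -integralZl// [RHS]integral_mkcond.
  apply: eq_integral => s _; rewrite /F/= !patchE.
  case: (s \in _); last by rewrite mulr0 mul0r.
  by rewrite -EFinM ker_dilation//; congr EFin; ring.
have := congr1 fine (Fubini iF).
under eq_integral do rewrite in1.
under [X in _ = fine X -> _]eq_integral do rewrite in2.
rewrite ![Rintegral mu I _]Rintegral_mkcond => H.
transitivity (\int[mu]_x ((g \_ I) x * riesz_op rho h (a * x))).
  by apply: eq_Rintegral => s _; rewrite !patchE; case: ifP => // _; rewrite mul0r.
rewrite [LHS]H.
by apply: eq_Rintegral => s _; rewrite !patchE; case: ifP => // _; rewrite mul0r.
Qed.

Lemma riesz_symmetric (g h : R -> R) (M N : R) :
  measurable_fun I g -> (forall y, I y -> `|g y| <= M) ->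
  measurable_fun I h -> (forall y, I y -> `|h y| <= N) ->
  \int[mu]_(s in I) (g s * riesz_op rho h s) =
  \int[mu]_(y in I) (h y * riesz_op rho g y).
Proof.
move=> mg gM mh hN; have := riesz_fubini ltr01 mg gM mh hN.
under eq_Rintegral do rewrite mul1r.
by under [X in _ = X -> _]eq_Rintegral do rewrite powR1 mul1r divr1.
Qed.

End riesz_symmetry.

(** * Eigenfunctions that vanish at an endpoint *)
Section simplicity.
Context {R : realType}.
Notation mu := (@lebesgue_measure R).
Notation I := (`]0 : R, 1 : R[%classic).
Variable rho : R.
Hypothesis hrho : 0 < rho < 1.

Lemma continuous_bounded01 (g : R -> R) : {within `[0, 1], continuous g} ->
  exists2 M : R, 0 < M & forall y, 0 <= y <= 1 -> `|g y| <= M.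
Proof.
move=> cg; have cn : {within `[0 : R, 1 : R], continuous (fun y => `|g y|)}.
  by move=> y; apply: continuous_comp; [exact: cg|exact: norm_continuous].
have [c _ cM] := EVT_max ler01 cn.
exists (`|g c| + 1); first by rewrite ltr_wpDl.
by move=> y y01; apply: (le_trans (cM y _)); rewrite ?lerDl// in_itv.
Qed.

Lemma Rintegral_dilation (a : R) (G : R -> R) : 0 < a -> continuous G ->
  \int[mu]_(y in `]0, a[) G y = a * \int[mu]_(s in I) G (a * s).
Proof.
move=> a0 cG.
have iG b (H : R -> R) : continuous H -> mu.-integrable `[0, b] (EFin \o H).
  move=> cH; apply: continuous_compact_integrable; first exact: segment_compact.
  exact: continuous_subspaceT.
have cGa : continuous (fun s => G (a * s)).
  by move=> s; apply: continuous_comp; [exact: mulrl_continuous|exact: cG].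
have oc b (H : R -> R) : continuous H ->
    \int[mu]_(y in `]0, b[) H y = \int[mu]_(y in `[0, b]) H y.
  move=> cH; rewrite Rintegral_itv_obnd_cbnd; last first.
    apply: (integrableS _ _ _ (iG b H cH)) => //.
    exact: subset_itv_oo_cc.
  rewrite Rintegral_itv_bndo_bndc//.
  by apply: (integrableS _ _ _ (iG b H cH)) => //; exact: subset_itv_co_cc.
rewrite (oc a G cG) (oc 1 _ cGa) -RintegralZl//; last exact: iG.
have d1 : (fun s : R => a * s)^`()%classic = cst a.
  by apply/funext => s; rewrite derive1E deriveZ//= derive_id /GRing.scale/= mulr1.
have := @integration_by_substitution_increasing R (fun s => a * s) G 0 1 ler01.
rewrite mulr0 mulr1 d1 /Rintegral => ->.
- by congr fine; apply: eq_integral => s _ /=; rewrite mulrC.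
- by move=> x y _ _ xy; rewrite ltr_pM2l.
- by move=> x _; exact: cvg_cst.
- exact: is_cvg_cst.
- exact: is_cvg_cst.
- split=> [x _| |]; first exact: derivableZ.
  + exact/cvg_at_right_filter/mulrl_continuous.
  + exact/cvg_at_left_filter/mulrl_continuous.
- exact: continuous_subspaceT.
Qed.

Lemma continuous_mul (g h : R -> R) : continuous g -> continuous h ->
  continuous (fun y => g y * h y).
Proof. by move=> cg ch y; exact: (cvgM (cg y) (ch y)). Qed.

Lemma continuous_integrable_itv (D : set R) (a b : R) (H : R -> R) :
  measurable D -> D `<=` `[a, b] -> continuous H -> mu.-integrable D (EFin \o H).
Proof.
move=> mD Dab cH; apply: (@integrableS _ _ _ mu `[a, b]%classic) => //.
apply: continuous_compact_integrable; first exact: segment_compact.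
exact: continuous_subspaceT.
Qed.

(** Unlike [riesz_eigen], this asks for an everywhere defined continuous
    representative that satisfies the equation at every point of [0, 1]; such
    functions can be evaluated at the nodes (l+1)/n and at the endpoint 1. *)
Definition riesz_eigenfunction (nu : R) (g : R -> R) :=
  continuous g /\ forall x, 0 <= x <= 1 -> riesz_op rho g x = nu * g x.

(** The eigenvalue of the operator on (0, a) is a^(1 - rho) nu, and its derivative
    in a is governed by g(1)^2; if g(1) = 0 then nu times the integral of g^2 must
    vanish.  To avoid derivatives, write A for the integral of g(s) g(a s) over
    (0, 1) and let a = 1 - t.  Applying [riesz_fubini] to A and splitting the
    resulting integral at a gives

      nu A (1 - a^(1 - rho)) = a^(-rho) int_a^1 g(y) (K g)(y / a) dy.

    The right side is o(t), because g is small on [a, 1], while 1 - a^(1 - rho) is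
    at least a multiple of t.  So A is at most o(1), and A tends to the integral of
    g^2. *)
Lemma riesz_eigenfunction_endpoint (nu : R) (g : R -> R) : 0 < nu ->
  riesz_eigenfunction nu g -> g 1 = 0 -> \int[mu]_(s in I) (g s * g s) <= 0.
Proof.
move=> nu0 [cg gE] g1.
have [M M0 gM'] := continuous_bounded01 (continuous_subspaceT cg).
have gM y : I y -> `|g y| <= M.
  by rewrite /= in_itv/= => /andP[/ltW ? /ltW ?]; apply: gM'; apply/andP.
have mgT : measurable_fun [set: R] g by exact: continuous_measurable_fun.
have mg : measurable_fun I g by exact: measurable_funTS.
set C := near_mass rho 1 + 1.
have C1 : 1 <= C by rewrite lerDr near_mass_ge0.
have C0 : 0 <= C by exact: le_trans C1.
pose B := M * C.
have B0 : 0 <= B by rewrite mulr_ge0 ?(ltW M0)// (le_trans ler01).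
have [rho0 rho1] : 0 < rho /\ 0 < 1 - rho by case/andP: hrho => ?; rewrite subr_gt0.
have unif (eta : R) : 0 < eta -> exists2 d : R, 0 < d & forall x y : R, 0 <= x <= 1 -> 0 <= y <= 1 ->
    `|x - y| <= d -> `|g x - g y| <= eta.
  move=> eta0; have [|d d0 H] := riesz_equicontinuous hrho (_ : 0 < eta * nu / M).
    by rewrite divr_gt0// mulr_gt0.
  exists d => // x y x01 y01 xy; have := H g M mg gM x y xy.
  rewrite !gE// -mulrBr normrM (gtr0_norm nu0) mulrCA divff ?gt_eqF// mulr1 mulrC.
  by rewrite ler_pM2r.
suff key (eta : R) : 0 < eta -> \int[mu]_(s in I) (g s * g s) <=
    eta * (M + 2 / (1 - rho) * (2 `^ rho * B) / nu).
  pose D := M + 2 / (1 - rho) * (2 `^ rho * B) / nu; rewrite -/D in key.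
  have D0 : 0 < D.
    have : 0 <= 2 / (1 - rho) * (2 `^ rho * B) / nu.
      by rewrite !mulr_ge0 ?invr_ge0 ?powR_ge0 ?C0 ?(ltW M0) ?(ltW rho1) ?(ltW nu0)//.
    by move=> h; rewrite /D ltr_wpDr.
  apply/ler_addgt0Pr => e e0; rewrite add0r.
  by have := key (e / D) (divr_gt0 e0 D0); rewrite divfK ?gt_eqF.
move=> eta0; have [d d0 gd] := unif _ eta0.
(* a >= 1/2 keeps a^(-rho) below 2^rho *)
pose t := Num.min d 2^-1; pose a := 1 - t.
have t0 : 0 < t by rewrite lt_min d0 invr_gt0 ltr0n.
have td : t <= d by rewrite ge_min lexx.
have th : t <= 2^-1 by rewrite ge_min lexx orbT.
have a0 : 2^-1 <= a by rewrite /a; lra.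
have a00 : 0 < a by lra.
have a1 : a < 1 by rewrite /a; lra.
pose A := \int[mu]_(s in I) (g s * g (a * s)).
have as01 s : I s -> 0 <= a * s <= 1.
  rewrite /= in_itv/= => /andP[s0 s1]; rewrite mulr_ge0//= ?mulr_ile1//; lra.
have cga : continuous (fun s => g (a * s)).
  by move=> s; apply: continuous_comp; [exact: mulrl_continuous|exact: cg].
have mga : measurable_fun I (fun s => g (a * s)).
  by apply: measurable_funTS; exact: continuous_measurable_fun.
pose Q y := g y * riesz_op rho g (y / a).
have cQ : continuous Q.
  apply: continuous_mul => // y.
  have cK := riesz_continuous hrho mg gM.
  exact: (continuous_comp (@mulrr_continuous R a^-1 y) (cK _)).
have AE : nu * A = a `^ (- rho) * \int[mu]_(y in I) Q y.
  have := riesz_fubini hrho a00 mg gM mg gM.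
  rewrite (@eq_Rintegral _ _ _ mu I (fun s => nu * (g s * g (a * s)))); last first.
    by move=> s /set_mem Is; rewrite gE ?as01// mulrCA.
  rewrite RintegralZl//; last first.
    apply: (@continuous_integrable_itv _ 0 1) => //; first exact: subset_itv_oo_cc.
    exact: continuous_mul.
  move=> ->; rewrite -RintegralZl//; first by apply: eq_Rintegral => s _; rewrite /Q; ring.
  by apply: (@continuous_integrable_itv _ 0 1) => //; exact: subset_itv_oo_cc.
have split_I : \int[mu]_(y in I) Q y = nu * (a * A) + \int[mu]_(y in `[a, 1[) Q y.
  rewrite (@itv_bndbnd_setU _ _ _ (BLeft a)); [|by rewrite bnd_simp ?(ltW a1)..].
  rewrite Rintegral_setU//=; last 2 first.
  - rewrite -itv_bndbnd_setU; [|by rewrite bnd_simp ?(ltW a1)..].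
    by apply: (@continuous_integrable_itv _ 0 1) => //; exact: subset_itv_oo_cc.
  - apply/disj_setPS => y [/=]; rewrite !in_itv/= => /andP[_ ya] /andP[].
    by rewrite leNgt ya.
  congr (_ + _); rewrite (Rintegral_dilation a00 cQ) mulrCA; congr (_ * _).
  rewrite -RintegralZl//; last first.
    apply: (@continuous_integrable_itv _ 0 1) => //; first exact: subset_itv_oo_cc.
    exact: continuous_mul.
  apply: eq_Rintegral => s /set_mem; rewrite /= in_itv/= => /andP[s0 s1].
  rewrite /Q [a * s / a]mulrAC divff ?gt_eqF// mul1r gE ?ltW//.
  by rewrite mulrCA [g s * _]mulrC.
have B1 : `|\int[mu]_(y in `[a, 1[) Q y| <= eta * B * t.
  apply: le_norm_Rintegral => //.
  - rewrite lebesgue_measure_itv/= lte_fin a1 -EFinB; congr EFin; rewrite /a; lra.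
  - by apply: measurable_funTS; exact: continuous_measurable_fun.
  - move=> y /=; rewrite in_itv/= => /andP[ay y1]; rewrite normrM; apply: ler_pM => //.
      have := gd y 1; rewrite g1 subr0; apply; rewrite ?ler01 ?lexx//; first by lra.
      by rewrite ler_norml; move: ay; rewrite /a; lra.
    exact: (riesz_bounded hrho mg gM).
have A2 : `|A - \int[mu]_(s in I) (g s * g s)| <= M * eta.
  rewrite /A -RintegralB//; last 2 first.
  - apply: (@continuous_integrable_itv _ 0 1) => //; first exact: subset_itv_oo_cc.
    exact: continuous_mul.
  - apply: (@continuous_integrable_itv _ 0 1) => //; first exact: subset_itv_oo_cc.
    exact: continuous_mul.
  apply: le_norm_Rintegral_unit.
    apply: measurable_funB; exact: measurable_funM.
  move=> s Is; rewrite -mulrBr normrM; apply: ler_pM => //; first exact: gM.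
  have := as01 s Is; move: Is; rewrite /= in_itv/= => /andP[s0 s1] ?.
  apply: gd => //; first by rewrite (ltW s0) (ltW s1).
  rewrite (_ : a * s - s = - (s * t)); last by rewrite /a; ring.
  rewrite normrN ger0_norm ?mulr_ge0 ?(ltW s0) ?(ltW t0)// (le_trans _ td)//.
  by rewrite ler_piMl ?(ltW t0) ?(ltW s1).
set Z := \int[mu]_(y in `[a, 1[) Q y in B1 split_I.
set S := \int[mu]_(s in I) (g s * g s) in A2 *.
rewrite split_I in AE.
have E : nu * A * (1 - a `^ (1 - rho)) = a `^ (- rho) * Z.
  have <- : a `^ (- rho) * a = a `^ (1 - rho).
    by rewrite -{2}[a]powRr1 ?(ltW a00)// -powRD ?(gt_eqF a00) ?implybT// addrC.
  rewrite mulrBr mulr1 {1}AE; ring.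
have pa : (1 - rho) / 2 * t <= 1 - a `^ (1 - rho).
  have -> : t = 1 - a by rewrite /a; ring.
  by apply: one_sub_powR_ge; rewrite ?a00 ?rho1 ?(ltW a1)//= lerBlDr lerDl ltW.
have ar : a `^ (- rho) <= 2 `^ rho.
  rewrite -[X in _ <= X `^ _]invrK -[(_^-1)^-1]powR_inv1 ?invr_ge0// -powRrM mulN1r.
  rewrite !powRN lef_pV2 ?posrE ?powR_gt0// ?invr_gt0//.
  by rewrite ge0_ler_powR ?nnegrE ?invr_ge0 ?(ltW rho0) ?(ltW a00).
have Zub : a `^ (- rho) * Z <= 2 `^ rho * (eta * B * t).
  apply: (le_trans (ler_norm _)); rewrite normrM ger0_norm ?powR_ge0//.
  by apply: ler_pM; rewrite ?powR_ge0.
clearbody A Z S; clear split_I Q cQ gd as01 cga mga unif gM gM' gE cg mgT mg.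
have AS : A <= eta * (2 / (1 - rho) * (2 `^ rho * B) / nu).
  have [A0|A0] := leP A 0.
    apply: (le_trans A0); rewrite !mulr_ge0 ?invr_ge0 ?powR_ge0 ?C0 ?(ltW M0) ?(ltW rho1) ?(ltW nu0) ?(ltW eta0)//.
  have h : nu * A * ((1 - rho) / 2 * t) <= 2 `^ rho * (eta * B * t).
    apply: le_trans Zub; rewrite -E; apply: ler_wpM2l => //.
    by rewrite mulr_ge0 ?ltW.
  have c0 : 0 < 2 / (1 - rho) / nu / t by rewrite !divr_gt0.
  have := ler_wpM2l (ltW c0) h.
  have -> : 2 / (1 - rho) / nu / t * (nu * A * ((1 - rho) / 2 * t)) = A.
    by field; rewrite !gt_eqF.
  have -> // : 2 / (1 - rho) / nu / t * (2 `^ rho * (eta * B * t)) =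
    eta * (2 / (1 - rho) * (2 `^ rho * B) / nu) by field; rewrite !gt_eqF.
move: A2; rewrite ler_norml => /andP[A2 _]; rewrite mulrDr [eta * M]mulrC.
move: AS; set u := _ * (_ / _) => AS; lra.
Qed.

End simplicity.

(** * Continuity of eigenfunctions *)
Section almost_everywhere.
Context {R : realType}.
Notation mu := (@lebesgue_measure R).
Implicit Types P Q S : R -> Prop.

Lemma ae_imp P Q : {ae mu, forall x, P x} -> (forall x, P x -> Q x) ->
  {ae mu, forall x, Q x}.
Proof. by move=> aP PQ; exact: (@filterS _ _ (ae_filter_ringOfSetsType mu) P Q PQ aP). Qed.

Lemma ae_imp2 P Q S : {ae mu, forall x, P x} -> {ae mu, forall x, Q x} ->
  (forall x, P x -> Q x -> S x) -> {ae mu, forall x, S x}.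
Proof.
by move=> aP aQ PQ; exact: (@filterS2 _ _ (ae_filter_ringOfSetsType mu) P Q S PQ aP aQ).
Qed.

End almost_everywhere.

Section regularity.
Context {R : realType}.
Notation mu := (@lebesgue_measure R).
Notation I := (`]0 : R, 1 : R[%classic).
Variable rho : R.
Hypothesis hrho : 0 < rho < 1.

Let mI : measurable I. Proof. exact: measurable_itv. Qed.

Let msub (x : R) : measurable_fun [set: R] (fun y : R => x - y).
Proof. exact: measurable_funB. Qed.

Lemma L2_measurable (f : R -> R) : L2 f -> measurable_fun I f.
Proof.
rewrite /L2 inE => /andP[+ _]; rewrite inE => mf.
have := (measurable_restrictT f mI).2; apply; exact: mf.
Qed.

Lemma L2_integrable (f : R -> R) : L2 f ->
  mu.-integrable I (EFin \o f) /\ mu.-integrable I (EFin \o (fun x => f x * f x)).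
Proof.
move=> f2; have mf := L2_measurable f2.
have := Lfun2_integrable_sqr f2.
move=> isq.
have i2 : mu.-integrable I (EFin \o (fun x => f x * f x)).
  have := (integrable_mkcond (mu := mu) (EFin \o (fun x => f x * f x)) mI).2; apply.
  apply: eq_integrable isq => // x _ /=.
  rewrite !patchE; case: ifP => _; first by rewrite expr2.
  exact: (congr1 EFin (mul0r (0 : R))).
split=> //.
have i1 : mu.-integrable I (EFin \o (fun=> 1)).
  by apply: (@bounded_integrable_unit _ _ 1) => // y _; rewrite normr1.
have iD := @integrableD _ _ _ mu I mI _ _ i1 i2.
apply: (@le_integrable _ _ _ mu I mI _ _ _ _ iD); first exact/measurable_EFinP.
move=> x Ix /=; rewrite lee_fin.
have fx0 : 0 <= f x * f x by rewrite -expr2 sqr_ge0.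
rewrite [leRHS]ger0_norm ?addr_ge0// -(ger0_norm fx0) normrM.
by have := normr_ge0 (f x); set t := `|f x| => t0; nra.
Qed.

(** Schur's test: the part of the kernel near the diagonal is an operator on L^1 of
    norm at most [near_mass]. *)
Lemma integral_near_le (e : R) (E : R -> R) : 0 < e -> measurable_fun I E ->
  (forall y, 0 <= E y) ->
  measurable_fun I (fun x => \int[mu]_(y in I) (trunc_error rho e (x - y) * E y)%:E)%E /\
  (\int[mu]_(x in I) \int[mu]_(y in I) (trunc_error rho e (x - y) * E y)%:E <=
   (near_mass rho e)%:E * \int[mu]_(y in I) (E y)%:E)%E.
Proof.
move=> e0 mE E0.
pose F (z : R * R) : \bar R := (((cst (1 : R)) \_ I) z.1 * (trunc_error rho e (z.1 - z.2) * (E \_ I) z.2))%:E.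
have mE' : measurable_fun [set: R] (E \_ I) by apply/(measurable_restrictT _ _).1.
have m1 : measurable_fun [set: R] ((cst (1 : R)) \_ I).
  by apply/(measurable_restrictT _ _).1.
have E'0 y : 0 <= (E \_ I) y by rewrite patchE; case: ifP.
have c'0 y : 0 <= ((cst (1 : R)) \_ I) y by rewrite patchE; case: ifP.
have mF : measurable_fun [set: R * R] F.
  apply/measurable_EFinP; apply: measurable_funM; last apply: measurable_funM.
  - exact: (measurableT_comp m1 measurable_fst).
  - apply: (measurableT_comp (measurable_trunc_error rho e)); apply: measurable_funB.
      exact: measurable_fst.
    exact: measurable_snd.
  - exact: (measurableT_comp mE' measurable_snd).
have F0 z : (0 <= F z)%E by rewrite lee_fin !mulr_ge0// /trunc_error.
have H := @fubini_tonelli _ _ _ _ _ mu mu F mF F0.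
have in1 x : (\int[mu]_y F (x, y) =
   (fun x => \int[mu]_(y in I) (trunc_error rho e (x - y) * E y)%:E) \_ I x)%E.
  rewrite patchE; case: ifPn => xI; last first.
    by apply: integral0_eq => y _; rewrite /F/= patchE (negbTE xI) mul0r.
  rewrite [RHS]integral_mkcond; apply: eq_integral => y _.
  rewrite /F/= !patchE xI; case: ifP => _; rewrite mul1r//.
  by rewrite mulr0.
split.
  pose Q x := (\int[mu]_(y in I) (trunc_error rho e (x - y) * E y)%:E)%E.
  apply: (measurable_restrictT Q mI).2.
  have <- : fubini_F mu F = Q \_ I by apply/funext => x; exact: in1.
  exact: measurable_fun_fubini_tonelli_F.
move: H; under eq_integral do rewrite in1.
rewrite -integral_mkcond => ->.
have in2 y : (\int[mu]_x F (x, y) <= (near_mass rho e)%:E * ((EFin \o E) \_ I) y)%E.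
  have mrx : measurable_fun [set: R] (fun x => trunc_error rho e (x - y)).
    by apply: (measurableT_comp (measurable_trunc_error rho e)); exact: measurable_funB.
  apply: (@le_trans _ _ (\int[mu]_x ((((E \_ I) y)%:E * (trunc_error rho e (y - x))%:E)))%E).
    apply: ge0_le_integral => //.
    - exact: (measurableT_comp mF (measurable_pair2 y)).
    - apply: measurable_funeM; apply/measurable_EFinP.
      exact: (measurableT_comp (measurable_trunc_error rho e) (msub y)).
    - move=> x _; rewrite /F/= -EFinM lee_fin mulrCA.
      rewrite (_ : trunc_error rho e (x - y) = trunc_error rho e (y - x)); last by rewrite /trunc_error /trunc_ker (distrC x y).
      rewrite mulrC; apply: ler_wpM2r; first by rewrite /trunc_error.
      rewrite [X in X * _]patchE; case: ifP => _; first by rewrite mul1r.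
      by rewrite mul0r.
  rewrite ge0_integralZl//; last 3 first.
  - by apply/measurable_EFinP; exact: (measurableT_comp (measurable_trunc_error rho e) (msub y)).
  - by move=> x _; rewrite lee_fin /trunc_error.
  - by rewrite lee_fin.
  rewrite restrict_EFin/= muleC; apply: lee_wpmul2r; first by rewrite lee_fin.
  exact: integral_trunc_error.
apply: (@le_trans _ _ (\int[mu]_y ((near_mass rho e)%:E * ((EFin \o E) \_ I) y))%E).
  apply: ge0_le_integral => //.
  - by move=> y _; exact: integral_ge0.
  - exact: (@measurable_fun_fubini_tonelli_G _ _ _ _ _ mu F).
  - by apply: measurable_funeM; rewrite restrict_EFin; exact/measurable_EFinP.
rewrite ge0_integralZl//.
- by rewrite -integral_mkcond.
- by rewrite restrict_EFin; exact/measurable_EFinP.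
- by move=> y _; rewrite restrict_EFin lee_fin.
- by rewrite lee_fin near_mass_ge0.
Qed.

(** Split the kernel as a bounded part, at most e^(-rho), and an error of total mass
    at most nu / 2.  Then nu |phi| <= nu C + (error applied to |phi|) for a constant
    C.  Let E be the positive part of |phi| - 2 C.  Since |phi| <= 2 C + E and the
    error turns the constant 2 C into at most nu C, this becomes
    nu E <= (error applied to E), whence nu |E|_1 <= (nu / 2) |E|_1 and E = 0 almost
    everywhere. *)
Lemma riesz_eigen_bounded (nu : R) (phi : R -> R) : 0 < nu -> riesz_eigen rho nu phi ->
  exists M : R, {ae mu, forall x, I x -> `|phi x| <= M}.
Proof.
move=> nu0 [L2phi eig].
have mphi := L2_measurable L2phi.
have [iphi _] := L2_integrable L2phi.
have inphi := integrable_norm iphi.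
have mnphi : measurable_fun I (fun y => `|phi y|) by exact: measurableT_comp.
pose A := \int[mu]_(y in I) `|phi y|.
have AE : (\int[mu]_(y in I) `|phi y|%:E = A%:E)%E.
  by rewrite /A /Rintegral fineK//; exact: integrable_fin_num.
have [e /andP[e0 _] /(_ e)] := near_mass_small hrho (divr_gt0 nu0 (ltr0n R 2)).
rewrite e0 lexx => /(_ isT) nme.
have A0 : 0 <= A by exact: Rintegral_ge0.
have [C [C0 CE]] : exists C : R, 0 <= C /\ e `^ (- rho) * A = nu * C.
  exists (e `^ (- rho) * A / nu); rewrite divr_ge0 ?mulr_ge0 ?powR_ge0 ?(ltW nu0)//.
  by split=> //; rewrite mulrCA divff ?gt_eqF// mulr1.
pose E y := Num.max (`|phi y| - 2 * C) 0.
have E0 y : 0 <= E y by rewrite le_max lexx orbT.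
have mE : measurable_fun I E.
  by apply: measurable_maxr => //; exact: measurable_funB.
have [mQ iQ] := integral_near_le e0 mE E0.
set Q := (fun x => \int[mu]_(y in I) (trunc_error rho e (x - y) * E y)%:E)%E in mQ iQ.
have mrx x : measurable_fun I (fun y => trunc_error rho e (x - y)).
  by apply: measurable_funTS; exact: (measurableT_comp (measurable_trunc_error rho e) (msub x)).
have rge0 t : 0 <= trunc_error rho e t by rewrite /trunc_error.
have C20 : 0 <= 2 * C by rewrite mulr_ge0.
have mrE x : measurable_fun I (fun y => trunc_error rho e (x - y) * E y).
  exact: measurable_funM (mrx x) mE.
have mlin x : measurable_fun I (fun y => e `^ (- rho) * `|phi y| + 2 * C * trunc_error rho e (x - y)).
  apply: measurable_funD; first exact: (measurable_funM (measurable_cst _) mnphi).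
  exact: (measurable_funM (measurable_cst _) (mrx x)).
have step x : (\int[mu]_(y in I) `|(`|x - y| `^ (- rho) * phi y)%:E| <=
    (2 * (nu * C))%:E + Q x)%E.
  apply: (@le_trans _ _ (\int[mu]_(y in I) ((e `^ (- rho) * `|phi y| + 2 * C * trunc_error rho e (x - y))%:E +
      (trunc_error rho e (x - y) * E y)%:E))%E).
    apply: ge0_le_integral => //.
    - apply: measurableT_comp => //; apply/measurable_EFinP/measurable_funM => //.
      by apply: measurable_funTS; exact: measurable_ker.
    - apply: emeasurable_funD; apply/measurable_EFinP; first exact: mlin.
      exact: mrE.
    - move=> y Iy; rewrite -EFinD lee_fin normrM (ger0_norm (powR_ge0 _ _)).
      have k1 : `|x - y| `^ (- rho) <= e `^ (- rho) + trunc_error rho e (x - y).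
        have := trunc_ker_le (x - y) (_ : 0 < rho <= 1) e0.
        case/andP: hrho => -> /ltW -> /(_ isT).
        have := ler_norm (`|x - y| `^ (- rho) - trunc_ker rho e (x - y)).
        rewrite -/(trunc_error rho e (x - y)); lra.
      have r0 : 0 <= trunc_error rho e (x - y) by rewrite /trunc_error.
      have p1 : `|phi y| <= 2 * C + E y by rewrite -lerBlDl le_max lexx.
      apply: (le_trans (ler_wpM2r (normr_ge0 _) k1)); rewrite mulrDl -addrA lerD2l.
      by rewrite [_ * trunc_error _ _ _]mulrC -mulrDr ler_wpM2l.
  rewrite ge0_integralD//; last 4 first.
  - by move=> y _; rewrite lee_fin addr_ge0// mulr_ge0// powR_ge0.
  - by apply/measurable_EFinP; exact: mlin.
  - by move=> y _; rewrite lee_fin mulr_ge0// /trunc_error.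
  - by apply/measurable_EFinP; exact: mrE.
  apply: leeD2r.
  under eq_integral do rewrite EFinD (EFinM (e `^ _)) (EFinM (2 * C)).
  rewrite ge0_integralD//; last 4 first.
  - by move=> y _; rewrite -EFinM lee_fin mulr_ge0 ?powR_ge0.
  - by apply: measurable_funeM; exact/measurable_EFinP.
  - by move=> y _; rewrite -!EFinM lee_fin mulr_ge0.
  - by apply: measurable_funeM; apply/measurable_EFinP; exact: mrx.
  rewrite ge0_integralZl//; last 2 first.
  - exact/measurable_EFinP.
  - by rewrite lee_fin powR_ge0.
  rewrite ge0_integralZl//; last 2 first.
  - by apply/measurable_EFinP; exact: mrx.
  - by move=> y _; rewrite lee_fin.
  rewrite AE; apply: (@le_trans _ _ ((nu * C)%:E + (2 * C)%:E * (near_mass rho e)%:E)%E).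
    apply: leeD; first by rewrite -EFinM lee_fin CE.
    apply: lee_wpmul2l; first by rewrite lee_fin mulr_ge0.
    apply: le_trans (integral_trunc_error hrho x e0).
    apply: ge0_subset_integral => //.
      by apply/measurable_EFinP; exact: (measurableT_comp (measurable_trunc_error rho e) (msub x)).
    by move=> y _; rewrite lee_fin.
  by rewrite -EFinM -EFinD lee_fin; nra.
have EQ : {ae mu, forall x, I x -> (nu%:E * (E x)%:E <= Q x)%E}.
  apply: (ae_imp eig) => x eigx Ix.
  have Q0 : (0 <= Q x)%E by apply: integral_ge0 => y _; rewrite lee_fin mulr_ge0// /trunc_error.
  rewrite -EFinM /E maxr_pMr ?(ltW nu0)// mulr0 EFin_max ge_max Q0 andbT.
  have : ((nu * `|phi x|)%:E <= (2 * (nu * C))%:E + Q x)%E.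
    apply: le_trans (step x).
    rewrite -[X in (X * _)%:E](gtr0_norm nu0) -normrM -eigx; last by rewrite inE.
    have mk : measurable_fun I (fun y => (`|x - y| `^ (- rho) * phi y)%:E).
      apply/measurable_EFinP/measurable_funM => //.
      by apply: measurable_funTS; exact: measurable_ker.
    apply: le_trans (le_abse_integral mu mI mk).
    rewrite /riesz_op /Rintegral; case: (\int[mu]_(y in I) _)%E => [s||] //=.
    - by rewrite normr0 leey.
    - by rewrite normr0 leey.
  by rewrite mulrBr EFinB leeBlDl// mulrCA.
have iEfin : (\int[mu]_(y in I) (E y)%:E < +oo)%E.
  apply: le_lt_trans (_ : A%:E < +oo)%E; last exact: ltry.
  rewrite -AE; apply: ge0_le_integral => //.
  - by move=> y _; rewrite lee_fin.
  - exact/measurable_EFinP.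
  - exact/measurable_EFinP.
  - move=> y _; rewrite lee_fin ge_max normr_ge0 andbT; lra.
have iE0 : (\int[mu]_(y in I) (E y)%:E = 0)%E.
  have : (nu%:E * \int[mu]_(y in I) (E y)%:E <= (nu / 2)%:E * \int[mu]_(y in I) (E y)%:E)%E.
    rewrite -ge0_integralZl//; last 3 first.
    - exact/measurable_EFinP.
    - by move=> y _; rewrite lee_fin.
    - by rewrite lee_fin ltW.
    apply: (@le_trans _ _ (\int[mu]_(x in I) Q x)%E).
      apply: ae_ge0_le_integral => //.
      - by move=> y _; rewrite -EFinM lee_fin mulr_ge0// ltW.
      - by apply: measurable_funeM; exact/measurable_EFinP.
      - by move=> x _; apply: integral_ge0 => y _; rewrite lee_fin mulr_ge0// /trunc_error.
    apply: (le_trans iQ); apply: lee_wpmul2r; last by rewrite lee_fin.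
    by apply: integral_ge0 => y _; rewrite lee_fin.
  have : (0 <= \int[mu]_(y in I) (E y)%:E)%E.
    by apply: integral_ge0 => y _; rewrite lee_fin.
  move: iEfin; case: (\int[mu]_(y in I) _)%E => [s||]//= _.
  rewrite lee_fin => s0; rewrite -!EFinM lee_fin => h; congr EFin; clear -s0 h nu0; nra.
exists (2 * C).
have mE' : measurable_fun I (fun y => (E y)%:E) by exact/measurable_EFinP.
have : (\int[mu]_(y in I) `|(E y)%:E| = 0)%E.
  rewrite -[RHS]iE0; apply: eq_integral => y _; by rewrite gee0_abs// lee_fin.
move/(ae_eq_integral_abs mu mI mE').1 => H; apply: (ae_imp H) => x h Ix.
have := h Ix => -[] /eqP; rewrite eq_le => /andP[+ _].
by rewrite ge_max lexx andbT subr_le0.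
Qed.

(** An eigenfunction agrees almost everywhere with a bounded function [psi], and the
    operator maps bounded functions to continuous ones: the representative is
    nu^-1 K psi. *)
Lemma riesz_eigen_regular (nu : R) (phi : R -> R) : 0 < nu -> riesz_eigen rho nu phi ->
  exists2 Phi, riesz_eigenfunction rho nu Phi & {ae mu, forall x, I x -> Phi x = phi x}.
Proof.
move=> nu0 eig; have [M phiM] := riesz_eigen_bounded nu0 eig.
case: eig => L2phi eig.
have mphi := L2_measurable L2phi.
pose psi y := Num.max (- `|M|) (Num.min `|M| (phi y)).
have mpsi : measurable_fun I psi.
  by apply: measurable_maxr => //; exact: measurable_minr.
have psiM y : I y -> `|psi y| <= `|M|.
  move=> _; have := normr_ge0 M; rewrite /psi; set m := `|M| => m0.
  by rewrite ler_norml le_max lexx ge_max ge_min lexx/= andbT; lra.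
have psiphi : {ae mu, forall x, I x -> psi x = phi x}.
  apply: (ae_imp phiM) => x h Ix; have := h Ix.
  have := ler_norm M; rewrite /psi; set m := `|M| => m0 px.
  have : `|phi x| <= m by exact: le_trans px m0.
  rewrite ler_norml => /andP[h1 h2].
  by rewrite min_r// max_r.
have congK (g h : R -> R) : measurable_fun I g -> measurable_fun I h ->
    {ae mu, forall x, I x -> g x = h x} -> forall x, riesz_op rho g x = riesz_op rho h x.
  move=> mg mh gh x; rewrite /riesz_op /Rintegral; congr fine.
  apply: ae_eq_integral => //.
  - by apply/measurable_EFinP/measurable_funM => //; apply: measurable_funTS; exact: measurable_ker.
  - by apply/measurable_EFinP/measurable_funM => //; apply: measurable_funTS; exact: measurable_ker.
  - by apply: (ae_imp gh) => y ghy Iy; rewrite /= ghy.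
pose Phi x := nu^-1 * riesz_op rho psi x.
have cPhi : continuous Phi.
  by apply: continuous_mul; [move=> ?; exact: cvg_cst|exact: (riesz_continuous hrho mpsi psiM)].
have Phiphi : {ae mu, forall x, I x -> Phi x = phi x}.
  apply: (ae_imp eig) => x h Ix; rewrite /Phi (congK _ phi)// h ?inE//.
  by rewrite mulrA mulVf ?gt_eqF// mul1r.
exists Phi => //; split=> // x _.
rewrite (congK _ psi)//.
- by rewrite /Phi mulrA divff ?gt_eqF// mul1r.
- by apply: measurable_funTS; exact: continuous_measurable_fun.
- by apply: (ae_imp2 Phiphi psiphi) => y h1 h2 Iy; rewrite h1// h2.
Qed.

End regularity.

(** * The spectrum in terms of continuous eigenfunctions *)
Section spectrum.
Context {R : realType}.
Notation mu := (@lebesgue_measure R).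
Notation I := (`]0 : R, 1 : R[%classic).
Variable rho : R.
Hypothesis hrho : 0 < rho < 1.

Let mI : measurable I. Proof. exact: measurable_itv. Qed.

Lemma continuous_integrable_unit (g : R -> R) : continuous g ->
  mu.-integrable I (EFin \o g).
Proof.
by move=> cg; apply: (@continuous_integrable_itv _ _ 0 1) => //; exact: subset_itv_oo_cc.
Qed.

Lemma continuous_measurable_unit (g : R -> R) : continuous g -> measurable_fun I g.
Proof. by move=> cg; apply: measurable_funTS; exact: continuous_measurable_fun. Qed.

Lemma continuous_bounded_unit (g : R -> R) : continuous g ->
  exists2 M : R, 0 < M & forall y, I y -> `|g y| <= M.
Proof.
move=> cg; have [M M0 gM] := continuous_bounded01 (continuous_subspaceT cg).
exists M => // y; rewrite /= in_itv/= => /andP[/ltW y0 /ltW y1].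
by apply: gM; rewrite y0 y1.
Qed.

Lemma continuous_sqr_integral_eq0 (k : R -> R) : continuous k ->
  \int[mu]_(s in I) (k s * k s) <= 0 -> forall x, 0 <= x <= 1 -> k x = 0.
Proof.
move=> ck k0 x x01; apply/eqP/contraT => kx.
have c0 : 0 < `|k x| / 2 by rewrite divr_gt0 ?normr_gt0.
have := ck x => /cvgrPdist_lt /(_ _ c0) /nbhs_ballP[d /= d0 kd].
pose a := Num.max 0 (x - d); pose b := Num.min 1 (x + d).
have ab : a < b.
  rewrite /a /b gt_max !lt_min ltr01/=; case/andP: x01 => ? ?.
  by apply/andP; split; [lra|apply/andP; split; lra].
have sub : `]a, b[ `<=` I.
  move=> y; rewrite /= !in_itv/= /a /b gt_max lt_min => /andP[/andP[y0 _] /andP[y1 _]].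
  by rewrite y0 y1.
have ckk : continuous (fun s => k s * k s) by exact: continuous_mul.
have ikk := continuous_integrable_unit ckk.
have : \int[mu]_(s in `]a, b[) (`|k x| / 2 * (`|k x| / 2)) <= \int[mu]_(s in I) (k s * k s).
  apply: (@le_trans _ _ (\int[mu]_(s in `]a, b[) (k s * k s))).
    apply: le_Rintegral => //.
    - apply: (@bounded_integrable _ _ (b - a) _ `|(`|k x| / 2 * (`|k x| / 2))|) => //.
      by rewrite lebesgue_measure_itv/= lte_fin ab -EFinB.
    - exact: (@integrableS _ _ _ mu I).
    - move=> y; rewrite /= in_itv/= /a /b gt_max lt_min.
      move=> /andP[/andP[_ y0] /andP[_ y1]].
      have : `|k x - k y| < `|k x| / 2.
        by apply: kd; rewrite /ball/= ltr_norml; apply/andP; split; lra.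
      rewrite -[k y * k y]ger0_norm -?expr2 ?sqr_ge0// normrX.
      have := lerB_dist (k x) (k y); move=> h1 h2.
      have h3 : `|k x| / 2 <= `|k y| by lra.
      by rewrite lerXn2r ?nnegrE ?(ltW c0).
  rewrite /Rintegral fine_le//.
  - by apply: integrable_fin_num => //; exact: (@integrableS _ _ _ mu I).
  - by apply: integrable_fin_num.
  - apply: ge0_subset_integral => //; first exact: (measurable_int mu ikk).
    by move=> y _; rewrite lee_fin -expr2 sqr_ge0.
rewrite Rintegral_cst// [X in fine X]lebesgue_measure_itv/= lte_fin ab -EFinB/=.
move=> h; have : 0 < `|k x| / 2 * (`|k x| / 2) * (b - a) by apply: mulr_gt0; [exact: mulr_gt0|rewrite subr_gt0].
by rewrite ltNge (le_trans h k0).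
Qed.

Lemma riesz_linear (a b : R) (g h : R -> R) (x : R) : continuous g -> continuous h ->
  riesz_op rho (fun y => a * g y + b * h y) x = a * riesz_op rho g x + b * riesz_op rho h x.
Proof.
move=> cg ch.
have [M _ gM] := continuous_bounded_unit cg.
have [N _ hN] := continuous_bounded_unit ch.
have ig := ker_mul_integrable hrho (continuous_measurable_unit cg) gM x.
have ih := ker_mul_integrable hrho (continuous_measurable_unit ch) hN x.
rewrite /riesz_op -RintegralZl// -RintegralZl// -RintegralD//.
- by apply: eq_Rintegral => y _; ring.
- by have := @integrableZl _ _ _ mu I mI a _ ig; apply: eq_integrable => // y _ /=; rewrite EFinM.
- by have := @integrableZl _ _ _ mu I mI b _ ih; apply: eq_integrable => // y _ /=; rewrite EFinM.
Qed.

Lemma continuous_lin (a b : R) (g h : R -> R) : continuous g -> continuous h ->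
  continuous (fun y => a * g y + b * h y).
Proof.
move=> cg ch y; apply: cvgD.
- by apply: cvgM; [exact: cvg_cst|exact: cg].
- by apply: cvgM; [exact: cvg_cst|exact: ch].
Qed.

(** The combination h - (h(1) / g(1)) g vanishes at 1, hence everywhere; the
    normalization leaves only the factors 1 and -1. *)
Lemma riesz_eigenfunction_sign (nu : R) (g h : R -> R) : 0 < nu ->
  riesz_eigenfunction rho nu g -> riesz_eigenfunction rho nu h ->
  L2_inner g g = 1 -> L2_inner h h = 1 ->
  exists b : bool, forall x, 0 <= x <= 1 -> h x = (-1) ^+ b * g x.
Proof.
move=> nu0 eg eh g1 h1; have [cg gE] := eg; have [ch hE] := eh.
have g10 : g 1 != 0.
  apply/eqP => g10; have := riesz_eigenfunction_endpoint hrho nu0 eg g10.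
  by rewrite -/(L2_inner g g) g1 ler10.
pose c := h 1 / g 1.
pose k := fun y => 1 * h y + (- c) * g y.
have ck : continuous k by exact: continuous_lin.
have ek : riesz_eigenfunction rho nu k.
  by split=> // x x01; rewrite riesz_linear// gE// hE// /k; ring.
have k1 : k 1 = 0 by rewrite /k /c mul1r mulNr divfK// subrr.
have k0 := continuous_sqr_integral_eq0 ck (riesz_eigenfunction_endpoint hrho nu0 ek k1).
have hc x : 0 <= x <= 1 -> h x = c * g x.
  by move=> /k0; rewrite /k mul1r mulNr => /eqP; rewrite subr_eq0 => /eqP.
have : c ^+ 2 = 1.
  rewrite -h1 /L2_inner (@eq_Rintegral _ _ _ mu I (fun x => c ^+ 2 * (g x * g x))).
    rewrite RintegralZl//; last by apply: continuous_integrable_unit; exact: continuous_mul.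
    by rewrite -/(L2_inner g g) g1 mulr1.
  move=> x /set_mem; rewrite /= in_itv/= => /andP[/ltW x0 /ltW x1].
  by rewrite hc ?x0 ?x1//; ring.
move/eqP; rewrite sqrf_eq1 => /orP[] /eqP c1.
- by exists false => x /hc ->; rewrite c1.
- by exists true => x /hc ->; rewrite c1.
Qed.

Lemma continuous_L2 (g : R -> R) : continuous g -> L2 g.
Proof.
move=> cg; have mg := continuous_measurable_unit cg.
have mg' : measurable_fun [set: R] (g \_ I) by apply/(measurable_restrictT _ _).1.
rewrite /L2 inE; apply/andP; split; first by rewrite inE.
rewrite inE/= /finite_norm unlock.
apply: poweR_lty.
have ikk : mu.-integrable I (EFin \o (fun s => g s * g s)).
  by apply: continuous_integrable_unit; exact: continuous_mul.
rewrite (_ : (\int[mu]_x _)%E = (\int[mu]_(x in I) `|(g x * g x)%:E|)%E); last first.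
  rewrite [RHS]integral_mkcond; apply: eq_integral => x _; rewrite /= !patchE.
  case: ifP => _; last by rewrite normr0 powR0.
  by rewrite powR_mulrn// -normrX expr2.
by case/integrableP: ikk.
Qed.

Lemma riesz_eigenfunction_eigen (nu : R) (g : R -> R) :
  riesz_eigenfunction rho nu g -> riesz_eigen rho nu g.
Proof.
move=> [cg gE]; split; first exact: continuous_L2.
apply: aeW => x; rewrite in_itv/= => /andP[/ltW x0 /ltW x1].
by apply: gE; rewrite x0 x1.
Qed.

Lemma L2_inner_ae (g g' h h' : R -> R) :
  measurable_fun I g -> measurable_fun I g' -> measurable_fun I h -> measurable_fun I h' ->
  {ae mu, forall x, I x -> g x = g' x} -> {ae mu, forall x, I x -> h x = h' x} ->
  L2_inner g h = L2_inner g' h'.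
Proof.
move=> mg mg' mh mh' gg hh; rewrite /L2_inner /Rintegral; congr fine.
apply: ae_eq_integral => //.
- by apply/measurable_EFinP; exact: measurable_funM.
- by apply/measurable_EFinP; exact: measurable_funM.
- by apply: (ae_imp2 gg hh) => x h1 h2 Ix; rewrite /= h1// h2.
Qed.

(** In the last clause, an eigenfunction whose eigenvalue is not listed is orthogonal
    to all the others by symmetry, hence zero by completeness. *)
Lemma riesz_spectrum_continuous (lam : nat -> R) : riesz_spectrum rho lam ->
  exists Phi : nat -> R -> R,
    [/\ forall i, riesz_eigenfunction rho (lam i) (Phi i),
        forall i k, L2_inner (Phi i) (Phi k) = (i == k)%:R &
        forall nu g, 0 < nu -> riesz_eigenfunction rho nu g -> L2_inner g g = 1 ->
          exists k, nu = lam k].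
Proof.
move=> [lampos [phi [eig orth compl]]].
have lam0 i : 0 < lam i by have /andP[h1 h2] := lampos i; exact: lt_le_trans h2.
have /choice[Phi PhiP] : forall i, exists Phi, riesz_eigenfunction rho (lam i) Phi /\
    {ae mu, forall x, I x -> Phi x = phi i x}.
  by move=> i; have [Phi h1 h2] := riesz_eigen_regular hrho (lam0 i) (eig i); exists Phi.
have mP i : measurable_fun I (Phi i).
  by apply: continuous_measurable_unit; have [[]] := PhiP i.
have mp i : measurable_fun I (phi i) by apply: L2_measurable; have [] := eig i.
exists Phi; split.
- by move=> i; have [] := PhiP i.
- move=> i k; rewrite -orth; apply: L2_inner_ae => //.
  + by have [] := PhiP i.
  + by have [] := PhiP k.
- move=> nu g nu0 eg g1; apply: contrapT => nex.
  have [cg gE] := eg.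
  have gP k : L2_inner g (phi k) = 0.
    have -> : L2_inner g (phi k) = L2_inner g (Phi k).
      apply: L2_inner_ae => //; [exact: continuous_measurable_unit..| |].
        by apply: aeW.
      by apply: (ae_imp (PhiP k).2) => x h Ix; rewrite h.
    have [[cP PE] _] := PhiP k.
    have [M _ gM] := continuous_bounded_unit cg.
    have [N _ PN] := continuous_bounded_unit cP.
    have := riesz_symmetric hrho (continuous_measurable_unit cg) gM (mP k) PN.
    have iE : mu.-integrable I (EFin \o (fun s => g s * Phi k s)).
      by apply: continuous_integrable_unit; exact: continuous_mul.
    rewrite (@eq_Rintegral _ _ _ mu I (fun s => lam k * (g s * Phi k s))); last first.
      move=> x /set_mem; rewrite /= in_itv/= => /andP[/ltW x0 /ltW x1].
      by rewrite PE ?x0 ?x1// mulrCA.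
    rewrite [X in _ = X -> _](@eq_Rintegral _ _ _ mu I (fun s => nu * (g s * Phi k s))); last first.
      move=> x /set_mem; rewrite /= in_itv/= => /andP[/ltW x0 /ltW x1].
      by rewrite gE ?x0 ?x1// mulrCA [g x * _]mulrC.
    rewrite !RintegralZl// -/(L2_inner g (Phi k)) => /eqP.
    rewrite -subr_eq0 -mulrBl mulf_eq0 subr_eq0 => /orP[/eqP e|/eqP//].
    by exfalso; apply: nex; exists k.
  have := compl nu g nu0 (riesz_eigenfunction_eigen eg) gP => g0.
  have : L2_inner g g = L2_inner (fun=> 0) (fun=> 0).
    have g0' : {ae mu, forall x, I x -> g x = 0}.
      by apply: (ae_imp g0) => x h Ix; apply: h; rewrite inE.
    by apply: L2_inner_ae => //; exact: continuous_measurable_unit.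
  rewrite g1 /L2_inner mulr0 Rintegral_cst// mul0r => /eqP.
  by rewrite oner_eq0.
Qed.

(** A point where [f] and [g] differ would be surrounded by an interval, of positive
    measure, where they differ. *)
Lemma within_continuous_ae_eq (f g : R -> R) :
  {within `[0, 1], continuous f} -> {within `[0, 1], continuous g} ->
  {ae mu, forall x, I x -> f x = g x} -> forall x, 0 <= x <= 1 -> f x = g x.
Proof.
move=> cf cg fg x x01; apply/eqP/contraT => fgx.
have c0 : 0 < `|f x - g x| / 2 by rewrite divr_gt0 ?normr_gt0 ?subr_eq0.
have Ix : `[0, 1]%classic x by rewrite /= in_itv.
have [d d0 fd] : exists2 d : R, 0 < d & forall y, 0 <= y <= 1 -> `|x - y| < d ->
    `|f x - f y| < `|f x - g x| / 2 /\ `|g x - g y| < `|f x - g x| / 2.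
  have := (subspace_continuousP _ _).1 cf x Ix => /cvgrPdist_lt /(_ _ c0).
  rewrite near_withinE => /nbhs_ballP[d /= d0 fd].
  have := (subspace_continuousP _ _).1 cg x Ix => /cvgrPdist_lt /(_ _ c0).
  rewrite near_withinE => /nbhs_ballP[e /= e0 ge].
  exists (Num.min d e); first by rewrite lt_min d0.
  move=> y y01; rewrite lt_min => /andP[xd xe].
  by split; [apply: fd|apply: ge] => //=; rewrite in_itv.
pose a := Num.max 0 (x - d); pose b := Num.min 1 (x + d).
have ab : a < b.
  rewrite /a /b gt_max !lt_min ltr01/=; case/andP: x01 => ? ?.
  by apply/andP; split; [lra|apply/andP; split; lra].
have [N [mN N0 subN]] := fg.
have : (mu `]a, b[ <= mu N)%E.
  apply: le_measure; rewrite ?inE// => y yab.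
  apply: subN => /= H; move: yab; rewrite /= in_itv/= /a /b gt_max lt_min.
  move=> /andP[/andP[y0 yd] /andP[y1 ye]].
  have y01 : 0 <= y <= 1 by rewrite !ltW.
  have xy : `|x - y| < d by rewrite ltr_norml; apply/andP; split; lra.
  have [h1 h2] := fd y y01 xy.
  have fgy : f y = g y by apply: H; rewrite /= in_itv/= y0 y1.
  rewrite fgy in h1; rewrite distrC in h2.
  have := ler_distD (g y) (f x) (g x); apply/negP; rewrite -ltNge.
  by rewrite [ltRHS]splitr ltrD.
rewrite N0 lebesgue_measure_itv/= lte_fin ab -EFinB lee_fin.
by rewrite subr_le0 leNgt ab.
Qed.

Lemma riesz_normalized_regular (nu : R) (f : R -> R) : 0 < nu ->
  riesz_normalized_eigenfunction rho nu f ->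
  exists F, [/\ riesz_eigenfunction rho nu F, L2_inner F F = 1 &
    forall x, 0 <= x <= 1 -> F x = f x].
Proof.
move=> nu0 [cf eig f1].
have [F eF Ff] := riesz_eigen_regular hrho nu0 eig.
have [cF _] := eF.
have mf : measurable_fun I f by apply: L2_measurable; have [] := eig.
have mF := continuous_measurable_unit cF.
exists F; split=> //; first by rewrite -f1; exact: L2_inner_ae.
exact: within_continuous_ae_eq (continuous_subspaceT cF) cf Ff.
Qed.

End spectrum.

(** * Slowly varying functions *)
Section uniform_convergence.
Context {R : realType}.
Notation mu := (@lebesgue_measure R).
Variable L : R -> R.
Hypothesis Lpos : forall x, 0 <= x -> 0 < L x.
Hypothesis Lcvg : forall a, 0 < a -> L (a * x) / L x @[x --> +oo] --> (1 : R).
Hypothesis Lmeas : lebesgue_measurable_fun `[0, +oo[ L.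

Let mu_le (A B : set R) : measurable A -> measurable B -> A `<=` B -> (mu A <= mu B)%E.
Proof. by move=> mA mB AB; apply: (@le_measure _ R _ mu A B) => //; rewrite inE. Qed.

Lemma ratio_near1 (a d : R) : 0 < a -> 0 < d ->
  exists X : R, forall x, X < x -> `|L (a * x) / L x - 1| < d.
Proof.
move=> a0 d0; have /cvgrPdist_lt /(_ _ d0) := Lcvg a0.
by move=> [X [_ XH]]; exists X => x Xx; rewrite distrC; exact: XH.
Qed.

(** Each a lies in finitely many of the sets where |L(a y_m) / L(y_m) - 1| >= d, so the
    measures of the unions of their tails tend to 0.  [L] is only measurable for the
    completed sigma-algebra, so each such set is squeezed between a Borel set [G] and
    its union with a Borel null set [Z]. *)
Lemma bad_ratios_small (B d : R) (y : nat -> R) : 0 < d ->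
  (forall m, m.+1%:R <= y m) -> forall e : R, 0 < e ->
  exists N : nat, forall m, (N <= m)%N -> exists D : set R,
    [/\ measurable D, (mu D < e%:E)%E &
      forall a, 1 <= a <= B -> d <= `|L (a * y m) / L (y m) - 1| -> D a].
Proof.
move=> d0 ym e e0.
have y0 m : 0 < y m by apply: lt_le_trans (ym m).
pose S m : set R := [set v | d <= `|v / L (y m) - 1|].
have mS m : measurable (S m).
  have mf : measurable_fun [set: R] (fun v => `|v / L (y m) - 1|).
    by apply: measurableT_comp => //; apply: measurable_funB => //; exact: mulrr_measurable.
  have := mf measurableT `[d, +oo[%classic (measurable_itv _); rewrite setTI.
  congr (measurable _); apply/seteqP; split => v; rewrite /S/= in_itv/= andbT//.
have split m : exists G Z : set R, [/\ measurable G, measurable Z, mu Z = 0%E,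
    G `<=` [set a | 1 <= a <= B /\ S m (L (a * y m))] &
    [set a | 1 <= a <= B /\ S m (L (a * y m))] `<=` G `|` Z].
  have [A mA [N [M [mM M0 NM]] AN]] := Lmeas (mS m).
  have msc : measurable_fun [set: R] (fun a => y m * a + 0).
    by apply: measurable_funD => //; exact: mulrl_measurable.
  pose sc := fun a : R => y m * a + 0.
  have mpre (C : set R) : measurable C -> measurable (sc @^-1` C).
    by move=> mC; have := msc measurableT C mC; rewrite setTI.
  exists (`[1, B] `&` sc @^-1` A), (sc @^-1` M); split.
  - by apply: measurableI => //; exact: mpre.
  - exact: mpre.
  - have := lebesgue_measure_affine 0 (lt0r_neq0 (y0 m)) mM.
    rewrite M0 => /eqP; rewrite mule_eq0 => /orP[|/eqP//].
    by rewrite eqe normr_eq0 gt_eqF.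
  - move=> a [/=]; rewrite in_itv/= => aB Aa; split => //.
    have : (`[0, +oo[ `&` L @^-1` S m) (sc a) by rewrite -AN; left.
    by case; rewrite /sc addr0 mulrC.
  - move=> a /= [aB Sa].
    have : (`[0, +oo[ `&` L @^-1` S m) (sc a).
      rewrite /sc addr0 mulrC; split => //=.
      rewrite in_itv/= andbT mulr_ge0 ?(ltW (y0 m))//.
      by case/andP: aB => h _; apply: le_trans h.
    rewrite -AN => -[Aa|Na]; [left|right; exact: NM].
    by split => //=; rewrite in_itv.
have /choice[G /choice[Z GZ]] := split.
pose H n := \bigcup_(m in [set m | (n <= m)%N]) G m.
have mG m : measurable (G m) by have [] := GZ m.
have mH n : measurable (H n) by apply: bigcup_measurable => m _.
have HB n : H n `<=` `[1, B].
  move=> a [m _ Gma]; have [_ _ _ GS _] := GZ m.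
  by have [] := GS _ Gma; rewrite /= in_itv.
have muB : (mu `[1%R, B] < +oo)%E.
  by rewrite lebesgue_measure_itv/= lte_fin; case: ifP => _; rewrite -?EFinB ltry.
have H0 : \bigcap_n H n = set0.
  apply/seteqP; split => // a Ha.
  have a1 : 0 < a.
    by have := HB 0%N _ (Ha 0%N I); rewrite /= in_itv/= => /andP[h _]; exact: lt_le_trans h.
  have [X HX] := ratio_near1 a1 d0.
  have [m /= nm Gma] := Ha (Num.bound `|X|) I.
  have [_ _ _ GS _] := GZ m.
  have [_] := GS _ Gma; rewrite /S/= leNgt HX//.
  apply: (le_lt_trans (ler_norm X)); apply: lt_le_trans (ym m).
  apply: (lt_trans (archi_boundP (normr_ge0 X))).
  by rewrite ltr_nat ltnS.
have cvH : mu (H n) @[n --> \oo] --> 0%E.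
  rewrite -(@measure0 _ _ _ mu) -H0; apply: nonincreasing_cvg_mu => //.
  - apply: le_lt_trans muB; exact: mu_le (mH _) (measurable_itv _) (HB _).
  - by rewrite H0.
  - move=> n m nm; apply/subsetPset => a [k /= mk Gka]; exists k => //=.
    exact: leq_trans mk.
have [N _ HN] : \forall n \near \oo, (mu (H n) < e%:E)%E.
  move/fine_cvgP: cvH => [fin /cvgrPdist_lt /(_ _ e0)].
  apply: filterS2 fin => n fin; rewrite sub0r normrN => h.
  by rewrite -(fineK fin) lte_fin; exact: le_lt_trans (ler_norm _) h.
exists N => m Nm; have [_ mZ Z0 _ sub] := GZ m.
exists (G m `|` Z m); split; first exact: measurableU.
  apply: (@le_lt_trans _ _ (mu (H m))); last exact: HN.
  apply: (le_trans (measureU2 mu (mG m) mZ)); rewrite [X in (_ + X)%E](_ : _ = 0%E) ?adde0; last exact: Z0.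
  apply: (mu_le (mG m) (mH m)) => a Ga.
  by exists m => /=.
by move=> a aB da; apply: sub.
Qed.

(** The uniform convergence theorem.  If it failed along points x_m and factors c_m,
    then for every a in [c_m, 2 A] one of the ratios L(a x_m) / L(x_m) and
    L(a x_m) / L(c_m x_m) would be away from 1, since their quotient is
    L(c_m x_m) / L(x_m).  But by [bad_ratios_small] the two exceptional sets are too
    small to cover an interval of length at least A. *)
Lemma slowly_varying_uniform (A eta : R) : 1 <= A -> 0 < eta ->
  exists N : nat, forall x c, N%:R <= x -> 1 <= c <= A -> `|L (c * x) / L x - 1| <= eta.
Proof.
move=> A1 eta0; apply: contrapT => bad.
have /choice[xc xcP] : forall m : nat, exists z : R * R,
    [/\ m.+1%:R <= z.1, 1 <= z.2 <= A & eta < `|L (z.2 * z.1) / L z.1 - 1|].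
  move=> m; apply: contrapT => H; apply: bad; exists m.+1 => x c mx cA.
  by rewrite leNgt; apply/negP => h; apply: H; exists (x, c).
pose x m := (xc m).1; pose c m := (xc m).2.
have xm m : m.+1%:R <= x m by have [] := xcP m.
have cA m : 1 <= c m <= A by have [] := xcP m.
have c0 m : 0 < c m by have /andP[h _] := cA m; exact: lt_le_trans h.
have x0 m : 0 < x m by exact: lt_le_trans (xm m).
have cxm m : m.+1%:R <= c m * x m.
  by apply: le_trans (xm m) _; rewrite ler_peMl ?(ltW (x0 m))//; case/andP: (cA m).
pose d := Num.min 2^-1 (eta / 8).
have d0 : 0 < d by rewrite lt_min invr_gt0 ltr0n divr_gt0.
have d2 : d <= 2^-1 by rewrite ge_min lexx.
have d8 : d <= eta / 8 by rewrite ge_min lexx orbT.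
have q4 : 0 < 4^-1 :> R by rewrite invr_gt0.
have [N1 H1] := @bad_ratios_small (2 * A) d x d0 xm 4^-1 q4.
have [N2 H2] := @bad_ratios_small (2 * A) d (fun m => c m * x m) d0 cxm 4^-1 q4.
pose m := maxn N1 N2.
have [D [mD Dlt DP]] := H1 m (leq_maxl _ _).
have [E [mE Elt EP]] := H2 m (leq_maxr _ _).
pose cE := [set a : R | E ((c m)^-1 * a + 0)].
have mcE : measurable cE.
  have msc : measurable_fun [set: R] (fun a => (c m)^-1 * a + 0).
    by apply: measurable_funD => //; exact: mulrl_measurable.
  by have := msc measurableT E mE; rewrite setTI.
have mucE : (mu cE = (c m)%:E * mu E)%E.
  have ci : (c m)^-1 != 0 by rewrite invr_eq0 gt_eqF.
  rewrite -(lebesgue_measure_affine 0 ci mE) muleA -EFinM ger0_norm ?invr_ge0 ?(ltW (c0 m))//.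
  by rewrite divff ?gt_eqF// mul1e.
have cover : `[c m, 2 * A] `<=` D `|` cE.
  move=> a; rewrite /= in_itv/= => /andP[ca aA].
  have /andP[c1 cA'] := cA m.
  have a1 : 1 <= a <= 2 * A by rewrite aA (le_trans c1).
  have [ad|ad] := leP d `|L (a * x m) / L (x m) - 1|; first by left; exact: DP.
  right; rewrite /cE/= addr0 mulrC; apply: EP.
    rewrite ler_pdivlMr// mul1r ca/= ler_pdivrMr//; apply: (le_trans aA).
    by rewrite ler_peMr//; lra.
  rewrite leNgt; apply/negP => be.
  have [_ _] := xcP m; rewrite -/(x m) -/(c m) ltNge => /negP; apply.
  move: ad be; rewrite mulrA divfK ?gt_eqF//.
  have : 0 < L (x m) by apply: Lpos; exact: ltW.
  have : 0 < L (c m * x m) by apply: Lpos; rewrite mulr_ge0 ?ltW.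
  have : 0 < L (a * x m) by apply: Lpos; rewrite mulr_ge0 ?ltW//; lra.
  set p := L (a * x m); set q := L (c m * x m); set r := L (x m) => p0 q0 r0.
  have -> : q / r = (p / r) / (p / q) by field; rewrite !gt_eqF.
  have P0 : 0 < p / q by exact: divr_gt0.
  move: (p / r) (p / q) P0 => s t t0.
  rewrite !ltr_norml => /andP[s1 s2] /andP[t1 t2].
  have -> : s / t - 1 = (s - t) / t by field; rewrite gt_eqF.
  rewrite normrM normfV (gtr0_norm t0) ler_pdivrMr//.
  by rewrite ler_norml; apply/andP; split; nra.
have : (mu `[c m, (2 * A)%R] <= mu D + mu cE)%E.
  apply: (le_trans _ (measureU2 mu mD mcE)).
  by apply: mu_le => //; exact: measurableU.
have /andP[c1 cA'] := cA m.
rewrite lebesgue_measure_itv/= lte_fin ifT; last by lra.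
rewrite mucE -EFinB.
have fD : mu D \is a fin_num by rewrite ge0_fin_numE//; exact: lt_trans Dlt (ltry _).
have fE : mu E \is a fin_num by rewrite ge0_fin_numE//; exact: lt_trans Elt (ltry _).
move: Dlt Elt; rewrite -(fineK fD) -(fineK fE) !lte_fin -EFinM -EFinD lee_fin.
have : 0 <= fine (mu E) by exact: fine_ge0.
set s := fine (mu D); set t := fine (mu E) => t0 sl tl.
nra.
Qed.

End uniform_convergence.

Section potter.
Context {R : realType}.
Variable L : R -> R.
Hypothesis Lpos : forall x, 0 <= x -> 0 < L x.
Hypothesis Lcvg : forall a, 0 < a -> L (a * x) / L x @[x --> +oo] --> (1 : R).
Hypothesis Lmeas : lebesgue_measurable_fun `[0, +oo[ L.

Let Ln0 n : 0 < L n%:R. Proof. exact: Lpos. Qed.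

(** Halve n until its ratio to h is at most 3.  Each halving loses at most the factor [q] in L, by the uniform
    convergence theorem, and gains at least (3/2)^d = 1/q in the power. *)
Lemma potter_monotone (d : R) : 0 < d -> exists N : nat, exists2 q : R, 0 < q &
  forall n h, (N <= h <= n)%N ->
    q * (L h%:R * h.+1%:R `^ d) <= L n%:R * n.+1%:R `^ d.
Proof.
move=> d0; pose q : R := (3 / 2) `^ (- d).
have q0 : 0 < q by rewrite powR_gt0// divr_gt0.
have q1 : q < 1.
  rewrite /q powRN invf_lt1 ?powR_gt0 ?divr_gt0//.
  have := @gt0_ltr_powR R d d0 1 (3 / 2); rewrite powR1; apply; rewrite ?nnegrE//; lra.
have qm : q * (3 / 2) `^ d = 1 by rewrite /q powRN mulVf// gt_eqF// powR_gt0// divr_gt0.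
have A1 : 1 <= 3 :> R by rewrite ler1n.
have e0 : 0 < 1 - q by rewrite subr_gt0.
have [N HN] := slowly_varying_uniform Lpos Lcvg Lmeas A1 e0.
exists (maxn N 1), q => //.
have stepL (m n : nat) : (maxn N 1 <= m)%N -> (m <= n <= 3 * m)%N -> q * L m%:R <= L n%:R.
  rewrite geq_max => /andP[Nm m1] /andP[mn n3].
  have m0 : 0 < m%:R :> R by rewrite ltr0n.
  have := HN m%:R (n%:R / m%:R); rewrite ler_nat => /(_ Nm).
  rewrite ler_pdivlMr// mul1r ler_nat mn ler_pdivrMr// -natrM ler_nat n3 => /(_ isT).
  rewrite divfK ?gt_eqF// ler_norml => /andP[h _].
  by rewrite -ler_pdivlMr//; lra.
move=> n; have [k] := ubnP n; elim: k n => // k IH n nk h /andP[Nh hn].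
have h1 : (1 <= h)%N by move: Nh; rewrite geq_max => /andP[].
have [n3|n3] := leqP n (3 * h).
  rewrite mulrA; apply: ler_pM.
  - by rewrite mulr_ge0// ltW.
  - exact: powR_ge0.
  - by apply: stepL => //; rewrite hn.
  - by rewrite ge0_ler_powR ?nnegrE ?(ltW d0)// ler_nat.
have hm : (h <= n./2)%N by lia.
have mn : (n./2 < n)%N by lia.
have mk : (n./2 < k)%N by lia.
apply: (le_trans (IH n./2 mk h _)); first by rewrite Nh.
have Lm : q * L (n./2)%:R <= L n%:R.
  by apply: stepL; [exact: leq_trans hm|lia].
have pm : (3 / 2) `^ d * (n./2).+1%:R `^ d <= n.+1%:R `^ d :> R.
  rewrite -powRM ?divr_ge0//.
  rewrite ge0_ler_powR ?nnegrE ?(ltW d0) ?mulr_ge0 ?divr_ge0//.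
  rewrite mulrAC ler_pdivrMr// -!natrM ler_nat; lia.
have -> : L (n./2)%:R * (n./2).+1%:R `^ d =
   (q * L (n./2)%:R) * ((3 / 2) `^ d * (n./2).+1%:R `^ d).
  by rewrite mulrACA qm mul1r.
by apply: ler_pM => //; rewrite mulr_ge0 ?powR_ge0// ltW.
Qed.

(** The finitely many h below the threshold of [potter_monotone] are absorbed in the
    constant. *)
Lemma potter_bound (d : R) : 0 < d -> exists N : nat, exists2 C : R, 0 < C &
  forall n h, (N <= n)%N -> (h <= n)%N ->
    L h%:R / L n%:R <= C * (n.+1%:R / h.+1%:R) `^ d.
Proof.
move=> d0; have [N [q q0 H]] := potter_monotone d0.
have powV (n h : nat) : (n.+1%:R / h.+1%:R) `^ d = n.+1%:R `^ d / h.+1%:R `^ d :> R.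
  rewrite powRM ?invr_ge0//; congr (_ * _).
  by rewrite -powR_inv1// -powRrM mulN1r powRN.
pose S := \sum_(h < N.+1) L h%:R * h.+1%:R `^ d.
have S0 (h : nat) : (h <= N)%N -> L h%:R * h.+1%:R `^ d <= S.
  move=> hN; rewrite /S (bigD1 (Ordinal (hN : (h < N.+1)%N)))//= lerDl.
  by apply: sumr_ge0 => i _; rewrite mulr_ge0 ?powR_ge0// ltW.
pose w := L N%:R * N.+1%:R `^ d.
have w0 : 0 < w by rewrite mulr_gt0 ?powR_gt0.
have wS : w <= S by exact: S0.
exists N, (q^-1 * (S / w)); first by rewrite !mulr_gt0 ?invr_gt0// (lt_le_trans w0).
move=> n h Nn hn.
have P0 (k : nat) : 0 < k.+1%:R `^ d :> R by rewrite powR_gt0.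
have key : q * (L h%:R * h.+1%:R `^ d) <= (S / w) * (L n%:R * n.+1%:R `^ d).
  have [Nh|hN] := leqP N h.
    apply: (le_trans (H n h _)); first by rewrite Nh.
    by rewrite ler_peMl ?mulr_ge0 ?(ltW (P0 _)) ?(ltW (Ln0 _))// ler_pdivlMr// mul1r.
  have := H n N; rewrite leqnn Nn => /(_ isT); rewrite -/w => Hn.
  apply: (@le_trans _ _ (S / w * (q * w))); last first.
    by apply: ler_wpM2l => //; rewrite divr_ge0 ?(ltW w0)// (le_trans (ltW w0)).
  have -> : S / w * (q * w) = q * S by field; rewrite gt_eqF.
  apply: ler_wpM2l; first exact: ltW.
  by apply: S0; exact: ltnW.
rewrite powV ler_pdivrMr//.
have -> : q^-1 * (S / w) * (n.+1%:R `^ d / h.+1%:R `^ d) * L n%:R =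
  (q^-1 / h.+1%:R `^ d) * ((S / w) * (L n%:R * n.+1%:R `^ d)) by ring.
apply: le_trans (ler_wpM2l _ key); last by rewrite divr_ge0 ?invr_ge0 ?(ltW q0) ?(ltW (P0 _)).
by rewrite le_eqVlt; apply/orP; left; apply/eqP; field; rewrite !gt_eqF.
Qed.

End potter.

(** * The rescaled covariances and the kernel *)
Section discrete_kernel.
Context {R : realType}.
Variable L : R -> R.
Hypothesis Lpos : forall x, 0 <= x -> 0 < L x.
Hypothesis Lcvg : forall a, 0 < a -> L (a * x) / L x @[x --> +oo] --> (1 : R).
Hypothesis Lmeas : lebesgue_measurable_fun `[0, +oo[ L.
Variable rho : R.
Hypothesis hrho : 0 < rho < 1.

Let rho0 : 0 < rho. Proof. by case/andP: hrho. Qed.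
Let rho1 : rho < 1. Proof. by case/andP: hrho. Qed.
Let rho01 : 0 < rho <= 1. Proof. by rewrite rho0 ltW. Qed.
Let Ln0 n : 0 < L n%:R. Proof. exact: Lpos. Qed.

(** The entry of the Toeplitz matrix at distance [h], divided by n^(-rho) L(n). *)
Definition weight (n h : nat) : R := n%:R `^ rho / L n%:R * (L h%:R / (1 + h%:R) `^ rho).

Definition dist (k l : nat) : nat := `|k%:Z - l%:Z|%N.

Lemma dist_le (n k l : nat) : (k < n)%N -> (l < n)%N -> (dist k l <= n)%N.
Proof. rewrite /dist; lia. Qed.

Lemma weight_ge0 n h : 0 <= weight n h.
Proof. by rewrite mulr_ge0// divr_ge0 ?powR_ge0// ltW. Qed.

Lemma powR_div (x y s : R) : 0 <= x -> 0 <= y -> (x / y) `^ s = x `^ s / y `^ s.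
Proof.
move=> x0 y0; rewrite powRM ?invr_ge0//; congr (_ * _).
by rewrite -powR_inv1// -powRrM mulN1r powRN.
Qed.

Lemma weightE n h : weight n h = L h%:R / L n%:R * (n%:R / h.+1%:R) `^ rho.
Proof. by rewrite powR_div// /weight nat1r; ring. Qed.

(* Potter's bound with exponent p costs n^p h^(-p), and 1 - rho - p = p is still
   positive, so that the sum of h^(- rho - p) behaves like an integral. *)
Let p : R := (1 - rho) / 2.
Let p0 : 0 < p. Proof. by rewrite divr_gt0// subr_gt0. Qed.
Let p1 : p <= 1. Proof. by have := rho0; rewrite /p; lra. Qed.

Lemma weight_le : exists N : nat, exists2 C : R, 0 < C & forall n h, (N <= n)%N -> (h < n)%N ->
  weight n h <= C * (n%:R `^ (1 - p) * h.+1%:R `^ (p - 1)).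
Proof.
have [N [C C0 H]] := potter_bound Lpos Lcvg Lmeas p0.
exists N, (C * 2 `^ p); first by rewrite mulr_gt0// powR_gt0.
move=> n h Nn hn; rewrite weightE.
have n0 : 0 < n%:R :> R by rewrite ltr0n; exact: leq_ltn_trans hn.
have h0 : 0 < h.+1%:R :> R by [].
have nh0 : 0 < n%:R / h.+1%:R :> R by exact: divr_gt0.
have -> : n%:R `^ (1 - p) * h.+1%:R `^ (p - 1) = (n%:R / h.+1%:R) `^ p * (n%:R / h.+1%:R) `^ rho.
  rewrite -powRD; last by rewrite (gt_eqF nh0) implybT.
  have -> : p + rho = 1 - p by rewrite /p; field.
  by rewrite powR_div ?ltW// -powRN opprB.
rewrite [leRHS]mulrA; apply: ler_wpM2r; first exact: powR_ge0.
apply: (le_trans (H n h Nn (ltnW hn))); rewrite -mulrA; apply: ler_wpM2l; first exact: ltW.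
rewrite -powRM ?(ltW nh0)// ge0_ler_powR ?nnegrE ?(ltW p0) ?divr_ge0 ?mulr_ge0 ?(ltW nh0)//.
rewrite mulrA ler_pM2r ?invr_gt0// -natrM ler_nat; lia.
Qed.

Lemma weight_sum : exists N : nat, exists2 C : R, 0 < C & forall n m, (N <= n)%N -> (0 < n)%N ->
  (m <= n)%N -> n%:R^-1 * \sum_(h < m) weight n h <= C * (m%:R / n%:R) `^ p.
Proof.
have [N [C C0 H]] := weight_le.
exists N, (C * (2 / p)); first by rewrite mulr_gt0// divr_gt0.
move=> n m Nn n1 mn.
have n0 : 0 < n%:R :> R by rewrite ltr0n.
have : \sum_(h < m) weight n h <= C * n%:R `^ (1 - p) * (2 / p * m%:R `^ p).
  apply: (@le_trans _ _ (C * n%:R `^ (1 - p) * \sum_(h < m) h.+1%:R `^ (p - 1))).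
    rewrite mulr_sumr; apply: ler_sum => h _; rewrite -mulrA; apply: H => //.
    exact: leq_trans (ltn_ord h) mn.
  apply: ler_wpM2l; first by rewrite mulr_ge0 ?powR_ge0// ltW.
  by apply: sum_powRN_le; rewrite p0.
move=> h; apply: (le_trans (ler_wpM2l _ h)); first by rewrite invr_ge0 ltW.
rewrite powR_div// powRB ?(gt_eqF n0) ?implybT// powRr1 ?(ltW n0)//.
have np : 0 < n%:R `^ p :> R by exact: powR_gt0.
by rewrite le_eqVlt; apply/orP; left; apply/eqP; field; rewrite !gt_eqF.
Qed.

(** For h between e n and n, both L(h) / L(n) and ((h + 1) / h)^rho are close to 1;
    the first by uniform convergence over the factors n / h in [1, 1/e]. *)
Lemma weight_far (e eta : R) : 0 < e <= 1 -> 0 < eta -> exists N : nat, forall n h,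
  (N <= n)%N -> e * n%:R <= h%:R -> (h <= n)%N ->
  `|weight n h - (h%:R / n%:R) `^ (- rho)| <= eta.
Proof.
move=> /andP[e0 e1] eta0.
have A1 : 1 <= e^-1 by rewrite invf_ge1.
pose E := e `^ (- rho).
have E0 : 0 < E by rewrite powR_gt0.
pose t := Num.min 2^-1 (eta / 4 / E).
have t0 : 0 < t by rewrite lt_min invr_gt0 ltr0n !divr_gt0.
have t2 : t <= 2^-1 by rewrite ge_min lexx.
have t4 : t <= eta / 4 / E by rewrite ge_min lexx orbT.
have [N HN] := slowly_varying_uniform Lpos Lcvg Lmeas A1 t0.
pose X := N%:R / e + 2 * (E / e) / eta + 1.
exists (Num.truncn X).+1 => n h nX ehn hn.
have Xn : X < n%:R by apply: lt_le_trans (truncnS_gt X) _; rewrite ler_nat.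
have Ne0 : 0 <= N%:R / e :> R by rewrite divr_ge0 ?(ltW e0).
have Ee0 : 0 <= 2 * (E / e) / eta by rewrite ltW// divr_gt0// mulr_gt0// divr_gt0.
have n0 : 0 < n%:R :> R by rewrite /X in Xn; lra.
have hN : N%:R <= h%:R :> R.
  apply: le_trans ehn; rewrite mulrC -ler_pdivrMr//; rewrite /X in Xn; lra.
have h0 : 0 < h%:R :> R by apply: lt_le_trans ehn; rewrite mulr_gt0.
have := HN h%:R (n%:R / h%:R) hN.
rewrite divfK ?gt_eqF// ler_pdivlMr// mul1r ler_nat hn ler_pdivrMr//.
rewrite -ler_pdivrMl ?invr_gt0// invrK ehn => /(_ isT) Lr.
pose r := L n%:R / L h%:R; rewrite -/r in Lr.
have r2 : 2^-1 <= r by move: Lr; rewrite ler_norml => /andP[? _]; lra.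
have r0 : 0 < r by lra.
have Lhn : L h%:R / L n%:R = r^-1 by rewrite /r invf_div.
have rinv : `|r^-1 - 1| <= 2 * t.
  have -> : r^-1 - 1 = (1 - r) / r by field; rewrite gt_eqF.
  rewrite normrM normfV (gtr0_norm r0) ler_pdivrMr// distrC (le_trans Lr)//.
  rewrite mulrAC ler_peMl ?(ltW t0)//; lra.
rewrite weightE Lhn.
have -> : (n%:R / h.+1%:R) `^ rho = (h.+1%:R / n%:R) `^ (- rho).
  by rewrite powRN !powR_div// invf_div.
have eh : e <= h%:R / n%:R by rewrite ler_pdivlMr.
have eh1 : e <= h.+1%:R / n%:R by rewrite ler_pdivlMr// (le_trans ehn)// ler_nat.
have lip := powRN_lipschitz rho01 e0 eh1 eh.
have Pe : (h.+1%:R / n%:R) `^ (- rho) <= E.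
  rewrite /E !powRN lef_pV2 ?posrE ?powR_gt0 ?divr_gt0//.
  by rewrite ge0_ler_powR ?nnegrE ?(ltW rho0) ?(ltW e0) ?divr_ge0.
have P0 : 0 <= (h.+1%:R / n%:R) `^ (- rho) by exact: powR_ge0.
set P := (h.+1%:R / n%:R) `^ (- rho) in lip Pe P0 *.
set Q := (h%:R / n%:R) `^ (- rho) in lip *.
have -> : r^-1 * P - Q = (r^-1 - 1) * P + (P - Q) by ring.
apply: (le_trans (ler_normD _ _)).
have h1 : `|(r^-1 - 1) * P| <= eta / 2.
  rewrite normrM (ger0_norm P0); apply: (@le_trans _ _ (2 * t * E)).
    by apply: ler_pM.
  by move: t4; rewrite ler_pdivlMr//; lra.
have h2 : `|P - Q| <= eta / 2.
  apply: (le_trans lip).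
  have -> : h.+1%:R / n%:R - h%:R / n%:R = n%:R^-1 :> R by rewrite -mulrBl -natr1 addrAC subrr add0r mul1r.
  rewrite ger0_norm ?invr_ge0 ?(ltW n0)// ler_pdivrMr//.
  have : 2 * (E / e) / eta <= n%:R by rewrite /X in Xn; lra.
  by rewrite ler_pdivrMr// -/E; lra.
by rewrite [leRHS]splitr lerD.
Qed.

Lemma sum_dist_le (n m k : nat) (F : nat -> R) : (forall h, 0 <= F h) ->
  \sum_(l < n | (dist k l < m)%N) F (dist k l) <= 2 * \sum_(h < m) F h.
Proof.
move=> F0.
have -> : \sum_(l < n | (dist k l < m)%N) F (dist k l) =
    \sum_(l < n) \sum_(h < m) (dist k l == h)%:R * F h.
  rewrite big_mkcond; apply: eq_bigr => l _; case: ifPn => [lm|].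
    rewrite (bigD1 (Ordinal lm))//= eqxx mul1r big1 ?addr0// => h.
    by rewrite -val_eqE/= eq_sym => /negbTE ->; rewrite mul0r.
  rewrite -leqNgt => lm; rewrite big1// => h _.
  by rewrite gtn_eqF ?mul0r// (leq_trans (ltn_ord h)).
rewrite exchange_big mulr_sumr/=; apply: ler_sum => h _.
rewrite -mulr_suml; apply: ler_wpM2r => //.
have one (a : nat) : \sum_(l < n) (l == a :> nat)%:R <= 1 :> R.
  have [an|na] := ltnP a n.
    rewrite (bigD1 (Ordinal an))//= eqxx big1 ?addr0// => l.
    by rewrite -val_eqE/= => /negbTE ->.
  by rewrite big1// => l _; rewrite ltn_eqF// (leq_trans (ltn_ord l)).
apply: (@le_trans _ _ (\sum_(l < n) (l == (k + h)%N :> nat)%:R + \sum_(l < n) (l == (k - h)%N :> nat)%:R)).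
  rewrite -big_split; apply: ler_sum => l _ /=.
  rewrite -natrD ler_nat /dist; case: eqP => //=.
  case: eqP => //=; case: eqP => //=; lia.
by rewrite (_ : 2 = 1 + 1)// lerD.
Qed.

Lemma dist_normr (k l : nat) : `|k%:R - l%:R| = (dist k l)%:R :> R.
Proof.
by rewrite /dist natr_absz intr_norm rmorphB/= -!pmulrn.
Qed.

Lemma card_dist_le (n m k : nat) : \sum_(l < n | (dist k l < m)%N) 1 <= 2 * m%:R :> R.
Proof.
have := @sum_dist_le n m k (fun=> 1) (fun=> ler01).
by rewrite [X in _ <= 2 * X]sumr_const card_ord.
Qed.

(** Away from the diagonal this is [weight_far].  Near it the weights and the truncated
    kernel are small separately: the former by [weight_sum], the latter because about
    2 e n terms of size e^(-rho) have mean about 2 e^(1 - rho). *)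
Lemma weight_trunc_ker (eta : R) : 0 < eta -> exists2 e0 : R, 0 < e0 <= 1 & forall e, 0 < e <= e0 ->
  exists N : nat, forall n, (N <= n)%N -> forall k, (k < n)%N ->
    n%:R^-1 * \sum_(l < n) `|weight n (dist k l) - trunc_ker rho e ((k%:R - l%:R) / n%:R)| <= eta.
Proof.
move=> eta0.
have [N1 [C C0 HC]] := weight_sum.
have q0 : 0 < eta / 8 / C by rewrite !divr_gt0.
have [e1 e10 He1] := powR_small p0 q0.
have r10 : 0 < 1 - rho by rewrite subr_gt0.
have q1 : 0 < eta / 16 by rewrite divr_gt0.
have [e2 e20 He2] := powR_small r10 q1.
pose e0 := Num.min 2^-1 (Num.min (e1 / 2) e2).
have e00 : 0 < e0 by rewrite !lt_min invr_gt0 ltr0n divr_gt0.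
have e0h : e0 <= 2^-1 by rewrite ge_min lexx.
have e01 : e0 <= e1 / 2 by rewrite !ge_min lexx orbT.
have e02 : e0 <= e2 by rewrite !ge_min lexx !orbT.
exists e0; first by rewrite e00/=; lra.
move=> e /andP[ep ee0].
have e_1 : 0 < e <= 1 by rewrite ep/=; lra.
have q2 : 0 < eta / 4 by rewrite divr_gt0.
have [N2 HN2] := weight_far e_1 q2.
exists (maxn (maxn N1 N2) (Num.truncn e^-1).+1) => n.
rewrite !geq_max => /andP[/andP[nN1 nN2] ne] k kn.
have en : e^-1 < n%:R by apply: lt_le_trans (truncnS_gt _) _; rewrite ler_nat.
have n0 : 0 < n%:R :> R by apply: lt_trans en; rewrite invr_gt0.
have n1 : (0 < n)%N by rewrite -(ltr0n R).
have en1 : 1 <= e * n%:R by rewrite mulrC -ler_pdivrMr// mul1r ltW.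
pose m := (Num.truncn (e * n%:R)).+1.
have men : m%:R <= 2 * e * n%:R.
  have : (Num.truncn (e * n%:R))%:R <= e * n%:R by rewrite truncn_le// mulr_ge0// ltW.
  by rewrite /m -natr1; lra.
have mn : (m <= n)%N.
  by rewrite -(ler_nat R) (le_trans men)// ler_piMl ?(ltW n0)//; lra.
have far (l : nat) : (m <= dist k l)%N -> e * n%:R <= (dist k l)%:R.
  by move=> h; apply: ltW; apply: lt_le_trans (truncnS_gt _) _; rewrite ler_nat.
have distn (l : 'I_n) : (dist k l <= n)%N by exact: dist_le.
pose E := e `^ (- rho).
have E0 : 0 < E by rewrite powR_gt0.
have nq : `|n%:R^-1| = n%:R^-1 :> R by rewrite gtr0_norm ?invr_gt0.
have term (l : 'I_n) : `|weight n (dist k l) - trunc_ker rho e ((k%:R - l%:R) / n%:R)| <=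
    eta / 4 + (if (dist k l < m)%N then weight n (dist k l) + E * 1 else 0).
  case: ifPn => [lm|]; last first.
    rewrite -leqNgt => /far lm; rewrite addr0 trunc_ker_far.
      by rewrite normrM nq dist_normr; exact: HN2.
    by rewrite normrM nq dist_normr ler_pdivlMr.
  have w0 := weight_ge0 n (dist k l).
  have k0 := trunc_ker_ge0 rho e ((k%:R - l%:R) / n%:R).
  have kE := trunc_ker_le ((k%:R - l%:R) / n%:R) rho01 ep; rewrite -/E in kE.
  by rewrite ler_norml; apply/andP; split; lra.
have : \sum_(l < n) `|weight n (dist k l) - trunc_ker rho e ((k%:R - l%:R) / n%:R)| <=
    n%:R * (eta / 4) + (2 * \sum_(h < m) weight n h + E * (2 * m%:R)).
  apply: (le_trans (ler_sum _ (fun l _ => term l))).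
  rewrite big_split/= sumr_const card_ord -[_ *+ n]mulr_natl lerD2l -big_mkcond/=.
  rewrite big_split/=; apply: lerD; first by apply: sum_dist_le => h; exact: weight_ge0.
  by rewrite -mulr_sumr; apply: ler_wpM2l; [exact: ltW|exact: card_dist_le].
move=> h; apply: (le_trans (ler_wpM2l _ h)); first by rewrite invr_ge0 ltW.
rewrite !mulrDr mulKf ?gt_eqF//.
have b1 : n%:R^-1 * (2 * \sum_(h < m) weight n h) <= eta / 4.
  rewrite mulrCA; have := HC n m nN1 n1 mn.
  have : (m%:R / n%:R) `^ p <= eta / 8 / C.
    apply: He1; rewrite divr_ge0// ler_pdivrMr//= (le_trans men)// ler_pM2r//; lra.
  rewrite ler_pdivlMr// => h1 h2; have := le_trans h2 (_ : C * _ <= eta / 8).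
  by rewrite mulrC => /(_ h1); lra.
have b2 : n%:R^-1 * (E * (2 * m%:R)) <= eta / 4.
  have -> : n%:R^-1 * (E * (2 * m%:R)) = 2 * E * (m%:R / n%:R) by ring.
  apply: (@le_trans _ _ (2 * E * (2 * e))).
    by apply: ler_wpM2l; [rewrite mulr_ge0// ltW|rewrite ler_pdivrMr].
  have : e `^ (1 - rho) <= eta / 16 by apply: He2; rewrite (ltW ep) (le_trans ee0).
  have -> : e `^ (1 - rho) = e * E.
    by rewrite /E -{2}[e](powRr1 (ltW ep)) -powRD// (gt_eqF ep) implybT.
  lra.
move: b1 b2; set x := _ * (2 * _); set y := _ * (E * _); lra.
Qed.

End discrete_kernel.

(** * Riemann sums *)
Section riemann_sums.
Context {R : realType}.
Notation mu := (@lebesgue_measure R).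
Notation I := (`]0 : R, 1 : R[%classic).

(** Only [x] is confined to [0, 1]: the uniformity comes from the compactness of
    the set of centres. *)
Lemma heine_unit (g : R -> R) : continuous g -> forall eta : R, 0 < eta ->
  exists2 d : R, 0 < d & forall x y, 0 <= x <= 1 -> `|x - y| <= d -> `|g x - g y| <= eta.
Proof.
move=> cg eta eta0.
have e2 : 0 < eta / 2 by rewrite divr_gt0.
have /compact_near_coveringP cov : compact `[0 : R, 1 : R] by exact: segment_compact.
pose P (d x : R) := forall y, `|x - y| <= d -> `|g x - g y| <= eta.
have : \forall d \near (0 : R)^'+, `[0 : R, 1 : R] `<=` P d.
  apply: cov => x _.
  have := cg x => /cvgrPdist_lt /(_ _ e2) /nbhs_ballP[r /= r0 gr].
  have r2 : 0 < r / 2 by rewrite divr_gt0.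
  exists (ball x (r / 2), [set d : R | d < r / 2]).
    split => /=; first exact: nbhsx_ballx.
    exact: nbhs_right_lt.
  move=> [x' d] /= [xx' dr] y x'y.
  rewrite [leRHS]splitr.
  have h1 : `|g x - g x'| < eta / 2 by apply: gr; apply: lt_trans xx' _; lra.
  have h2 : `|g x - g y| < eta / 2.
    apply: gr; rewrite /ball/= in xx' *; have := ler_distD x' x y; lra.
  have := ler_distD (g x) (g x') (g y); rewrite (distrC (g x') (g x)); lra.
move=> H; have [d [/= d0 Hd]] := filter_ex (filterI (nbhs_right_gt (0 : R)) H).
by exists d => // x y x01 xy; apply: Hd => //=; rewrite in_itv.
Qed.

Lemma Rintegral_oo_cc (a b : R) (g : R -> R) : continuous g ->
  \int[mu]_(y in `]a, b[) g y = \int[mu]_(y in `[a, b]) g y.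
Proof.
move=> cg; rewrite Rintegral_itv_obnd_cbnd; last first.
  apply: (@continuous_integrable_itv _ _ a b) => //.
  exact: subset_itv_oo_cc.
rewrite Rintegral_itv_bndo_bndc//; apply: (@continuous_integrable_itv _ _ a b) => //.
exact: subset_itv_co_cc.
Qed.

Lemma riemann_sum_le (g : R -> R) (n : nat) (e : R) : (0 < n)%N -> continuous g ->
  (forall l y, (l < n)%N -> l%:R / n%:R <= y <= l.+1%:R / n%:R ->
    `|g (l.+1%:R / n%:R) - g y| <= e) ->
  `|n%:R^-1 * \sum_(l < n) g (l.+1%:R / n%:R) - \int[mu]_(y in I) g y| <= e.
Proof.
move=> n1 cg ge.
have n0 : 0 < n%:R :> R by rewrite ltr0n.
have ig (a b : R) : mu.-integrable `[a, b] (EFin \o g).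
  exact: (@continuous_integrable_itv _ _ a b).
suff H m : (m <= n)%N ->
    `|n%:R^-1 * \sum_(l < m) g (l.+1%:R / n%:R) - \int[mu]_(y in `[0, (m%:R / n%:R)%R]) g y| <=
    e * (m%:R / n%:R).
  by have := H n (leqnn n); rewrite divff ?gt_eqF// mulr1 Rintegral_oo_cc.
elim: m => [|m IH] mn.
  by rewrite big_ord0 mulr0 mul0r mulr0 set_itv1 Rintegral_set1 subr0 normr0.
rewrite big_ord_recr/= mulrDr.
have mm : m%:R / n%:R <= m.+1%:R / n%:R :> R by rewrite ler_pM2r ?invr_gt0// ler_nat.
have := @Rintegral_itvB R g (BLeft 0) (BRight (m.+1%:R / n%:R)) (m%:R / n%:R) (ig _ _).
rewrite !bnd_simp divr_ge0 ?(ltW n0)// mm => /(_ isT isT).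
set J := \int[mu]_(t in `](m%:R / n%:R), _]) _ => JE.
have mlen : mu `](m%:R / n%:R), (m.+1%:R / n%:R)]%classic = (n%:R^-1)%:E.
  rewrite lebesgue_measure_itv/= lte_fin ltr_pM2r ?invr_gt0// ltr_nat ltnSn -EFinB.
  by congr EFin; rewrite -mulrBl -natr1 addrAC subrr add0r mul1r.
have iJ : mu.-integrable `](m%:R / n%:R), (m.+1%:R / n%:R)] (EFin \o g).
  by apply: (integrableS _ _ _ (ig (m%:R / n%:R) (m.+1%:R / n%:R))) => //; exact: subset_itv_oc_cc.
have J1 : `|n%:R^-1 * g (m.+1%:R / n%:R) - J| <= e * n%:R^-1.
  have -> : n%:R^-1 * g (m.+1%:R / n%:R) =
      \int[mu]_(t in `](m%:R / n%:R), (m.+1%:R / n%:R)]) g (m.+1%:R / n%:R).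
    by rewrite Rintegral_cst// [X in fine X]mlen/= mulrC.
  rewrite /J -RintegralB//; last first.
    apply: (@bounded_integrable _ _ _ _ `|g (m.+1%:R / n%:R)| _ mlen) => //.
  apply: le_norm_Rintegral => //.
    apply: measurable_funB => //; apply: measurable_funTS.
    exact: continuous_measurable_fun.
  move=> y; rewrite /= in_itv/= => /andP[y1 y2]; apply: ge => //.
  by rewrite y2 ltW.
have IHm := IH (ltnW mn).
move: JE => /eqP; rewrite subr_eq => /eqP ->.
set S := n%:R^-1 * \sum_(l < m) _ in IHm *.
set G := n%:R^-1 * g _ in J1 *.
set K := \int[mu]_(t in _) g t in IHm *.
have -> : S + G - (J + K) = (S - K) + (G - J) by ring.
rewrite -natr1 mulrDl mul1r mulrDr.
by apply: (le_trans (ler_normD _ _)); exact: lerD.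
Qed.

Lemma node01 (n l : nat) : (l < n)%N -> 0 <= (l.+1%:R / n%:R : R) <= 1.
Proof.
move=> ln; have n0 : 0 < n%:R :> R by rewrite ltr0n; exact: leq_ltn_trans ln.
by rewrite divr_ge0//= ler_pdivrMr// mul1r ler_nat.
Qed.

Lemma riemann_sum_cvg (g : R -> R) (eta : R) : continuous g -> 0 < eta ->
  exists N : nat, forall n, (N <= n)%N ->
  `|n%:R^-1 * \sum_(l < n) g (l.+1%:R / n%:R) - \int[mu]_(y in I) g y| <= eta.
Proof.
move=> cg eta0; have [d d0 gd] := heine_unit cg eta0.
exists (Num.truncn d^-1).+1 => n ne.
have nd : d^-1 < n%:R by apply: lt_le_trans (truncnS_gt _) _; rewrite ler_nat.
have n0 : 0 < n%:R :> R by apply: lt_trans nd; rewrite invr_gt0.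
apply: riemann_sum_le => //; first by rewrite -(ltr0n R).
move=> l y ln /andP[y1 y2]; apply: gd; first exact: node01.
rewrite ger0_norm ?subr_ge0//.
have : n%:R^-1 < d by rewrite invf_plt ?posrE.
have : l.+1%:R / n%:R = l%:R / n%:R + n%:R^-1 :> R by rewrite -natr1 mulrDl mul1r.
lra.
Qed.

End riemann_sums.

(** * The rescaled Toeplitz matrices as operators *)
Section discrete_operator.
Context {R : realType}.
Variable L : R -> R.
Hypothesis Lpos : forall x, 0 <= x -> 0 < L x.
Hypothesis Lcvg : forall a, 0 < a -> L (a * x) / L x @[x --> +oo] --> (1 : R).
Hypothesis Lmeas : lebesgue_measurable_fun `[0, +oo[ L.
Variable rho : R.
Hypothesis hrho : 0 < rho < 1.

Let rho01 : 0 < rho <= 1. Proof. by case/andP: hrho => -> /ltW ->. Qed.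

(** Vectors are functions on nat, of which the first [n] values matter, so that one
    vector makes sense for all [n]. *)
Definition scaled_toeplitz (n : nat) (v : nat -> R) (k : nat) : R :=
  n%:R^-1 * \sum_(l < n) weight L rho n (dist k l) * v l.

Definition trunc_toeplitz (e : R) (n : nat) (v : nat -> R) (k : nat) : R :=
  n%:R^-1 * \sum_(l < n) trunc_ker rho e ((k%:R - l%:R) / n%:R) * v l.

(** The comparison on which everything about large [n] rests: the error is uniform
    over all vectors with a given bound. *)
Lemma scaled_toeplitz_trunc (eta : R) : 0 < eta -> exists2 e0 : R, 0 < e0 <= 1 & forall e, 0 < e <= e0 ->
  exists N : nat, forall n, (N <= n)%N -> forall k, (k < n)%N -> forall v B,
    (forall l, (l < n)%N -> `|v l| <= B) -> `|scaled_toeplitz n v k - trunc_toeplitz e n v k| <= B * eta.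
Proof.
move=> eta0; have [e0 e01 H] := weight_trunc_ker Lpos Lcvg Lmeas hrho eta0.
exists e0 => // e ee; have [N HN] := H e ee.
exists N => n nN k kn v B vB.
have B0 : 0 <= B by apply: (le_trans (normr_ge0 (v k))); exact: vB.
rewrite /scaled_toeplitz /trunc_toeplitz -mulrBr -sumrB normrM ger0_norm ?invr_ge0//.
apply: le_trans (ler_wpM2l B0 (HN n nN k kn)); rewrite mulrCA; apply: ler_wpM2l.
  by rewrite invr_ge0.
apply: (le_trans (ler_norm_sum _ _ _)); rewrite mulr_sumr; apply: ler_sum => l _.
by rewrite -mulrBl normrM mulrC; apply: ler_wpM2r => //; exact: vB.
Qed.

Lemma trunc_toeplitz_le (e : R) (n : nat) (v : nat -> R) (k : nat) : 0 < e ->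
  `|trunc_toeplitz e n v k| <= e `^ (- rho) * (n%:R^-1 * \sum_(l < n) `|v l|).
Proof.
move=> e0; rewrite /trunc_toeplitz normrM ger0_norm ?invr_ge0// mulrCA; apply: ler_wpM2l.
  by rewrite invr_ge0.
apply: (le_trans (ler_norm_sum _ _ _)); rewrite mulr_sumr; apply: ler_sum => l _.
by rewrite normrM; apply: ler_wpM2r => //; rewrite ger0_norm ?trunc_ker_ge0// trunc_ker_le.
Qed.

Lemma scaled_toeplitz_bounded : exists N : nat, exists2 C : R, 0 < C & forall n, (N <= n)%N ->
  forall k, (k < n)%N -> forall v B, (forall l, (l < n)%N -> `|v l| <= B) ->
  `|scaled_toeplitz n v k| <= C * B.
Proof.
have [e0 /andP[e00 _] H] := scaled_toeplitz_trunc ltr01.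
have [|N HN] := H e0; first by rewrite e00 lexx.
exists N, (1 + e0 `^ (- rho)); first by rewrite addr_gt0// powR_gt0.
move=> n nN k kn v B vB.
have n0 : 0 < n%:R :> R by rewrite ltr0n; exact: leq_ltn_trans kn.
have h1 := HN n nN k kn v B vB.
have h2 : `|trunc_toeplitz e0 n v k| <= e0 `^ (- rho) * B.
  apply: (le_trans (trunc_toeplitz_le _ _ _ e00)); apply: ler_wpM2l; first exact: powR_ge0.
  rewrite ler_pdivrMl//.
  apply: (le_trans (ler_sum _ (fun (l : 'I_n) _ => vB l (ltn_ord l)))).
  by rewrite sumr_const card_ord mulr_natl.
rewrite -[scaled_toeplitz n v k](subrK (trunc_toeplitz e0 n v k)) mulrDl mul1r -[B in X in _ <= X + _]mulr1.
by apply: (le_trans (ler_normD _ _)); exact: lerD.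
Qed.

End discrete_operator.

(** * Consistency, and compactness of the discrete eigenvectors *)
Section discrete_eigenvectors.
Context {R : realType}.
Notation mu := (@lebesgue_measure R).
Notation I := (`]0 : R, 1 : R[%classic).
Variable L : R -> R.
Hypothesis Lpos : forall x, 0 <= x -> 0 < L x.
Hypothesis Lcvg : forall a, 0 < a -> L (a * x) / L x @[x --> +oo] --> (1 : R).
Hypothesis Lmeas : lebesgue_measurable_fun `[0, +oo[ L.
Variable rho : R.
Hypothesis hrho : 0 < rho < 1.

Let rho01 : 0 < rho <= 1. Proof. by case/andP: hrho => -> /ltW ->. Qed.

(** The modulus of continuity of the truncated kernel does not depend on the base
    point (k+1)/n, so the Riemann sums converge uniformly in [k]. *)
Lemma trunc_toeplitz_riemann (e eta : R) (g : R -> R) : 0 < e -> 0 < eta -> continuous g ->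
  exists N : nat, forall n, (N <= n)%N -> forall k, (k < n)%N ->
    `|trunc_toeplitz rho e n (fun l => g (l.+1%:R / n%:R)) k -
      \int[mu]_(y in I) (trunc_ker rho e (k.+1%:R / n%:R - y) * g y)| <= eta.
Proof.
move=> e0 eta0 cg.
have [M M0 gM] := continuous_bounded01 (continuous_subspaceT cg).
pose E := e `^ (- rho).
have E0 : 0 < E by rewrite powR_gt0.
have q0 : 0 < eta / 2 / E by rewrite !divr_gt0.
have [d d0 gd] := heine_unit cg q0.
pose X := d^-1 + 2 * M * (E / e) / eta.
exists (Num.truncn X).+1 => n ne k kn.
have nX : X < n%:R by apply: lt_le_trans (truncnS_gt _) _; rewrite ler_nat.
have d10 : 0 < d^-1 by rewrite invr_gt0.
have c0 : 0 < 2 * M * (E / e) / eta by rewrite !(mulr_gt0, divr_gt0, invr_gt0).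
have nd : d^-1 < n%:R by rewrite /X in nX; lra.
have nc : 2 * M * (E / e) / eta < n%:R by rewrite /X in nX; lra.
have n0 : 0 < n%:R :> R by exact: lt_trans nd.
set x := k.+1%:R / n%:R.
pose F y := trunc_ker rho e (x - y) * g y.
have cF : continuous F.
  apply: continuous_mul => // y; apply/cvgrPdist_le => z z0.
  have lz : 0 < z / (E / e) by rewrite !divr_gt0.
  near=> y'; apply: (le_trans (trunc_ker_lipschitz _ _ rho01 e0)).
  rewrite -ler_pdivlMl ?divr_gt0// mulrC.
  have -> : x - y - (x - y') = - (y - y') by ring.
  by rewrite normrN; near: y'; apply: (@cvgr_dist_le R R^o).
have -> : trunc_toeplitz rho e n (fun l => g (l.+1%:R / n%:R)) k =
    n%:R^-1 * \sum_(l < n) F (l.+1%:R / n%:R).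
  congr (_ * _); apply: eq_bigr => l _; congr (trunc_ker _ _ _ * _).
  by rewrite /x -mulrBl -!natr1; congr (_ / _); ring.
apply: riemann_sum_le => //; first by rewrite -(ltr0n R).
move=> l y ln /andP[y1 y2]; rewrite /F.
have [z0 z1] := andP (node01 ln : 0 <= (l.+1%:R / n%:R : R) <= 1).
set z := l.+1%:R / n%:R in y2 z0 z1 *.
have zy : `|z - y| <= n%:R^-1.
  rewrite ger0_norm ?subr_ge0//.
  have : z = l%:R / n%:R + n%:R^-1 :> R by rewrite /z -natr1 mulrDl mul1r.
  lra.
have y0 : 0 <= y by apply: le_trans y1; rewrite divr_ge0.
have y01 : 0 <= y <= 1 by rewrite y0 (le_trans y2).
have nd' : n%:R^-1 < d by rewrite invf_plt ?posrE.
have h1 : `|g z - g y| <= eta / 2 / E.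
  by apply: gd; [rewrite z0|exact: le_trans zy (ltW nd')].
have h2 : `|trunc_ker rho e (x - z) - trunc_ker rho e (x - y)| <= E / e * n%:R^-1.
  apply: (le_trans (trunc_ker_lipschitz _ _ rho01 e0)); apply: ler_wpM2l.
    by rewrite divr_ge0 ?(ltW E0) ?(ltW e0).
  have -> : x - z - (x - y) = - (z - y) by ring.
  by rewrite normrN.
have -> : trunc_ker rho e (x - z) * g z - trunc_ker rho e (x - y) * g y =
   trunc_ker rho e (x - z) * (g z - g y) + (trunc_ker rho e (x - z) - trunc_ker rho e (x - y)) * g y by ring.
apply: (le_trans (ler_normD _ _)); rewrite [leRHS]splitr; apply: lerD; rewrite normrM.
  have : `|trunc_ker rho e (x - z)| <= E by rewrite ger0_norm ?trunc_ker_ge0// trunc_ker_le.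
  have -> : eta / 2 = E * (eta / 2 / E) by field; rewrite gt_eqF.
  by move=> ?; apply: ler_pM.
apply: (@le_trans _ _ (E / e * n%:R^-1 * M)); first by apply: ler_pM => //; exact: gM.
rewrite mulrAC ler_pdivrMr//; move: nc; rewrite ltr_pdivrMr// => nc.
move: nc; set w := E / e => nc; lra.
Unshelve. all: by end_near. Qed.

(** Both operators are replaced by their truncations, at a level [e] that is small
    enough for the two errors. *)
Lemma scaled_toeplitz_consistent (eta : R) (g : R -> R) : 0 < eta -> continuous g ->
  exists N : nat, forall n, (N <= n)%N -> forall k, (k < n)%N ->
    `|scaled_toeplitz L rho n (fun l => g (l.+1%:R / n%:R)) k - riesz_op rho g (k.+1%:R / n%:R)| <= eta.
Proof.
move=> eta0 cg.
have [M M0 gM] := continuous_bounded01 (continuous_subspaceT cg).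
have q0 : 0 < eta / 3 / M by rewrite !divr_gt0.
have [e1 /andP[e10 _] H1] := scaled_toeplitz_trunc Lpos Lcvg Lmeas hrho q0.
have [e2 /andP[e20 _] H2] := near_mass_small hrho q0.
pose e := Num.min e1 e2.
have e0 : 0 < e by rewrite lt_min e10.
have [|N1 HN1] := H1 e; first by rewrite e0 ge_min lexx.
have := H2 e; rewrite e0 ge_min lexx orbT => /(_ isT) HN2.
have [N3 HN3] := trunc_toeplitz_riemann e0 (divr_gt0 eta0 (ltr0n R 3)) cg.
exists (maxn N1 N3) => n; rewrite geq_max => /andP[n1 n3] k kn.
have gMI y : I y -> `|g y| <= M.
  by rewrite /= in_itv/= => /andP[/ltW y0 /ltW y1]; apply: gM; rewrite y0.
have mg : measurable_fun I g by exact: continuous_measurable_unit.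
have a1 := HN1 n n1 k kn (fun l => g (l.+1%:R / n%:R)) M (fun l ln => gM _ (node01 ln)).
have a2 := riesz_truncation hrho mg gMI (k.+1%:R / n%:R) e0.
have a3 := HN3 n n3 k kn.
have b1 : M * (eta / 3 / M) = eta / 3 by field; rewrite gt_eqF.
have b2 : M * near_mass rho e <= eta / 3 by rewrite -b1; apply: ler_wpM2l => //; exact: ltW.
rewrite b1 in a1; have {a2}a2 := le_trans a2 b2.
have -> : eta = eta / 3 + eta / 3 + eta / 3 by field.
exact: (ler_dist_chain a1 a2 a3).
Qed.

Lemma mean_norm_le1 (n : nat) (v : nat -> R) : (0 < n)%N ->
  n%:R^-1 * \sum_(l < n) v l ^+ 2 <= 1 -> n%:R^-1 * \sum_(l < n) `|v l| <= 1.
Proof.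
move=> n1; have n0 : 0 < n%:R :> R by rewrite ltr0n.
rewrite !ler_pdivrMl// mulr1 => h.
have : \sum_(l < n) `|v l| <= \sum_(l < n) (2^-1 + 2^-1 * v l ^+ 2).
  apply: ler_sum => l _; rewrite -[v l ^+ 2]real_normK ?num_real//.
  by have := sqr_ge0 (`|v l| - 1); set t := `|v l|; rewrite !expr2; lra.
rewrite big_split/= sumr_const card_ord -mulr_sumr -[_ *+ n]mulr_natl; lra.
Qed.

(** The normalization makes the mean square 1, as for samples of a function of
    L^2 norm 1. *)
Definition eigvec (n : nat) (nu : R) (v : nat -> R) :=
  (forall k, (k < n)%N -> scaled_toeplitz L rho n v k = nu * v k) /\
  n%:R^-1 * \sum_(l < n) v l ^+ 2 = 1.

(** If B is the largest entry, the equation and the truncation at an error of nu0 / 2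
    give nu0 B <= E + B nu0 / 2, where E = e^(-rho) bounds the truncated operator on
    vectors of mean square 1. *)
Lemma eigvec_bounded (nu0 : R) : 0 < nu0 -> exists N : nat, exists2 B : R, 0 < B &
  forall n, (N <= n)%N -> forall nu v, nu0 <= nu -> eigvec n nu v ->
  forall k, (k < n)%N -> `|v k| <= B.
Proof.
move=> nu00.
have q0 : 0 < nu0 / 2 by rewrite divr_gt0.
have [e0 /andP[e00 _] H] := scaled_toeplitz_trunc Lpos Lcvg Lmeas hrho q0.
have [|N HN] := H e0; first by rewrite e00 lexx.
pose E := e0 `^ (- rho).
have E0 : 0 < E by rewrite powR_gt0.
exists N, (2 * E / nu0); first by rewrite divr_gt0// mulr_gt0.
move=> n nN nu v nunu [ev v1] k kn.
pose B := \big[Num.max/0]_(l < n) `|v l|.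
have vB l : (l < n)%N -> `|v l| <= B by move=> ln; exact: (le_bigmax _ _ (Ordinal ln)).
have n1 : (0 < n)%N by exact: leq_ltn_trans kn.
have step l : (l < n)%N -> `|v l| <= (E + B * (nu0 / 2)) / nu0.
  move=> ln; rewrite ler_pdivlMr// mulrC.
  apply: (@le_trans _ _ `|scaled_toeplitz L rho n v l|).
    rewrite ev// normrM ler_wpM2r//; apply: le_trans nunu (ler_norm _).
  have h1 := HN n nN l ln v B vB.
  have h2 : `|trunc_toeplitz rho e0 n v l| <= E.
    apply: (le_trans (trunc_toeplitz_le hrho n v l e00)); rewrite -[leRHS]mulr1.
    by apply: ler_wpM2l; [exact: ltW|apply: mean_norm_le1 => //; rewrite v1].
  rewrite -[scaled_toeplitz L rho n v l](subrK (trunc_toeplitz rho e0 n v l)) addrC.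
  by apply: (le_trans (ler_normD _ _)); exact: lerD.
have B2 : B <= (E + B * (nu0 / 2)) / nu0.
  apply: bigmax_le => [|l _]; last exact: step.
  by apply: (le_trans (normr_ge0 (v k))); exact: step.
apply: (le_trans (vB k kn)); rewrite ler_pdivlMr//; move: B2; rewrite ler_pdivlMr//.
lra.
Qed.

(** An eigenvector is nu^-1 times its image, and the image is close to the image under
    the truncated operator, which has a Lipschitz kernel. *)
Lemma eigvec_equicontinuous (nu0 B eta : R) : 0 < nu0 -> 0 < B -> 0 < eta ->
  exists N : nat, exists2 d : R, 0 < d & forall n, (N <= n)%N ->
  forall nu v, nu0 <= nu -> eigvec n nu v -> (forall k, (k < n)%N -> `|v k| <= B) ->
  forall k k', (k < n)%N -> (k' < n)%N -> `|k%:R - k'%:R| <= d * n%:R ->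
    `|v k - v k'| <= eta.
Proof.
move=> nu00 B0 eta0.
have q0 : 0 < nu0 * eta / 4 / B by rewrite !divr_gt0// mulr_gt0.
have [e /andP[e0 _] H] := scaled_toeplitz_trunc Lpos Lcvg Lmeas hrho q0.
have [|N HN] := H e; first by rewrite e0 lexx.
pose w := e `^ (- rho) / e.
have w0 : 0 < w by rewrite divr_gt0// powR_gt0.
exists N, (nu0 * eta / 2 / B / w); first by rewrite !(divr_gt0, mulr_gt0, powR_gt0).
move=> n nN nu v nunu [ev v1] vB k k' kn k'n kk'.
have n0 : 0 < n%:R :> R by rewrite ltr0n; exact: leq_ltn_trans kn.
have a1 := HN n nN k kn v B vB.
have a2 := HN n nN k' k'n v B vB.
have b1 : B * (nu0 * eta / 4 / B) = nu0 * eta / 4 by field; rewrite gt_eqF.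
rewrite b1 in a1 a2.
have a3 : `|trunc_toeplitz rho e n v k - trunc_toeplitz rho e n v k'| <= nu0 * eta / 2.
  rewrite /trunc_toeplitz -mulrBr -sumrB normrM ger0_norm ?invr_ge0 ?(ltW n0)// ler_pdivrMl//.
  apply: (le_trans (ler_norm_sum _ _ _)).
  have -> : n%:R * (nu0 * eta / 2) = \sum_(l < n) (nu0 * eta / 2) by rewrite sumr_const card_ord mulr_natl.
  apply: ler_sum => l _; rewrite -mulrBl normrM.
  have h : `|trunc_ker rho e ((k%:R - l%:R) / n%:R) - trunc_ker rho e ((k'%:R - l%:R) / n%:R)| <= nu0 * eta / 2 / B.
    apply: (le_trans (trunc_ker_lipschitz _ _ rho01 e0)); rewrite -/w.
    rewrite -mulrBl [X in X / _](_ : _ = k%:R - k'%:R); last by ring.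
    rewrite normrM normfV (gtr0_norm n0) mulrC -ler_pdivlMr// ler_pdivrMr//.
  apply: (@le_trans _ _ (nu0 * eta / 2 / B * B)); last by rewrite divfK ?gt_eqF.
  by apply: ler_pM => //; exact: vB.
have := ler_dist_chain a1 a2 a3; rewrite !ev// -mulrBr normrM.
have -> : nu0 * eta / 4 + nu0 * eta / 4 + nu0 * eta / 2 = nu0 * eta by field.
move=> h; rewrite -(ler_pM2l nu00); apply: le_trans h; apply: ler_wpM2r => //.
exact: le_trans nunu (ler_norm _).
Qed.

End discrete_eigenvectors.

(** * Real symmetric matrices *)
Section spectral.
Context {R : realType}.

Lemma char_poly_involution n (H A : 'M[R]_n) : H *m H = 1%:M ->
  char_poly (H *m A *m H) = char_poly A.
Proof.
move=> HH; pose G := map_mx (polyC : R -> {poly R}) H.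
have GG : G *m G = 1%:M by rewrite -map_mxM HH map_mx1.
have -> : char_poly (H *m A *m H) = \det (G *m char_poly_mx A *m G).
  rewrite /char_poly /char_poly_mx; congr (\det _).
  rewrite mulmxBr mulmxBl !map_mxM/= -/G; congr (_ - _).
  by rewrite mul_mx_scalar -scalemxAl GG scalemx1.
rewrite !det_mulmx mulrAC -det_mulmx GG det1 mul1r//.
Qed.

(** The reflection in the hyperplane orthogonal to e - u, where e is the first basis
    vector; it exchanges e and u because they have the same norm.  If e = u the identity
    does. *)
Lemma householder n (u : 'cV[R]_(1 + n)) : u^T *m u = 1%:M ->
  exists H : 'M[R]_(1 + n), [/\ H^T = H, H *m H = 1%:M &
    H *m (delta_mx 0 0 : 'cV_(1 + n)) = u].
Proof.
move=> u1; set e : 'cV[R]_(1 + n) := delta_mx 0 0.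
have e1 : e^T *m e = 1%:M.
  by rewrite /e trmx_delta mul_delta_mx; apply/matrixP => i j; rewrite !ord1 !mxE eqxx.
have [w wE] : exists w, w = e - u by exists (e - u).
have ue : u^T *m e = (u 0 0)%:M.
  apply/matrixP => i j; rewrite !ord1 !mxE (bigD1 0)//= !mxE eqxx mulr1 big1 ?addr0 ?eqxx ?mulr1n//.
  by move=> k /negbTE k0; rewrite !mxE k0 mulr0.
have eu : e^T *m u = (u 0 0)%:M.
  by rewrite -[LHS]trmxK trmx_mul trmxK ue tr_scalar_mx.
have wT : w^T = e^T - u^T by rewrite wE linearB.
have ww : w^T *m w = (2 * (1 - u 0 0))%:M.
  rewrite wT wE mulmxBl !mulmxBr e1 u1 ue eu -!raddfB/=; congr (_ %:M); ring.
have we : w^T *m e = (1 - u 0 0)%:M.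
  by rewrite wT mulmxBl e1 ue -raddfB.
have [w0|w0] := eqVneq w 0.
  exists 1%:M; split; rewrite ?trmx1 ?mul1mx//.
  by apply/eqP; rewrite -subr_eq0 -wE w0.
have c0 : 1 - u 0 0 != 0.
  apply: contra_neq w0 => c0; rewrite c0 mulr0 in ww.
  apply/matrixP => i j; rewrite !ord1 [RHS]mxE; apply/eqP; rewrite -sqrf_eq0; apply/eqP.
  have s0 : \sum_k w k 0 ^+ 2 = 0.
    transitivity ((w^T *m w) 0 0); last by rewrite ww !mxE.
    by rewrite !mxE; apply: eq_bigr => k _; rewrite mxE expr2.
  by apply: (psumr_eq0P _ s0) => // l _; exact: sqr_ge0.
pose c := (1 - u 0 0)^-1.
exists (1%:M - c *: (w *m w^T)); split.
- by rewrite linearB/= linearZ/= trmx_mul trmxK trmx1.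
- set S := w *m w^T.
  have SS : S *m S = (2 * (1 - u 0 0)) *: S.
    by rewrite /S mulmxA -(mulmxA w) ww mul_mx_scalar -scalemxAl.
  rewrite mulmxBl mul1mx mulmxBr mulmx1 -scalemxAl -scalemxAr SS !scalerA.
  have -> : c * c * (2 * (1 - u 0 0)) = c + c by rewrite /c; field.
  rewrite scalerDl; set a := c *: S.
  have -> : a - (a + a) = - a by rewrite opprD addrA subrr add0r.
  by rewrite opprK subrK.
- rewrite mulmxBl mul1mx -scalemxAl -mulmxA we mul_mx_scalar scalerA.
  by rewrite /c mulVf// scale1r wE subKr.
Qed.

(** The eigenvalues come as a list, since it is their order in a given list of roots
    of the characteristic polynomial that matters. *)
Definition orthonormal_diag n (A P : 'M[R]_n) (s : seq R) :=
  P^T *m P = 1%:M /\ A *m P = P *m diag_mx (\row_i s`_i).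

Lemma normalize_row n (v : 'rV[R]_n) : v != 0 ->
  exists d, (d *: v^T)^T *m (d *: v^T) = 1%:M.
Proof.
move=> v0; pose c := \sum_k v 0 k ^+ 2.
have c0 : 0 < c.
  have [k vk] : exists k, v 0 k != 0 by have /rV0Pn := v0.
  rewrite /c (bigD1 k)//= ltr_wpDr//; first by apply: sumr_ge0 => l _; rewrite sqr_ge0.
  by rewrite lt0r sqrf_eq0 vk sqr_ge0.
pose d := (Num.sqrt c)^-1; exists d.
have -> : (d *: v^T)^T = d *: v by rewrite linearZ/= trmxK.
rewrite -scalemxAl -scalemxAr scalerA.
apply/matrixP => i j; rewrite !ord1 !mxE.
rewrite (eq_bigr (fun k => v 0 k ^+ 2)); last by move=> k _; rewrite mxE expr2.
by rewrite -/c /d -invfM -expr2 sqr_sqrtr ?(ltW c0)// mulVf ?(gt_eqF c0).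
Qed.

Lemma unit_eigenvector n (A : 'M[R]_n) (x : R) : A^T = A -> root (char_poly A) x ->
  exists2 u : 'cV[R]_n, A *m u = x *: u & u^T *m u = 1%:M.
Proof.
move=> sA; rewrite -eigenvalue_root_char => /eigenvalueP[v vA v0].
have [d dd] := normalize_row v0.
have Av : A *m v^T = x *: v^T by rewrite -{1}sA -trmx_mul vA linearZ.
by exists (d *: v^T) => //; rewrite -scalemxAr Av !scalerA mulrC.
Qed.

(** Deflation: conjugating by a reflection that sends the first basis vector to [u]
    splits off the block [x], and the remaining block is symmetric with
    characteristic polynomial given by [s].  The eigenvector [u] of the first
    eigenvalue is prescribed, whatever the multiplicity. *)
Lemma spectral_split n (A : 'M[R]_n) (s : seq R) (x : R) (u : 'cV[R]_n) : A^T = A ->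
  char_poly A = \prod_(y <- x :: s) ('X - y%:P) ->
  A *m u = x *: u -> u^T *m u = 1%:M ->
  exists P : 'M[R]_n, orthonormal_diag A P (x :: s) /\
    forall i : 'I_n, i = 0%N :> nat -> col i P = u.
Proof.
elim: n A s x u => [|n IH] A s x u sA charA Au uu.
  exists 0; split; last by case.
  by split; apply/matrixP; case.
have [H [sH HH He]] := householder (uu : u^T *m (u : 'cV_(1 + n)) = 1%:M).
set e : 'cV[R]_(1 + n) := delta_mx 0 0 in He.
have Hu : H *m u = e by rewrite -He mulmxA HH mul1mx.
have [A' A'def] : exists A' : 'M[R]_(1 + n), A' = H *m A *m H by exists (H *m A *m H).
have sA' : A'^T = A' by rewrite A'def !trmx_mul sH sA mulmxA.
have A'e : A' *m e = x *: e.
  by rewrite A'def -!mulmxA He Au -scalemxAr Hu.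
have [B Bdef] : exists B, B = drsubmx A' by exists (drsubmx A').
have A'E : A' = block_mx x%:M 0 0 B.
  have colE i : A' i 0 = x * e i 0.
    have := congr1 (fun M : 'M[R]_(1 + n, 1) => M i 0) A'e; rewrite !mxE => <-.
    rewrite (bigD1 0)//= !mxE eqxx mulr1 big1 ?addr0// => k /negbTE k0.
    by rewrite !mxE k0 mulr0.
  have l0 : lshift n (0 : 'I_1) = 0 :> 'I_(1 + n) by exact: val_inj.
  have dl : dlsubmx A' = 0.
    apply/matrixP => i j; rewrite !mxE ord1 l0 colE !mxE.
    by rewrite -val_eqE/= mulr0.
  rewrite -[LHS]submxK; congr block_mx => //.
    by apply/matrixP => i j; rewrite !mxE !ord1 l0 colE !mxE !eqxx mulr1.
  by rewrite -[ursubmx _]trmxK trmx_ursub sA' dl trmx0.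
have sB : B^T = B by rewrite Bdef trmx_drsub sA'.
have charB : char_poly B = \prod_(y <- s) ('X - y%:P).
  have : char_poly A' = char_poly A by rewrite A'def; exact: char_poly_involution.
  rewrite A'E charA big_cons /char_poly char_block_diag_mx det_ublock.
  rewrite {1}/char_poly_mx det_mx11 !mxE eqxx mulr1n => /mulfI; apply.
  by rewrite polyXsubC_eq0.
have [Q [QQ BQ]] : exists Q : 'M[R]_n, orthonormal_diag B Q s.
  case: s charB {charA} => [|y s] charB.
    have n0 : n = 0%N by have := size_char_poly B; rewrite charB big_nil size_poly1 => -[].
    exists 0; move: (B); rewrite n0 => B0.
    by split; apply/matrixP; case.
  have [|v Bv vv] := @unit_eigenvector _ B y sB.
    by rewrite charB big_cons rootM root_XsubC eqxx.
  by have [Q [QB _]] := IH B s y v sB charB Bv vv; exists Q.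
pose C : 'M[R]_(1 + n) := block_mx 1%:M 0 0 Q.
have CC : C^T *m C = 1%:M.
  rewrite /C tr_block_mx mulmx_block !trmx0 !mul0mx !mulmx0 !addr0 !add0r trmx1 mul1mx QQ.
  by rewrite -scalar_mx_block.
have rowE : \row_(i < 1 + n) (x :: s)`_i = row_mx x%:M (\row_i s`_i).
  apply/matrixP => i k; rewrite ord1 !mxE; case: split_ordP => l ->; rewrite !mxE.
    by rewrite ord1.
  by [].
have AC : A' *m C = C *m diag_mx (\row_(i < 1 + n) (x :: s)`_i).
  rewrite rowE diag_mx_row A'E /C !mulmx_block !mul0mx !mulmx0 !addr0 !add0r BQ mulmx1 mul1mx.
  by congr block_mx; apply/matrixP => i k; rewrite !ord1 !mxE.
exists (H *m C); split.
  split; first by rewrite trmx_mul sH mulmxA -(mulmxA C^T H H) HH mulmx1.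
  by rewrite -mulmxA -AC A'def !mulmxA HH mul1mx.
have eE : e = col_mx 1%:M 0.
  by apply/matrixP => i k; rewrite ord1 !mxE; case: split_ordP => l ->; rewrite !mxE ?ord1 ?andbT.
have Ce : C *m e = e.
  by rewrite {1}eE /C mul_block_col !mul0mx mulmx0 mul1mx !addr0 -eE.
move=> i i0; have -> : i = 0 by exact: val_inj.
by rewrite colE -mulmxA -/e Ce.
Qed.

(** Some nonzero combination of the i + 1 columns of [V] is orthogonal to the first i
    eigenvectors, since these are i linear conditions. *)
Lemma courant_fischer n (A P : 'M[R]_n) (s : seq R) (i : nat) (V : 'M[R]_(n, i.+1)) :
  orthonormal_diag A P s -> (i < n)%N -> (forall k, (i <= k < n)%N -> s`_k <= s`_i) ->
  exists t : 'cV[R]_(i.+1), t^T *m t = 1%:M /\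
    ((V *m t)^T *m A *m (V *m t)) 0 0 <= s`_i * ((V *m t)^T *m (V *m t)) 0 0.
Proof.
move=> [PP AP] ilt smax.
have PP' : P *m P^T = 1%:M by exact: mulmx1C.
pose M : 'M[R]_(i.+1, i) := \matrix_(m, a) (P^T *m V) (widen_ord (ltnW ilt) a) m.
have [v v0 vM] : exists2 v : 'rV[R]_(i.+1), v != 0 & v *m M = 0.
  have : kermx M != 0.
    rewrite -mxrank_eq0 mxrank_ker -lt0n subn_gt0.
    by apply: leq_ltn_trans (rank_leq_col M) _.
  move=> /rowV0Pn[v /sub_kermxP vM v0]; by exists v.
have [d dd] := normalize_row v0; exists (d *: v^T); split=> //.
set x := V *m (d *: v^T).
have [y yE] : exists y, y = P^T *m x by exists (P^T *m x).
have xE : x = P *m y by rewrite yE mulmxA PP' mul1mx.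
have y0 (a : 'I_n) : (a < i)%N -> y a 0 = 0.
  move=> ai; rewrite yE /x mulmxA -scalemxAr mxE.
  have := congr1 (fun M : 'M[R]_(1, i) => M 0 (Ordinal ai)) vM.
  rewrite !mxE => h; apply/eqP; rewrite mulf_eq0; apply/orP; right; apply/eqP.
  rewrite -[RHS]h; apply: eq_bigr => k _; rewrite [RHS]mulrC; congr (_ * _); last by rewrite mxE.
  rewrite [RHS]mxE; congr ((P^T *m V) _ k); exact: val_inj.
have xx : x^T *m x = y^T *m y.
  by rewrite xE trmx_mul mulmxA -(mulmxA y^T) PP mulmx1.
have xAx : x^T *m A *m x = y^T *m diag_mx (\row_k s`_k) *m y.
  by rewrite xE trmx_mul -!mulmxA (mulmxA A) AP -(mulmxA P) (mulmxA P^T) PP mul1mx.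
rewrite xx xAx mul_mx_diag !mxE mulr_sumr; apply: ler_sum => a _.
rewrite !mxE; have [ai|ia] := ltnP a i; first by rewrite y0// !mulr0.
rewrite mulrAC -expr2 [leRHS]mulrC; apply: ler_wpM2l; first exact: sqr_ge0.
by apply: smax; rewrite ia ltn_ord.
Qed.

End spectral.

(** * Eigenvalues and eigenvectors of the Toeplitz matrices *)
Section eigensystem.
Context {R : realType}.

Definition ord_ext n (f : 'I_n -> R) (k : nat) : R := oapp f 0 (insub k).

Lemma ord_extE n (f : 'I_n -> R) (k : 'I_n) : ord_ext f k = f k.
Proof. by rewrite /ord_ext valK. Qed.

(** [spectral_split] puts the prescribed eigenvector in first position, while the
    eigenvalues are needed in decreasing order: this is the cycle that puts the
    entry of index [q] back in its place. *)
Definition to_front q i := if i == q then 0%N else if (i < q)%N then i.+1 else i.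

Lemma to_front_inj q : injective (to_front q).
Proof.
move=> i k; rewrite /to_front.
case: (i =P q) => [->|iq]; case: (k =P q) => [->//|kq];
  case: (ltnP i q) => ?; case: (ltnP k q) => ?; lia.
Qed.

Lemma to_front_lt q i n : (q < n)%N -> (i < n)%N -> (to_front q i < n)%N.
Proof. by move=> qn iN; rewrite /to_front; case: (i =P q); case: (ltnP i q); lia. Qed.

Lemma eigenbasis n j (A : 'M[R]_n) (lamj : R) (u : 'cV[R]_n) : A^T = A ->
  mx_lambda A j lamj -> mx_normalized_eigenvector A lamj u ->
  exists (s : seq R) (P : 'M[R]_n), [/\ orthonormal_diag A P s,
    forall i k, (i <= k < n)%N -> s`_k <= s`_i, (0 < j <= n)%N, s`_j.-1 = lamj &
    forall i : 'I_n, i = j.-1 :> nat -> col i P = u].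
Proof.
move=> sA [s [ss charA js lamE]] [Au uu].
have sz : size s = n.
  by have := size_char_poly A; rewrite charA size_prod_XsubC => -[].
have /andP[j0 jn] := js.
pose q := j.-1.
have qs : (q < size s)%N by rewrite prednK.
pose rest := take q s ++ drop q.+1 s.
have pe : perm_eq s (lamj :: rest).
  rewrite -{1}(cat_take_drop q s) (drop_nth 0 qs) -lamE.
  by rewrite /rest -cat1s perm_catCA.
have charA' : char_poly A = \prod_(y <- lamj :: rest) ('X - y%:P).
  by rewrite charA; apply: perm_big.
have uu' : u^T *m u = 1%:M.
  apply/matrixP => a b; rewrite !ord1 !mxE eqxx -uu; apply: eq_bigr => k _.
  by rewrite mxE expr2.
have [P [[PP AP] Pu]] := spectral_split sA charA' Au uu'.
pose sg (i : 'I_n) : 'I_n :=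
  Ordinal (to_front_lt (leq_trans qs (eq_leq sz)) (ltn_ord i)).
have sginj : injective sg.
  by move=> i k /(congr1 val)/= E; apply: val_inj; exact: to_front_inj E.
have nthE i : (i < n)%N -> (lamj :: rest)`_(to_front q i) = s`_i.
  move=> iN; rewrite /to_front; case: eqP => [->//|iq]; case: ltnP => [iq'|qi] /=.
    by rewrite /rest nth_cat size_takel ?(ltnW qs)// iq' nth_take.
  have qi' : (q < i)%N by rewrite ltn_neqAle qi andbT; apply/eqP => E; apply: iq.
  case: i {iN iq qi} qi' => // i; rewrite ltnS => qi.
  by rewrite /= /rest nth_cat size_takel ?(ltnW qs)// ltnNge qi /= nth_drop addSn subnKC.
pose P0 : 'M[R]_n := \matrix_(k, i) P k (sg i).
exists s, P0; split=> //.
- split.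
    apply/matrixP => i k; transitivity ((P^T *m P) (sg i) (sg k)).
      by rewrite !mxE; apply: eq_bigr => l _; rewrite !mxE.
    by rewrite PP !mxE (inj_eq sginj).
  apply/matrixP => k i; transitivity ((A *m P) k (sg i)).
    by rewrite !mxE; apply: eq_bigr => l _; rewrite !mxE.
  by rewrite AP !mul_mx_diag !mxE nthE.
- move=> i k /andP[ik kn].
  have := sorted_leq_nth (rev_trans le_trans) (lexx : reflexive (>=%R : rel R)) 0 ss.
  by apply=> //; rewrite inE sz//; exact: leq_ltn_trans kn.
- by rewrite j0 -sz.
- move=> i iq; rewrite -(Pu (sg i)); last by rewrite /= /to_front iq eqxx.
  by apply/matrixP => a b; rewrite !mxE.
Qed.

End eigensystem.

Section toeplitz.
Context {R : realType}.
Variable L : R -> R.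
Hypothesis Lpos : forall x, 0 <= x -> 0 < L x.
Variable rho : R.
Hypothesis hrho : 0 < rho < 1.

Lemma toeplitz_sym n : (toeplitz (autocov rho L) n)^T = toeplitz (autocov rho L) n.
Proof.
apply/matrixP => i k; rewrite !mxE /autocov.
by rewrite distnC.
Qed.

Definition toeplitz_scale (n : nat) : R := n%:R `^ (1 - rho) * L n%:R.

Lemma toeplitz_scale_gt0 n : (0 < n)%N -> 0 < toeplitz_scale n.
Proof. by move=> n0; rewrite mulr_gt0 ?powR_gt0 ?ltr0n ?Lpos. Qed.

Lemma toeplitz_scaled n (v : nat -> R) (k : 'I_n) :
  \sum_(l < n) toeplitz (autocov rho L) n k l * v l = toeplitz_scale n * scaled_toeplitz L rho n v k.
Proof.
have n0 : 0 < n%:R :> R by rewrite ltr0n; exact: leq_ltn_trans (ltn_ord k).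
have Ln : 0 < L n%:R by exact: Lpos.
rewrite /scaled_toeplitz mulrA mulr_sumr; apply: eq_bigr => l _; rewrite mxE mulrA; congr (_ * _).
rewrite /weight /autocov -/(dist k l) /toeplitz_scale powRB ?(gt_eqF n0) ?implybT// powRr1 ?(ltW n0)//.
have P0 : 0 < n%:R `^ rho by rewrite powR_gt0.
by field; rewrite !gt_eqF// powR_gt0// ltr_wpDr.
Qed.

(** What is retained of the matrix: the eigenvalues in decreasing order, the
    eigenvectors, orthonormal for the mean, and the lower half of the
    Courant-Fischer principle for arbitrary test vectors [V]. *)
Definition eigensystem n (nu : nat -> R) (v : nat -> nat -> R) :=
  [/\ forall i k, (i <= k < n)%N -> nu k <= nu i,
      forall i, (i < n)%N -> forall k, (k < n)%N -> scaled_toeplitz L rho n (v i) k = nu i * v i k,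
      forall i k, (i < n)%N -> (k < n)%N ->
        n%:R^-1 * \sum_(l < n) v i l * v k l = (i == k)%:R &
      forall i, (i < n)%N -> forall V : nat -> nat -> R, exists t : nat -> R,
        \sum_(m < i.+1) t m ^+ 2 = 1 /\
        let x k := \sum_(m < i.+1) t m * V m k in
        n%:R^-1 * (\sum_(k < n) x k * scaled_toeplitz L rho n x k) <=
        nu i * (n%:R^-1 * \sum_(k < n) x k ^+ 2)].

(** The j-th vector of the basis can be taken to be the given one, up to the factor
    sqrt n that turns norm 1 into mean square 1. *)
Lemma toeplitz_eigensystem n j (lamj : R) (u : 'cV[R]_n) :
  mx_lambda (toeplitz (autocov rho L) n) j lamj ->
  mx_normalized_eigenvector (toeplitz (autocov rho L) n) lamj u ->
  exists (nu : nat -> R) (v : nat -> nat -> R), eigensystem n nu v /\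
    forall k : 'I_n, v j.-1 k = Num.sqrt n%:R * u k 0.
Proof.
move=> hl hu; have [s [P [[PP AP] smono /andP[j0 jn] _ Pu]]] := eigenbasis (toeplitz_sym n) hl hu.
set A := toeplitz (autocov rho L) n in AP hl hu.
have n1 : (0 < n)%N by exact: leq_trans jn.
have n0 : 0 < n%:R :> R by rewrite ltr0n.
have c0 := toeplitz_scale_gt0 n1; set c := toeplitz_scale n in c0.
have qn : Num.sqrt n%:R * Num.sqrt n%:R = n%:R :> R by rewrite -expr2 sqr_sqrtr// ltW.
pose v i k := Num.sqrt n%:R * ord_ext (fun i' => ord_ext (fun k' => P k' i') k) i.
have vE (i k : 'I_n) : v i k = Num.sqrt n%:R * P k i by rewrite /v !ord_extE.
exists (fun i => s`_i / c), v; split; last first.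
  move=> k; have jlt : (j.-1 < n)%N by rewrite prednK.
  by rewrite (vE (Ordinal jlt) k) -(Pu (Ordinal jlt) erefl) mxE.
split.
- move=> i k ikn; apply: ler_wpM2r; first by rewrite invr_ge0 ltW.
  exact: smono.
- move=> i ilt k klt; pose i' := Ordinal ilt; pose k' := Ordinal klt.
  apply: (mulfI (lt0r_neq0 c0)); rewrite -(toeplitz_scaled (v i) k').
  have := congr1 (fun M : 'M[R]_(n, n) => M k' i') AP; rewrite mul_mx_diag !mxE => E.
  rewrite (eq_bigr (fun l => Num.sqrt n%:R * (A k' l * P l i'))); last first.
    by move=> l _; rewrite (vE i' l) mulrCA.
  rewrite -mulr_sumr E (vE i' k').
  by field; rewrite gt_eqF.
- move=> i k ilt klt; pose i' := Ordinal ilt; pose k' := Ordinal klt.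
  have := congr1 (fun M : 'M[R]_(n, n) => M i' k') PP; rewrite !mxE => E.
  rewrite (eq_bigr (fun l => n%:R * ((P^T) i' l * P l k'))); last first.
    by move=> l _; rewrite (vE i' l) (vE k' l) mxE mulrACA qn.
  by rewrite -mulr_sumr mulKf ?(gt_eqF n0)// E.
- move=> i ilt V; pose W : 'M[R]_(n, i.+1) := \matrix_(k, m) V m k.
  have smax k : (i <= k < n)%N -> s`_k <= s`_i by exact: smono.
  have [t [tt H]] := courant_fischer W (conj PP AP) ilt smax.
  exists (ord_ext (fun m => t m 0)); split.
    have := congr1 (fun M : 'M[R]_(1, 1) => M 0 0) tt; rewrite !mxE eqxx => E1.
    rewrite -[RHS]E1.
    by apply: eq_bigr => m _; rewrite ord_extE [t^T _ _]mxE expr2.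
  set x := fun k => _; rewrite /=.
  have xE (k : 'I_n) : x k = (W *m t) k 0.
    by rewrite /x mxE; apply: eq_bigr => m _; rewrite ord_extE mxE mulrC.
  rewrite -(ler_pM2l c0).
  have -> : c * (n%:R^-1 * \sum_(k < n) x k * scaled_toeplitz L rho n x k) =
      n%:R^-1 * ((W *m t)^T *m A *m (W *m t)) 0 0.
    rewrite mulrCA; congr (_ * _); rewrite -mulmxA mxE mulr_sumr; apply: eq_bigr => k _.
    rewrite mulrCA -(toeplitz_scaled x k) mxE -xE mxE; congr (_ * _).
    by apply: eq_bigr => l _; rewrite -xE.
  have -> : c * (s`_i / c * (n%:R^-1 * \sum_(k < n) x k ^+ 2)) =
      n%:R^-1 * (s`_i * ((W *m t)^T *m (W *m t)) 0 0).
    have -> : ((W *m t)^T *m (W *m t)) 0 0 = \sum_(k < n) x k ^+ 2.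
      by rewrite mxE; apply: eq_bigr => k _; rewrite mxE -xE expr2.
    by field; rewrite !gt_eqF.
  by apply: ler_wpM2l => //; rewrite invr_ge0 ltW.
Qed.

End toeplitz.

(** * Limits along ultrafilters *)
Section ultralimit.
Context {R : realType}.

Lemma ultra_fmap (T U : Type) (F : set_system T) (h : T -> U) :
  UltraFilter F -> UltraFilter (h @ F).
Proof.
move=> UF; have PF := ultra_proper (F := F); split; first exact: fmap_proper_filter.
move=> F' PF' FF'; apply/seteqP; split => // A F'A.
have [//|FA] := in_ultra_setVsetC (h @^-1` A) UF.
have F'C : F' (~` A) by apply: FF'.
exfalso; apply: (@filter_not_empty _ _ PF'); rewrite -(setICr A).
exact: (@filterI _ _ _ A _ F'A F'C).
Qed.

Variable G : set_system nat.
Hypothesis UG : UltraFilter G.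
Let PG : ProperFilter G. Proof. exact: ultra_proper. Qed.
#[local] Existing Instance PG.

(** Ultrafilters spare the extraction of subsequences: one ultrafilter serves all
    bounded sequences at once. *)
Lemma ultra_limit (u : nat -> R) (B : R) : (\forall n \near G, `|u n| <= B) ->
  exists l : R, forall eps : R, 0 < eps -> \forall n \near G, `|l - u n| <= eps.
Proof.
move=> uB; have K : compact `[- B, B : R] by exact: segment_compact.
move: K; rewrite compact_ultra => /(_ _ (ultra_fmap u UG)) [].
  by apply: filterS uB => n; rewrite /= in_itv/= ler_norml.
move=> l [_ ul]; exists l => eps eps0.
apply: (@filterS _ G _ (u @^-1` ball l eps)) => [n /ltW//|].
exact: (ul _ (nbhsx_ballx l eps eps0)).
Qed.

Lemma ultra_forall_lt (P : nat -> nat -> Prop) (M : nat) :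
  (forall p, (p < M)%N -> \forall n \near G, P n p) ->
  \forall n \near G, forall p, (p < M)%N -> P n p.
Proof.
elim: M => [|M IH] H; first by apply: filterE.
have h1 : \forall n \near G, forall p, (p < M)%N -> P n p by apply: IH => p pM; apply: H; exact: ltnW.
apply: filterS2 h1 (H M (ltnSn M)) => n hn hM p.
by rewrite ltnS leq_eqVlt => /orP[/eqP->//|]; exact: hn.
Qed.

Hypothesis Goo : forall N : nat, G [set n | (N <= n)%N].

Lemma ultra_archimedean (X : R) : \forall n \near G, X < n%:R.
Proof.
apply: filterS (Goo (Num.truncn X).+1) => n /= nX.
by apply: lt_le_trans (truncnS_gt _) _; rewrite ler_nat.
Qed.

(** A left inverse of k |-> (k+1)/n, total in [x]; this is why the integer part is
    lowered by one. *)
Definition node_index (n : nat) (x : R) : nat := minn n.-1 (Num.truncn (n%:R * x)).-1.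

Lemma node_index_lt n x : (0 < n)%N -> (node_index n x < n)%N.
Proof. by move=> n0; rewrite (leq_ltn_trans (geq_minl _ _))// prednK. Qed.

Lemma node_indexK n k : (k < n)%N -> node_index n (k.+1%:R / n%:R) = k.
Proof.
move=> kn; have n0 : 0 < n%:R :> R by rewrite ltr0n; exact: leq_ltn_trans kn.
rewrite /node_index mulrC divfK ?gt_eqF// natrK /=; apply/minn_idPr; lia.
Qed.

Lemma node_index_dist n (x y : R) :
  `|(node_index n x)%:R - (node_index n y)%:R| <= n%:R * `|x - y| + 1 :> R.
Proof.
wlog xy : x y / x <= y.
  move=> H; case/orP: (le_total x y) => xy; first exact: H.
  by rewrite distrC [`|x - y|]distrC; exact: H.
rewrite distrC [`|x - y|]distrC (ger0_norm (x := y - x)) ?subr_ge0// mulrBr.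
have nxy : n%:R * x <= n%:R * y by apply: ler_wpM2l.
rewrite /node_index; move: (n%:R * x) (n%:R * y) nxy => a b ab.
have tab : (Num.truncn a <= Num.truncn b)%N by exact: le_truncn.
have h : (Num.truncn b)%:R <= (Num.truncn a)%:R + (b - a) + 1.
  have := truncnS_gt a; rewrite -natr1 => ha.
  case: (leP 0 b) => b0; last first.
    have -> : Num.truncn b = 0%N by apply/truncn0Pn; rewrite -ltNge (lt_trans b0).
    by have : 0 <= (Num.truncn a)%:R :> R by []; lra.
  by have := truncn_le b; rewrite b0; lra.
set i := Num.truncn a in tab h *; set k := Num.truncn b in tab h *.
rewrite -natrB; last by lia.
apply: le_trans (_ : (k - i)%:R <= _); first by rewrite ger0_norm// ler_nat; lia.
by rewrite natrB//; lra.
Qed.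

(** The limit is taken pointwise, and inherits the modulus of continuity; on a finite
    grid the pointwise convergence is uniform, and the equicontinuity extends this
    to all nodes. *)
Lemma ultra_ascoli (v : nat -> nat -> R) (B : R) :
  (\forall n \near G, forall k, (k < n)%N -> `|v n k| <= B) ->
  (forall eta : R, 0 < eta -> exists2 d : R, 0 < d & \forall n \near G,
    forall k k', (k < n)%N -> (k' < n)%N -> `|k%:R - k'%:R| <= d * n%:R ->
    `|v n k - v n k'| <= eta) ->
  exists2 g : R -> R, continuous g & forall eps : R, 0 < eps ->
    \forall n \near G, forall k, (k < n)%N -> `|v n k - g (k.+1%:R / n%:R)| <= eps.
Proof.
move=> vB vequi.
have /choice[g gv] : forall x : R, exists l : R, forall eps : R, 0 < eps ->
    \forall n \near G, `|l - v n (node_index n x)| <= eps.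
  move=> x; apply: (@ultra_limit _ B); apply: filterS2 vB (Goo 1) => n vn n0.
  by apply: vn; exact: node_index_lt.
have equi eta : 0 < eta -> exists2 d : R, 0 < d & \forall n \near G,
    forall x y, `|x - y| <= d -> `|v n (node_index n x) - v n (node_index n y)| <= eta.
  move=> eta0; have [d d0 H] := vequi eta eta0.
  exists (d / 2); first by rewrite divr_gt0.
  apply: filterS3 H (Goo 1) (ultra_archimedean (2 / d)) => n Hn n0 nd x y xy.
  have n0' : 0 < n%:R :> R by rewrite ltr0n.
  apply: Hn; [exact: node_index_lt|exact: node_index_lt|].
  apply: (le_trans (node_index_dist _ _ _)).
  have h1 : 2 < n%:R * d by rewrite -ltr_pdivrMr.
  have h2 : n%:R * `|x - y| <= n%:R * (d / 2) by rewrite ler_pM2l.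
  lra.
have gequi eta : 0 < eta -> exists2 d : R, 0 < d & forall x y, `|x - y| <= d -> `|g x - g y| <= eta.
  move=> eta0; have e3 : 0 < eta / 3 by rewrite divr_gt0.
  have [d d0 H] := equi _ e3; exists d => // x y xy.
  have [n [[h1 h2] h3]] := filter_ex (filterI (filterI (gv x _ e3) (gv y _ e3)) H).
  have h4 := h3 x y xy.
  move: h1 h2 h4; rewrite /= !ler_norml; lra.
exists g.
  move=> x; apply/cvgrPdist_le => eps eps0.
  have [d d0 H] := gequi _ eps0.
  apply: filterS (nbhsx_ballx x d d0) => y /= /ltW.
  exact: H.
move=> eps eps0; have e3 : 0 < eps / 3 by rewrite divr_gt0.
have [d1 d10 H1] := equi _ e3.
have [d2 d20 H2] := gequi _ e3.
pose d := Num.min d1 d2; have d0 : 0 < d by rewrite lt_min d10.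
pose M := (Num.truncn d^-1).+1.
have M0 : 0 < M%:R :> R by [].
have Md : d^-1 < M%:R by exact: truncnS_gt.
have grid : \forall n \near G, forall p, (p < M.+1)%N ->
    `|g (p%:R / M%:R) - v n (node_index n (p%:R / M%:R))| <= eps / 3.
  by apply: ultra_forall_lt => p _; exact: gv.
apply: filterS2 H1 grid => n H1n gn k kn.
have /andP[] : 0 <= (k.+1%:R / n%:R : R) <= 1 by exact: node01.
have := node_indexK kn; set x := k.+1%:R / n%:R => <- x0 x1.
pose p := Num.truncn (M%:R * x).
have Mx0 : 0 <= M%:R * x by rewrite mulr_ge0.
have /andP[p1 p2] := truncn_itv Mx0.
have pM : (p < M.+1)%N.
  rewrite ltnS -(ler_nat R); apply: le_trans p1 _.
  by rewrite -[leRHS]mulr1 ler_pM2l.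
have xp : `|x - p%:R / M%:R| <= d.
  have dM : M%:R^-1 <= d by rewrite invf_ple ?posrE// ltW.
  have pe : p%:R / M%:R <= x by rewrite ler_pdivrMr// mulrC.
  have px : x <= p%:R / M%:R + M%:R^-1.
    by rewrite -[X in _ + X]mul1r -mulrDl natr1 ler_pdivlMr// mulrC ltW.
  rewrite ger0_norm ?subr_ge0//; lra.
have h1 := H1n x (p%:R / M%:R); have h2 := H2 x (p%:R / M%:R).
have h3 := gn p pM.
have [dd1 dd2] : d <= d1 /\ d <= d2 by rewrite !ge_min !lexx orbT.
have {}h1 := h1 (le_trans xp dd1); have {}h2 := h2 (le_trans xp dd2).
move: h1 h2 h3; rewrite !ler_norml; lra.
Qed.

End ultralimit.

(** * Passage to the limit in the eigenvalue equation *)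
Section nodes.
Context {R : realType}.

Lemma node_index_near n (x : R) : (0 < n)%N -> 0 <= x <= 1 ->
  `|x - (node_index n x).+1%:R / n%:R| <= n%:R^-1.
Proof.
move=> n1 /andP[x0 x1]; have n0 : 0 < n%:R :> R by rewrite ltr0n.
have nx0 : 0 <= n%:R * x by rewrite mulr_ge0.
have /andP[t1 t2] := truncn_itv nx0.
have nxn : n%:R * x <= n%:R by rewrite -[leRHS]mulr1 ler_pM2l.
have tn : (Num.truncn (n%:R * x) <= n)%N by rewrite -(ler_nat R) (le_trans t1).
rewrite -(ler_pM2l n0) mulfV ?gt_eqF// -[X in X * _](ger0_norm (ltW n0)) -normrM mulrBr.
rewrite [n%:R * (_ / _)]mulrC divfK ?gt_eqF// /node_index.
case: (Num.truncn (n%:R * x)) t1 t2 tn => [|t] t1 t2 tn /=.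
  by rewrite minn0 ler_norml; apply/andP; lra.
rewrite (minn_idPr _); last by lia.
by move: t1 t2; rewrite -!natr1 ler_norml => t1 t2; apply/andP; lra.
Qed.

Lemma exists_forall_lt (P : nat -> nat -> Prop) (M : nat) :
  (forall p, (p < M)%N -> exists N : nat, forall n, (N <= n)%N -> P n p) ->
  exists N : nat, forall n, (N <= n)%N -> forall p, (p < M)%N -> P n p.
Proof.
elim: M => [|M IH] H; first by exists 0%N.
have [|N1 H1] := IH; first by move=> p pM; apply: H; exact: ltnW.
have [N2 H2] := H M (ltnSn M); exists (maxn N1 N2) => n.
rewrite geq_max => /andP[n1 n2] p; rewrite ltnS leq_eqVlt => /orP[/eqP->|]; first exact: H2.
exact: H1.
Qed.

Lemma mean_le (n : nat) (a : nat -> R) (e : R) : (0 < n)%N ->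
  (forall l, (l < n)%N -> `|a l| <= e) -> `|n%:R^-1 * \sum_(l < n) a l| <= e.
Proof.
move=> n1 ae; have n0 : 0 < n%:R :> R by rewrite ltr0n.
rewrite normrM ger0_norm ?invr_ge0// ler_pdivrMl//.
apply: (le_trans (ler_norm_sum _ _ _)).
rewrite -[n%:R]/(n%:R) mulrC mulr_natr -[X in _ *+ X](card_ord n) -sumr_const.
by apply: ler_sum => l _; exact: ae.
Qed.

(** Each t_m is at most 1 in absolute value, so the p^2 entries contribute at most
    [e] each. *)
Lemma form_near_diag (p : nat) (t q : nat -> R) (Q : nat -> nat -> R) (e : R) : 0 <= e ->
  \sum_(m < p) t m ^+ 2 = 1 ->
  (forall m m', (m < p)%N -> (m' < p)%N -> `|Q m m' - q m * (m == m')%:R| <= e) ->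
  `|\sum_(m < p) \sum_(m' < p) t m * t m' * Q m m' - \sum_(m < p) t m ^+ 2 * q m| <=
    e * (p%:R * p%:R).
Proof.
move=> e0 t1 Qq.
have tle (m : 'I_p) : `|t m| <= 1.
  rewrite -(@ler_pXn2r _ 2) ?nnegrE// expr1n real_normK ?num_real// -t1 (bigD1 m)//= lerDl.
  by apply: sumr_ge0 => k _; exact: sqr_ge0.
rewrite -sumrB; apply: (le_trans (ler_norm_sum _ _ _)).
apply: le_trans (_ : \sum_(m < p) e * p%:R <= _); last first.
  by rewrite sumr_const card_ord -[_ *+ p]mulr_natr mulrA.
apply: ler_sum => m _.
have -> : t m ^+ 2 * q m = \sum_(m' < p) t m * t m' * (q m * (m == m' :> nat)%:R).
  rewrite (bigD1 m)//= eqxx mulr1 big1 ?addr0 ?expr2// => m' m'm.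
  by rewrite eq_sym (negbTE (m'm : (m' != m :> nat))) !mulr0.
rewrite -sumrB; apply: (le_trans (ler_norm_sum _ _ _)).
apply: le_trans (_ : \sum_(m' < p) e <= _); last by rewrite sumr_const card_ord mulr_natr.
apply: ler_sum => m' _; rewrite -mulrBr !normrM -[leRHS]mul1r.
apply: ler_pM; [by rewrite mulr_ge0|by []| |exact: Qq].
by rewrite -[leRHS]mul1r; apply: ler_pM.
Qed.

End nodes.

Section discrete_limits.
Context {R : realType}.
Variable L : R -> R.
Hypothesis Lpos : forall x, 0 <= x -> 0 < L x.
Hypothesis Lcvg : forall a, 0 < a -> L (a * x) / L x @[x --> +oo] --> (1 : R).
Hypothesis Lmeas : lebesgue_measurable_fun `[0, +oo[ L.
Variable rho : R.
Hypothesis hrho : 0 < rho < 1.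

Lemma scaled_toeplitzB n v w k : scaled_toeplitz L rho n (fun l => v l - w l) k = scaled_toeplitz L rho n v k - scaled_toeplitz L rho n w k.
Proof.
rewrite /scaled_toeplitz -mulrBr -sumrB; congr (_ * _).
by apply: eq_bigr => l _; exact: mulrBr.
Qed.

Lemma scaled_toeplitz_sum n p (t : nat -> R) (V : nat -> nat -> R) k :
  scaled_toeplitz L rho n (fun l => \sum_(m < p) t m * V m l) k = \sum_(m < p) t m * scaled_toeplitz L rho n (V m) k.
Proof.
transitivity (n%:R^-1 * \sum_(m < p) t m * \sum_(l < n) weight L rho n (dist k l) * V m l).
  congr (_ * _); under eq_bigr do rewrite mulr_sumr.
  rewrite exchange_big/=; apply: eq_bigr => m _; rewrite mulr_sumr.
  by apply: eq_bigr => l _; rewrite mulrCA.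
by rewrite mulr_sumr; apply: eq_bigr => m _; rewrite mulrCA.
Qed.

Variable G : set_system nat.
Hypothesis UG : UltraFilter G.
Hypothesis Goo : forall N : nat, G [set n | (N <= n)%N].
Let PG : ProperFilter G. Proof. exact: ultra_proper. Qed.
#[local] Existing Instance PG.

Let cvg_nodes (v : nat -> nat -> R) (g : R -> R) := forall eps : R, 0 < eps ->
  \forall n \near G, forall k, (k < n)%N -> `|v n k - g (k.+1%:R / n%:R)| <= eps.

(** At a node within 1/n of [x], the equation for g is compared with the equation for
    v_n through [scaled_toeplitz_bounded], applied to the error v_n - g, and
    [scaled_toeplitz_consistent], applied to g. *)
Lemma limit_riesz (nu : nat -> R) (v : nat -> nat -> R) (nu' B : R) (g : R -> R) :
  continuous g -> cvg_nodes v g ->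
  (forall eps : R, 0 < eps -> \forall n \near G, `|nu' - nu n| <= eps) ->
  (\forall n \near G, forall k, (k < n)%N -> `|v n k| <= B) ->
  (\forall n \near G, forall k, (k < n)%N -> scaled_toeplitz L rho n (v n) k = nu n * v n k) ->
  riesz_eigenfunction rho nu' g.
Proof.
move=> cg vg nunu vB ev; split=> // x x01.
have [M M0 gM] := continuous_bounded01 (continuous_subspaceT cg).
have ch : continuous (fun y => 1 * riesz_op rho g y + (- nu') * g y).
  apply: continuous_lin => //; apply: (riesz_continuous hrho (M := M)).
    exact: continuous_measurable_unit.
  by move=> y; rewrite /= in_itv/= => /andP[/ltW y0 /ltW y1]; apply: gM; rewrite y0.
have [N1 [C C0 Cb]] := scaled_toeplitz_bounded Lpos Lcvg Lmeas hrho.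
pose K := C + 2 + `|B| + `|nu'|.
have K0 : 0 < K by have := normr_ge0 B; have := normr_ge0 nu'; rewrite /K; lra.
apply/eqP; rewrite -subr_eq0 -normr_le0; apply/ler_addgt0Pr => e e0; rewrite add0r.
have eK0 : 0 < e / K by rewrite divr_gt0.
have eE : e = e / K * K by rewrite divfK// gt_eqF.
move: (e / K) eK0 eE => eps eps0 ->.
have [d d0 hd] := heine_unit ch eps0.
have [N2 cons] := scaled_toeplitz_consistent Lpos Lcvg Lmeas hrho eps0 cg.
have := filter_ex (filterI (filterI (filterI (vg eps eps0) (nunu eps eps0)) (filterI vB ev))
  (filterI (ultra_archimedean UG Goo d^-1) (filterI (Goo 1) (filterI (Goo N1) (Goo N2))))).
move=> [n [[[vgn nun] [vBn evn]] [nd [n1 [nN1 nN2]]]]].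
have kn := node_index_lt x n1; have xk := node_index_near n1 x01.
set k := node_index n x in kn xk; set y := k.+1%:R / n%:R in xk.
have n0 : 0 < n%:R :> R by rewrite ltr0n.
have nd' : n%:R^-1 <= d by rewrite invf_ple ?posrE// ltW.
have h1 := hd x y x01 (le_trans xk nd').
have h2 := cons n nN2 k kn; rewrite -/y in h2.
have h3 : `|scaled_toeplitz L rho n (fun l => v n l - g (l.+1%:R / n%:R)) k| <= C * eps.
  by apply: Cb => // l ln; exact: vgn.
rewrite scaled_toeplitzB evn// in h3.
have h4 := vgn k kn; rewrite -/y in h4.
have h5 : `|(nu' - nu n) * v n k| <= eps * `|B|.
  by rewrite normrM; apply: ler_pM => //; apply: le_trans (ler_norm B); exact: vBn.
have h6 : `|nu' * (v n k - g y)| <= `|nu'| * eps by rewrite normrM ler_wpM2l.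
move: h1 h2 h3 h5 h6 {h4 cons vgn vBn evn Cb}; rewrite /K !(mulrDr eps).
rewrite [eps * C]mulrC [eps * `|nu'|]mulrC mulrBl mulrBr !mul1r !mulNr.
move: (C * eps) (eps * `|B|) (`|nu'| * eps) (nu n * _) (nu' * v n k) (nu' * g y) (nu' * g x).
move: (scaled_toeplitz _ _ _ _ _) (riesz_op _ _ _) (riesz_op _ _ _) => T S1 S2 a b c z1 z2 z3 z4.
rewrite !ler_norml => /andP[? ?] /andP[? ?] /andP[? ?] /andP[? ?] /andP[? ?]; apply/andP; lra.
Qed.

Lemma limit_inner (v w : nat -> nat -> R) (g h : R -> R) (B c : R) :
  continuous g -> continuous h -> cvg_nodes v g -> cvg_nodes w h ->
  (\forall n \near G, forall k, (k < n)%N -> `|v n k| <= B) ->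
  (\forall n \near G, n%:R^-1 * \sum_(l < n) v n l * w n l = c) ->
  L2_inner g h = c.
Proof.
move=> cg ch vg wh vB vw.
have [M M0 hM] := continuous_bounded01 (continuous_subspaceT ch).
pose K := `|B| + M + 1.
have K0 : 0 < K by have := normr_ge0 B; rewrite /K; lra.
apply/eqP; rewrite -subr_eq0 -normr_le0; apply/ler_addgt0Pr => e e0; rewrite add0r.
have eK0 : 0 < e / K by rewrite divr_gt0.
have eE : e = e / K * K by rewrite divfK// gt_eqF.
move: (e / K) eK0 eE => eps eps0 ->.
have [N1 H1] := riemann_sum_cvg (continuous_mul cg ch) eps0.
have := filter_ex (filterI (filterI (vg eps eps0) (wh eps eps0)) (filterI (filterI vB vw)
  (filterI (Goo 1) (Goo N1)))).
move=> [n [[vgn whn] [[vBn vwn] [n1 nN1]]]].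
have h1 := H1 n nN1.
have h2 : `|n%:R^-1 * \sum_(l < n) (v n l * w n l -
    g (l.+1%:R / n%:R) * h (l.+1%:R / n%:R))| <= eps * (`|B| + M).
  apply: (mean_le (a := fun l => v n l * w n l -
      g (l.+1%:R / n%:R) * h (l.+1%:R / n%:R))) => // l ln.
  set y := _ / _.
  have -> : v n l * w n l - g y * h y = v n l * (w n l - h y) + h y * (v n l - g y) by ring.
  apply: (le_trans (ler_normD _ _)); rewrite !normrM mulrDr; apply: lerD.
    rewrite mulrC; apply: ler_pM => //; first exact: whn.
    by apply: le_trans (ler_norm B); exact: vBn.
  rewrite mulrC; apply: ler_pM => //; first exact: vgn.
  by apply: hM; exact: node01.
rewrite sumrB mulrBr vwn in h2; rewrite /L2_inner.
have -> : eps * K = eps * (`|B| + M) + eps by rewrite /K; ring.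
move: h1 h2 {H1 vgn whn vBn vwn}.
move: (eps * _) (n%:R^-1 * _) (Rintegral _ _ _) => z1 z2 z3.
rewrite !ler_norml => /andP[? ?] /andP[? ?]; apply/andP; lra.
Qed.

(** Read the equation at an entry of largest absolute value. *)
Lemma eigvec_eigenvalue_le : exists N : nat, exists2 C : R, 0 < C & forall n, (N <= n)%N ->
  forall nu v, eigvec L rho n nu v -> `|nu| <= C.
Proof.
have [N [C C0 H]] := scaled_toeplitz_bounded Lpos Lcvg Lmeas hrho.
exists N, C => // n nN nu v [ev v1].
pose B := \big[Num.max/0]_(l < n) `|v l|.
have vB l : (l < n)%N -> `|v l| <= B.
  by move=> ln; apply: (@le_bigmax _ _ _ 0 (fun i : 'I_n => `|v i|) (Ordinal ln)).
have B0 : 0 < B.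
  rewrite lt_def; apply/andP; split; last by exact: bigmax_ge_id.
  apply/eqP => B0; have := v1; rewrite big1 ?mulr0 => [/esym/eqP|l _]; first by rewrite oner_eq0.
  have := vB l (ltn_ord l); rewrite B0 normr_le0 => /eqP ->.
  by rewrite expr0n.
rewrite leNgt; apply/negP => Cnu.
have nu0 : 0 < `|nu| by exact: lt_trans Cnu.
have : B <= C * B / `|nu|.
  apply: bigmax_le => [|l _]; first by rewrite divr_ge0// mulr_ge0// ltW.
  rewrite ler_pdivlMr// mulrC -normrM -ev//; exact: H.
by rewrite ler_pdivlMr// leNgt [C * B]mulrC ltr_pM2l// Cnu.
Qed.

End discrete_limits.

(** * Identification of the limits *)
Section spectral_limit.
Context {R : realType}.
Variable L : R -> R.
Hypothesis Lpos : forall x, 0 <= x -> 0 < L x.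
Hypothesis Lcvg : forall a, 0 < a -> L (a * x) / L x @[x --> +oo] --> (1 : R).
Hypothesis Lmeas : lebesgue_measurable_fun `[0, +oo[ L.
Variable rho : R.
Hypothesis hrho : 0 < rho < 1.
Variables (lm : nat -> R) (Phi : nat -> R -> R).
Hypothesis lm_pos : forall i, 0 < lm i.
Hypothesis lm_decr : forall i k, (i <= k)%N -> lm k <= lm i.
Hypothesis Phi_eigen : forall i, riesz_eigenfunction rho (lm i) (Phi i).
Hypothesis Phi_orth : forall i k, L2_inner (Phi i) (Phi k) = (i == k)%:R.
Hypothesis Phi_complete : forall nu g, 0 < nu -> riesz_eigenfunction rho nu g ->
  L2_inner g g = 1 -> exists k, nu = lm k.

Lemma mean_bilinear n p (t : nat -> R) (V W : nat -> nat -> R) :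
  n%:R^-1 * \sum_(k < n) (\sum_(m < p) t m * V m k) * (\sum_(m < p) t m * W m k) =
  \sum_(m < p) \sum_(m' < p) t m * t m' * (n%:R^-1 * \sum_(k < n) V m k * W m' k).
Proof.
under eq_bigr do rewrite big_distrlr/=.
rewrite exchange_big/= mulr_sumr; apply: eq_bigr => m _.
rewrite exchange_big/= mulr_sumr; apply: eq_bigr => m' _.
by rewrite mulrCA; congr (_ * _); rewrite mulr_sumr; apply: eq_bigr => k _; ring.
Qed.

Lemma discrete_forms_cvg (e : R) (m m' : nat) : 0 < e -> exists N, forall n, (N <= n)%N ->
  `|n%:R^-1 * \sum_(k < n) Phi m (k.+1%:R / n%:R) * Phi m' (k.+1%:R / n%:R) -
    1 * (m == m')%:R| <= e /\
  `|n%:R^-1 * \sum_(k < n) Phi m (k.+1%:R / n%:R) *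
      scaled_toeplitz L rho n (fun l => Phi m' (l.+1%:R / n%:R)) k - lm m * (m == m')%:R| <= e.
Proof.
move=> e0; have [cm _] := Phi_eigen m; have [cm' em'] := Phi_eigen m'.
have [M M0 PM] := continuous_bounded01 (continuous_subspaceT cm).
have lm0 := lm_pos m'.
pose e3 := Num.min e (e / 2 / lm m').
have e30 : 0 < e3 by rewrite lt_min e0 !divr_gt0.
have [e3e e3l] : e3 <= e /\ e3 <= e / 2 / lm m' by rewrite !ge_min !lexx orbT.
have e20 : 0 < e / 2 / M by rewrite !divr_gt0.
have [N1 H1] := riemann_sum_cvg (continuous_mul cm cm') e30.
have [N2 H2] := scaled_toeplitz_consistent Lpos Lcvg Lmeas hrho e20 cm'.
exists (maxn 1 (maxn N1 N2)) => n; rewrite !geq_max => /and3P[n1 nN1 nN2].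
have := H1 n nN1; have := Phi_orth m m'; rewrite /L2_inner => ->.
set S := n%:R^-1 * _ => hS; split; first by rewrite mul1r (le_trans hS).
have h2 : `|n%:R^-1 * \sum_(k < n) (Phi m (k.+1%:R / n%:R) *
    (scaled_toeplitz L rho n (fun l => Phi m' (l.+1%:R / n%:R)) k - lm m' * Phi m' (k.+1%:R / n%:R)))| <= e / 2.
  apply: (mean_le (a := fun k => Phi m (k.+1%:R / n%:R) *
    (scaled_toeplitz L rho n (fun l => Phi m' (l.+1%:R / n%:R)) k - lm m' * Phi m' (k.+1%:R / n%:R)))) => //.
  move=> k kn; rewrite normrM -[leRHS](divfK (lt0r_neq0 M0)) mulrC; apply: ler_pM => //.
    by rewrite -em' ?node01//; exact: H2.
  by apply: PM; exact: node01.
have h3 : `|lm m' * (S - (m == m')%:R)| <= e / 2.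
  by rewrite normrM gtr0_norm// -ler_pdivlMl// mulrC (le_trans hS).
have -> : lm m * (m == m')%:R = lm m' * (m == m')%:R.
  by case: eqP => [->//|_]; rewrite !mulr0.
move: h2; under eq_bigr do rewrite mulrBr [_ * (lm m' * _)]mulrCA.
rewrite sumrB mulrBr -mulr_sumr [_ * (lm m' * _)]mulrCA -/S => h2.
move: h2 h3; rewrite mulrBr.
move: (n%:R^-1 * _) (lm m' * S) (lm m' * _) => a b c.
by rewrite !ler_norml => /andP[? ?] /andP[? ?]; apply/andP; lra.
Qed.

(** On the span of the sampled eigenfunctions Phi_0, ..., Phi_i the quadratic form of
    the matrix is close to the diagonal form with coefficients lm_m >= lm_i, and the
    mean square is close to 1; Courant-Fischer compares them with nu_i. *)
Lemma eigenvalue_liminf i (eps : R) : 0 < eps -> exists N, forall n, (N <= n)%N ->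
  forall nu v, (i < n)%N -> eigensystem L rho n nu v -> lm i - eps <= nu i.
Proof.
move=> eps0; have lmi0 := lm_pos i.
have li1 : 0 < lm i + 1 by rewrite addr_gt0.
have [d [d0 d1 d2 d3]] : exists d, [/\ 0 < d, d <= 2^-1, d <= lm i / 2 & d <= eps / (lm i + 1)].
  exists (Num.min 2^-1 (Num.min (lm i / 2) (eps / (lm i + 1)))).
  by rewrite !lt_min !divr_gt0// invr_gt0 ltr0n !ge_min !lexx !orbT.
pose p := i.+1.
have pp : 0 < p%:R * p%:R :> R by rewrite mulr_gt0 ?ltr0n.
pose e := d / (p%:R * p%:R); have e0 : 0 < e by rewrite divr_gt0.
have eE : e * (p%:R * p%:R) = d by rewrite divfK// gt_eqF.
have [N HN] := exists_forall_lt (fun m (mp : (m < p)%N) =>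
  exists_forall_lt (fun m' (mp' : (m' < p)%N) => discrete_forms_cvg m m' e0)).
exists N => n nN nu v ilt [_ _ _ minimax]; have {}HN := HN n nN.
pose V m k := Phi m (k.+1%:R / n%:R).
have [t [t1 /=]] := minimax i ilt V.
under eq_bigr do rewrite scaled_toeplitz_sum.
under [X in _ <= _ * (_ * X)]eq_bigr do rewrite expr2.
rewrite (mean_bilinear n p t V (fun m => scaled_toeplitz L rho n (V m))) (mean_bilinear n p t V V).
set QB := \sum_(m < p) _; set QG := \sum_(m < p) _ => H.
have hB : `|QB - \sum_(m < p) t m ^+ 2 * lm m| <= d.
  rewrite -eE; apply: (form_near_diag (Q := fun m m' => n%:R^-1 *
    \sum_(k < n) V m k * scaled_toeplitz L rho n (V m') k) (ltW e0) t1) => m m' mp mp'.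
  exact: (HN m mp m' mp').2.
have : `|QG - \sum_(m < p) t m ^+ 2 * 1| <= d.
  rewrite -eE; apply: (form_near_diag (q := fun=> 1) (Q := fun m m' => n%:R^-1 *
    \sum_(k < n) V m k * V m' k) (ltW e0) t1) => m m' mp mp'.
  exact: (HN m mp m' mp').1.
move: hB; clearbody QB QG.
have -> : \sum_(m < p) t m ^+ 2 * 1 = 1 by rewrite -[RHS]t1; apply: eq_bigr => m _; rewrite mulr1.
have : lm i <= \sum_(m < p) t m ^+ 2 * lm m.
  rewrite -[leLHS]mul1r -t1 mulr_suml; apply: ler_sum => m _; apply: ler_wpM2l.
    exact: sqr_ge0.
  by apply: lm_decr; rewrite -ltnS.
move: (\sum_(m < p) _ * lm m) => q lmq; rewrite !ler_norml => /andP[hB _] /andP[hG1 hG2].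
have d3' : d * (lm i + 1) <= eps by rewrite -ler_pdivlMr.
rewrite leNgt; apply/negP => hnu.
have nu0 : 0 < nu i.
  rewrite ltNge; apply/negP => nu0; have : nu i * QG <= 0 by apply: mulr_le0_ge0 => //; lra.
  lra.
have : nu i * QG <= nu i * (1 + d) by rewrite ler_pM2l//; lra.
have : nu i * (1 + d) < (lm i - eps) * (1 + d) by rewrite ltr_pM2r//; lra.
have : 0 < d * eps by rewrite mulr_gt0.
rewrite mulrDr in d3'; rewrite mulrBl !mulrDr !mulr1 [lm i * d]mulrC [eps * d]mulrC.
lra.
Qed.

Section along_ultrafilter.
Variable G : set_system nat.
Hypothesis UG : UltraFilter G.
Hypothesis Goo : forall N : nat, G [set n | (N <= n)%N].
Let PG : ProperFilter G. Proof. exact: ultra_proper. Qed.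
#[local] Existing Instance PG.
Variables (nu : nat -> nat -> R) (v : nat -> nat -> nat -> R).
Hypothesis sys : \forall n \near G, eigensystem L rho n (nu n) (v n).

Lemma ultralimit_eigenpair i : exists (z : R * (R -> R) * R),
  [/\ lm i <= z.1.1, riesz_eigenfunction rho z.1.1 z.1.2,
    \forall n \near G, forall k, (k < n)%N -> `|v n i k| <= z.2 &
    forall eps, 0 < eps -> \forall n \near G, forall k, (k < n)%N ->
      `|v n i k - z.1.2 (k.+1%:R / n%:R)| <= eps].
Proof.
have ev : \forall n \near G, eigvec L rho n (nu n i) (v n i).
  apply: filterS2 sys (Goo i.+1) => n [_ H1 H2 _] ilt; split; first exact: H1.
  have := H2 i i ilt ilt; rewrite eqxx => E.
  by rewrite -[RHS]E; congr (_ * _); apply: eq_bigr => k _; rewrite expr2.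
have [nu' nuE] : exists nu' : R, forall eps : R, 0 < eps ->
    \forall n \near G, `|nu' - nu n i| <= eps.
  have [N [C C0 H]] := eigvec_eigenvalue_le Lpos Lcvg Lmeas hrho.
  apply: (ultra_limit UG (B := C)); apply: filterS2 ev (Goo N) => n evn nN.
  exact: H evn.
have lmnu : lm i <= nu'.
  apply/ler_addgt0Pr => e e0; have e2 : 0 < e / 2 by rewrite divr_gt0.
  have [N H] := eigenvalue_liminf i e2.
  have [n [[h1 h2] [nN ilt]]] := filter_ex (filterI (filterI (nuE _ e2) sys)
    (filterI (Goo N) (Goo i.+1))).
  by have := H n nN _ _ ilt h2; move: h1; rewrite ler_norml => /andP[? ?]; lra.
have nu00 : 0 < lm i / 2 by rewrite divr_gt0.
have nulb : \forall n \near G, lm i / 2 <= nu n i.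
  apply: filterS (nuE _ nu00) => n; rewrite ler_norml => /andP[? ?]; lra.
have [N1 [B B0 HB]] := eigvec_bounded Lpos Lcvg Lmeas hrho nu00.
have vB : \forall n \near G, forall k, (k < n)%N -> `|v n i k| <= B.
  by apply: filterS3 nulb ev (Goo N1) => n h1 h2 h3; exact: HB h3 _ _ h1 h2.
have [eta eta0|g cg gE] := ultra_ascoli UG Goo vB.
  have [N [d d0 H]] := eigvec_equicontinuous Lpos Lcvg Lmeas hrho nu00 B0 eta0.
  exists d => //; apply: filterS2 (filterI nulb ev) (filterI vB (Goo N)) => n [h1 h2] [h3 h4].
  exact: H h4 _ _ h1 h2 h3.
exists (nu', g, B); split=> //=.
apply: (limit_riesz Lpos Lcvg Lmeas hrho UG Goo cg gE nuE vB).
by apply: filterS ev => n [].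
Qed.

(** By strong induction the limit nu'_k is lm_k: it is some lm_l, and l < k is excluded
    because g_k would then be g_l or - g_l, against their orthogonality; for l >= k,
    lm_k <= nu'_k = lm_l <= lm_k. *)
Lemma ultralimit_sign i (F : R -> R) : riesz_eigenfunction rho (lm i) F -> L2_inner F F = 1 ->
  exists b : bool, forall eps : R, 0 < eps -> \forall n \near G, forall k, (k < n)%N ->
    `|(-1) ^+ b * v n i k - F (k.+1%:R / n%:R)| <= eps.
Proof.
move=> eF FF; have /choice[z zE] := ultralimit_eigenpair.
pose g i := (z i).1.2; pose nu' i := (z i).1.1.
have lmnu k : lm k <= nu' k by have [] := zE k.
have ge k : riesz_eigenfunction rho (nu' k) (g k) by have [] := zE k.
have gg a b : L2_inner (g a) (g b) = (a == b)%:R.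
  have [_ [ca _] va Ea] := zE a; have [_ [cb _] _ Eb] := zE b.
  apply: (limit_inner UG Goo ca cb Ea Eb va).
  apply: filterS3 sys (Goo a.+1) (Goo b.+1) => n [_ _ H _] an bn; exact: H.
have nu'0 k : 0 < nu' k by exact: lt_le_trans (lm_pos k) (lmnu k).
have nuE k : nu' k = lm k.
  elim/ltn_ind: k => k IH.
  have [l nul] : exists l, nu' k = lm l.
    by apply: Phi_complete (ge k) _ => //; rewrite gg eqxx.
  case: (ltnP l k) => [lk|kl]; last first.
    by apply/eqP; rewrite eq_le lmnu nul lm_decr.
  have el : riesz_eigenfunction rho (nu' k) (g l) by rewrite nul -IH.
  have [||b hb] := riesz_eigenfunction_sign hrho (nu'0 k) el (ge k).
  - by rewrite gg eqxx.
  - by rewrite gg eqxx.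
  have : L2_inner (g l) (g k) = (-1) ^+ b * L2_inner (g l) (g l).
    have [cl _] := ge l.
    rewrite /L2_inner -RintegralZl//; last by apply: continuous_integrable_unit; exact: continuous_mul.
    apply: eq_Rintegral => x; rewrite inE/= in_itv/= => /andP[/ltW x0 /ltW x1].
    by rewrite hb ?x0// mulrCA.
  by rewrite !gg eqxx (ltn_eqF lk) mulr1 => /esym/eqP; rewrite signr_eq0.
have eg : riesz_eigenfunction rho (lm i) (g i) by rewrite -nuE.
have gi1 : L2_inner (g i) (g i) = 1 by rewrite gg eqxx.
have [b hb] := riesz_eigenfunction_sign hrho (lm_pos i) eF eg FF gi1.
exists b => eps eps0; have [_ _ _ H] := zE i.
apply: filterS (H eps eps0) => n Hn k kn.
have := Hn k kn; rewrite -/(g i) hb ?node01//.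
have {1}-> : v n i k = (-1) ^+ b * ((-1) ^+ b * v n i k) by rewrite signrMK.
by rewrite -mulrBr normrMsign.
Qed.

End along_ultrafilter.
End spectral_limit.

(** * Convergence of the eigenvectors *)
Section final.
Context {R : realType}.

(** If [P] failed infinitely often, the tails of its failures would generate a proper
    filter, contained in some ultrafilter. *)
Lemma ultra_eventually (P : nat -> Prop) :
  (forall G : set_system nat, UltraFilter G -> (forall N : nat, G [set n | (N <= n)%N]) ->
    \forall n \near G, P n) ->
  \forall n \near \oo, P n.
Proof.
move=> H; apply: contrapT => notP.
pose bad := [set n | ~ P n].
have PF : ProperFilter (within bad \oo).
  apply: Build_ProperFilter => bad0; apply: notP.
  by apply: (@filterS _ \oo _ [set n | bad n -> False]) => [n nbad|//]; apply: contrapT.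
have [G [UG subG]] := ultraFilterLemma PF.
have Goo N : G [set n | (N <= n)%N].
  apply: subG; apply: (@filterS _ \oo _ [set n | (N <= n)%N]) => [n nN _//|].
  exact: nbhs_infty_ge.
have Gbad : G bad by apply: subG; apply: (@filterE _ \oo _) => n.
have PG : ProperFilter G by exact: ultra_proper.
by have [n [nbad Pn]] := filter_ex (filterI Gbad (H G UG Goo)).
Qed.

End final.

Unset Implicit Arguments.

Theorem proposition2p2 (R : realType) (rho : R) (hrho : 0 < rho < 1)
    (L1 : R -> R) (hL1 : slowly_varying L1)
    (hL1_measurable : lebesgue_measurable_fun `[0, +oo[ L1)
    (hL1_bounded : [locally [bounded L1 x | x in `[0, +oo[]])
    (hT : forall n, (0 < n)%N ->
      positive_semidefinite (toeplitz (autocov rho L1) n))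
    (j : nat) (hj : (0 < j)%N)
    (lam : R) (hlam : riesz_lambda rho j lam)
    (f : R -> R) (hf : riesz_normalized_eigenfunction rho lam f)
    (lamT : nat -> R)
    (hlamT : forall n, (j <= n)%N ->
      mx_lambda (toeplitz (autocov rho L1) n) j (lamT n))
    (u : forall n, 'cV[R]_n)
    (hu : forall n, (j <= n)%N ->
      mx_normalized_eigenvector (toeplitz (autocov rho L1) n) (lamT n) (u n)) :
  exists e : nat -> bool,
    \big[Num.max/0]_(k < n)
       `|Num.sqrt n%:R * ((-1) ^+ e n * u n k 0) - f (k.+1%:R / n%:R)|
      @[n --> \oo] --> (0 : R).
Proof.
have [Lpos Lcvg] := hL1; have Lmeas := hL1_measurable.
have [_ [lm [lmS [phi phiE]] lamE]] := hlam.
have [Phi [Phie Phio Phic]] := riesz_spectrum_continuous hrho (conj lmS (ex_intro _ phi phiE)).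
have lm_pos i : 0 < lm i by have /andP[l0 l1] := lmS i; exact: lt_le_trans l1.
have lm_decr i k : (i <= k)%N -> lm k <= lm i.
  move=> /subnK <-; elim: (k - i)%N => // m IH.
  by rewrite addSn; apply: le_trans IH; have /andP[] := lmS (m + i)%N.
have lam0 : 0 < lam by rewrite lamE.
have [F [eF FF Ff]] := riesz_normalized_regular hrho lam0 hf.
have : forall n, exists z : (nat -> R) * (nat -> nat -> R), (j <= n)%N ->
    eigensystem L1 rho n z.1 z.2 /\ forall k : 'I_n, z.2 j.-1 k = Num.sqrt n%:R * u n k 0.
  move=> n; case: (leqP j n) => jn; last by exists (fun=> 0, fun _ _ => 0).
  have [nu [v H]] := toeplitz_eigensystem Lpos (hlamT n jn) (hu n jn).
  by exists (nu, v).
move=> /choice[z zE].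
pose D n (b : bool) := \big[Num.max/0]_(k < n)
  `|Num.sqrt n%:R * ((-1) ^+ b * u n k 0) - f (k.+1%:R / n%:R)|.
(* the sign that makes the distance smaller is at least as good as the one, unknown
   beforehand, that works along a given ultrafilter *)
exists (fun n => D n true < D n false); apply/cvgrPdist_le => eps eps0.
apply: ultra_eventually => G UG Goo; have PG : ProperFilter G by exact: ultra_proper.
have sys : \forall n \near G, eigensystem L1 rho n (z n).1 (z n).2.
  by apply: filterS (Goo j) => n jn; exact: (zE n jn).1.
rewrite lamE in eF.
have [b Hb] := ultralimit_sign Lpos Lcvg Lmeas hrho lm_pos lm_decr Phie Phio Phic UG Goo sys eF FF.
apply: filterS2 (Goo j) (Hb eps eps0) => n jn Hn.
have Db : D n b <= eps.
  apply: bigmax_le => [|k _]; first exact: ltW.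
  have := Hn k (ltn_ord k); rewrite (zE n jn).2 Ff ?node01//.
  by rewrite mulrCA.
rewrite sub0r normrN ger0_norm; last by exact: bigmax_ge_id.
rewrite -/(D n _); apply: le_trans Db.
by case: b {Hb Hn} => /=; case: ltP => // /ltW.
Qed.
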